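(* Let $r\ge 1$ be an integer, let $\alpha_1,\ldots,\alpha_r$ be positive integers and $a_1,\ldots,a_r,b$ positive real numbers such that $c:=b-\frac12(a_1\alpha_1+\cdots+a_r\alpha_r)\neq 0$. Put $\beta=\alpha_1+\cdots+\alpha_r$. Let $U_{j\ell}$ ($1\le j\le r$, $1\le \ell\le\alpha_j$) be i.i.d. uniform random variables on $(0,1)$ and $V_j=U_{j1}+\cdots+U_{j\alpha_j}$. For $\mathrm{Re}(s)>\beta$ define the multiple hyperbolic tanh-moment function \[T_{\alpha,a}(s;b)=\sum_{n_1,\ldots,n_r=0}^{\infty}E\Big\{\frac{\binom{-\alpha_1}{n_1}\cdots\binom{-\alpha_r}{n_r}}{(a_1(n_1+V_1)+\cdots+a_r(n_r+V_r)+b)^s}\Big\}.\] Let $X_1,\ldots,X_r$ be independent random variables with $X_j\stackrel{d}{=}\frac12\hat T_{\alpha_j}$, where $\hat T_t$ denotes a random variable with characteristic function $E(e^{i\theta\hat T_t})=(\tanh\theta/\theta)^t$, $\theta\in\mathbb{R}$, and let $W_r=a_1X_1+\cdots+a_rX_r$ with distribution function $F_{W_r}$. Then \[T_{\alpha,a}(s;b)=2^{-\beta}\int_{\mathbb{R}}\frac{1}{(b+iw)^{s}}\,dF_{W_r}(w)=2^{-\beta}E\{(b+iW_r)^{-s}\},\quad \mathrm{Re}(s)>\beta,\] and $T_{\alpha,a}(s;b)$ extends analytically to an entire function of $s\in\mathbb{C}$.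
   Context: For integer $\gamma$, $\binom{\gamma}{0}=1$ and $\binom{\gamma}{n}=\gamma(\gamma-1)\cdots(\gamma-n+1)/n!$ for $n\in\mathbb{N}$. Complex powers are principal: $(b+iw)^s=\exp(s\,\mathrm{Log}(b+iw))$. The random variable $\hat T_t$ ($t>0$) exists, is symmetric about $0$, and has finite moments of all orders. *)

(* Defs.v *)
From HB Require Import structures.
From mathcomp Require Import all_boot all_order all_algebra.
From mathcomp Require Import all_classical all_reals all_analysis.
From mathcomp Require Import complex.
From mathcomp.analysis.showcase Require summability.

Set Implicit Arguments.
Unset Strict Implicit.
Unset Printing Implicit Defensive.

Import Order.TTheory GRing.Theory Num.Theory.
Import numFieldNormedType.Exports.

Local Open Scope classical_set_scope.
Local Open Scope ring_scope.
Local Open Scope complex_scope.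

Definition gbinom (R : realType) (g : int) (n : nat) : R :=
  (\prod_(k < n) (g%:~R - k%:R)) / n`!%:R.

Section complex_functions.
Context {R : realType}.
Implicit Types (z s : R[i]) (f : R[i] -> R[i]).

Definition expC z : R[i] :=
  (expR (complex.Re z) * cos (complex.Im z)) +i*
  (expR (complex.Re z) * sin (complex.Im z)).

(* principal argument in ]-pi, pi], unspecified at 0 *)
Definition argC z : R :=
  let t := acos (complex.Re z / ComplexField.Normc.normc z) in
  if 0 <= complex.Im z then t else - t.

Definition LogC z : R[i] := ln (ComplexField.Normc.normc z) +i* argC z.

Definition powC z s : R[i] := expC (s * LogC z).

(* R[i]^o is the normed module R[i] over itself, so the increment in the
   difference quotient is complex. *)
Definition entire f := forall s, derivable (f : R[i]^o -> R[i]^o) s 1.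

End complex_functions.

Section tanh.
Context {R : realType}.
Implicit Types x : R.

Definition tanh x : R := (expR x - expR (- x)) / (expR x + expR (- x)).

(* tanh x / x, with its limit value at 0 *)
Definition tanhc x : R := if x == 0 then 1 else tanh x / x.

End tanh.

Section complex_integral.
Context (d : measure_display) (T : measurableType d) (R : realType).

Definition integralC (mu : {measure set T -> \bar R}) (f : T -> R[i]) : R[i] :=
  (\int[mu]_x complex.Re (f x)) +i* (\int[mu]_x complex.Im (f x)).

Definition expectationC (P : probability T R) (X : T -> R[i]) : R[i] :=
  (fine 'E_P[fun w => complex.Re (X w)]) +i*
  (fine 'E_P[fun w => complex.Im (X w)]).

Definition char_fun (P : probability T R) (X : {RV P >-> R}) (theta : R) :
    R[i] :=
  expectationC P (fun w => expC (0 +i* (theta * X w))).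

Definition mutually_independent (P : probability T R) (I : finType)
    (X : I -> {RV P >-> R}) :=
  forall (J : {set I}) (A : I -> set R), (forall i, measurable (A i)) ->
    P (\bigcap_(i in [set` J]) X i @^-1` A i) =
    (\prod_(i in J) P (X i @^-1` A i))%E.

End complex_integral.

Definition eq_in_distribution (R : realType)
    (d1 : measure_display) (T1 : measurableType d1) (P1 : probability T1 R)
    (d2 : measure_display) (T2 : measurableType d2) (P2 : probability T2 R)
    (X1 : T1 -> R) (X2 : T2 -> R) :=
  forall A : set R, measurable A -> P1 (X1 @^-1` A) = P2 (X2 @^-1` A).

Section distribution_function.
Context (d : measure_display) (T : measurableType d) (R : realType).
Context (P : probability T R).
Variable X : {RV P >-> R}.

(* The library's cdf is \bar R-valued, but lebesgue_stieltjes_measure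
   takes a real-valued cumulative function. *)
Definition rcdf (x : R) : R := fine (cdf X x).

Let rcdf_nd : nondecreasing rcdf.
Proof. by move=> *; rewrite fine_le ?fin_num_measure// cdf_nondecreasing. Qed.

Let rcdf_rc : right_continuous rcdf.
Proof.
move=> a; apply: fine_cvg.
by rewrite fineK ?fin_num_measure//; exact: cdf_right_continuous.
Qed.

HB.instance Definition _ := isCumulative.Build R _ R rcdf rcdf_nd rcdf_rc.

End distribution_function.

Section tanh_moment.
Context (R : realType) (d : measure_display) (T : measurableType d).
Context (P : probability T R) (r : nat) (alpha : 'I_r -> nat) (a : 'I_r -> R).
Context (b : R) (U : forall j : 'I_r, 'I_(alpha j) -> {RV P >-> R}).

Definition Vsum (j : 'I_r) (w : T) : R := \sum_(l < alpha j) U l w.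

Definition tanh_moment_term (s : R[i]) (n : {ffun 'I_r -> nat}) : R[i] :=
  expectationC P (fun w =>
    (\prod_j gbinom R (- (alpha j)%:Z) (n j))%:C /
    powC ((\sum_j a j * ((n j)%:R + Vsum j w) + b)%:C) s).

(* The multiple series is summed unconditionally: the limit is along the
   finite subsets of N^r directed by inclusion. *)
Definition tanh_moment_cvg (s : R[i]) :=
  cvg (summability.partial_sum (tanh_moment_term s : _ -> R[i]^o)
       @ summability.totally).

Definition tanh_moment (s : R[i]) : R[i] :=
  summability.sum (tanh_moment_term s : _ -> R[i]^o).

End tanh_moment.

(* Main.v *)
(** Substituting [t = e^v] in Euler's integral gives, for [Re z > 0] and
    [Re s > 0], [Gamma(s) z^-s = int_R e^(s v - z e^v) dv].  Applied to each term
    of the series, with the Laplace transform [(1 - e^-x) / x] of a uniform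
    variable and the negative binomial series, it turns [Gamma(s) T(s; b)] into
    the integral of [e^(s v - b e^v)] times
    [prod_j ((1 - e^-x_j) / (x_j (1 + e^-x_j)))^alpha_j], where [x_j = a_j e^v].
    Each factor is half of [tanh(x_j / 2) / (x_j / 2)], so the product is
    [2^-beta] times the characteristic function of [W] at [e^v], and the same
    formula with [z = b + i W] identifies the integral with
    [2^-beta Gamma(s) E (b + i W)^-s].  Summation under the integral is allowed
    because replacing every coefficient by its absolute value changes the product
    into [prod_j x_j^-alpha_j], whence a bound by a multiple of
    [e^((Re s - beta) v - b e^v)].  The characteristic function of [W] has
    Taylor polynomials of every order at [0], so [W] has all moments; therefore
    [E e^(k |Log (b + i W)|)] is finite for every [k] and
    [s |-> E (b + i W)^-s] is entire. *)
Require Import Defs.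
From HB Require Import structures.
From mathcomp Require Import all_boot all_order all_algebra.
From mathcomp Require Import finmap all_classical all_reals all_analysis.
From mathcomp Require Import measurable_realfun complex ring lra.
From mathcomp.analysis.showcase Require summability.

Set Implicit Arguments.
Unset Strict Implicit.
Unset Printing Implicit Defensive.

Import Order.TTheory GRing.Theory Num.Theory.
Import numFieldNormedType.Exports.

Local Open Scope classical_set_scope.
Local Open Scope ring_scope.
Local Open Scope complex_scope.

Local Notation Re := complex.Re.
Local Notation Im := complex.Im.
Local Notation normc := ComplexField.Normc.normc.

(** * Complex exponential, logarithm and integrals *)

(** For complex [z] the Mellin formula says that Euler's integral may be taken along the horizontal
    line at height [arg z]. This is proved by real means: moving the line by [h] changes the
    integral by only [O(h^2)], hence not at all. The same translation argument replaces integration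
    by parts in [Gamma(s + 1) = s Gamma(s)].

    The two sides of the theorem are compared after multiplication by [Gamma(s)], so zeros of Gamma
    must be excluded. A zero at [s] would recur at every [s + n], whereas for [a] large against
    [Im s] the integrand concentrates near [v = ln a] and cannot cancel.

    The law of [W] is known only through its characteristic function. Symmetric differences of [cos]
    are used because at [0] they give the nonnegative integrand [(2 - 2 cos(h w))^k], which bounds
    truncated moments without assuming that any moment exists.

    The series is summed along arbitrary finite sets of indices. On cubes the sum factors into
    one-variable series; any other finite set is compared with a cube containing it, or contained in
    it. *)

Section real_estimates.
Context {R : realType}.
Implicit Types x y : R.

(** Controlling the intermediate point by [|c| <= |x|] alone treats both signs of [x] at once; the
    elementary bounds on [exp] and [sin] below all start from this form. *)
Lemma mean_value0 (f df : R -> R) (hf : forall x : R, is_derive x 1 f (df x)) x :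
  exists2 c, `|c| <= `|x| & f x - f 0 = df c * x.
Proof.
have cf : forall a b, {within `[a, b], continuous f}.
  move=> a b; apply: derivable_within_continuous => z _.
  by have [] := hf z.
have [x0|x0|->] := ltgtP x 0.
- have [c] := MVT x0 (fun z _ => hf z) (cf _ _).
  rewrite in_itv/= => /andP[c1 c2] h; exists c; last by rewrite -opprB h; ring.
  by rewrite !ltr0_norm// lerN2 ltW.
- have [c] := MVT x0 (fun z _ => hf z) (cf _ _).
  rewrite in_itv/= => /andP[c1 c2] h; exists c; last by rewrite h; ring.
  by rewrite !gtr0_norm// ltW.
- by exists 0 => //; rewrite subrr mulr0.
Qed.

Lemma expR_le_norm x y : `|x| <= `|y| -> expR x <= expR `|y|.
Proof. by move=> h; rewrite ler_expR (le_trans _ h)// ler_norm. Qed.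

Lemma norm_expR_sub1 x : `|expR x - 1| <= `|x| * expR `|x|.
Proof.
have [c cx] := mean_value0 (fun x => is_derive_expR x) x.
rewrite expR0 => ->; rewrite normrM mulrC ler_wpM2l// ger0_norm ?expR_ge0//.
exact: expR_le_norm.
Qed.

Lemma norm_expR_sub1_subx x : `|expR x - 1 - x| <= x ^+ 2 * expR `|x|.
Proof.
have h (z : R) : is_derive z 1 (fun z => expR z - z) (expR z - 1).
  by apply: is_deriveB.
have [c cx] := mean_value0 h x.
rewrite expR0 subr0 => e.
have -> : expR x - 1 - x = (expR c - 1) * x by rewrite -e; ring.
rewrite normrM -real_normK ?num_real// expr2 mulrC -mulrA ler_wpM2l//.
apply: (le_trans (norm_expR_sub1 c)); apply: ler_pM => //.
by rewrite ler_expR.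
Qed.

Lemma norm_sin_le x : `|sin x| <= `|x|.
Proof.
have [c cx] := mean_value0 (fun x => is_derive_sin x) x.
rewrite sin0 subr0 => ->; rewrite normrM ler_piMl// ler_norml cos_le1 cos_geN1//.
Qed.

Lemma oneB_cos_le x : 1 - cos x <= x ^+ 2 / 2.
Proof.
have -> : 1 - cos x = sin (x / 2) ^+ 2 *+ 2.
  have -> : cos x = cos ((x / 2) *+ 2) by congr cos; rewrite -mulr_natr; field.
  by rewrite cos_mulr2n cos2sin2; ring.
have : sin (x / 2) ^+ 2 <= (x / 2) ^+ 2.
  by rewrite -[leLHS]real_normK ?num_real// -[leRHS]real_normK ?num_real// lerXn2r ?nnegrE// norm_sin_le.
by lra.
Qed.

Lemma norm_sin_sub_le x : `|sin x - x| <= x ^+ 2 * expR `|x|.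
Proof.
have h (z : R) : is_derive z 1 (fun z => sin z - z) (cos z - 1).
  by apply: is_deriveB.
have [c cx] := mean_value0 h x.
rewrite sin0 subr0 subr0 => ->.
rewrite normrM -[x ^+ 2]real_normK ?num_real// expr2 mulrC -[leRHS]mulrA ler_wpM2l//.
rewrite distrC [ `|1 - cos c|]ger0_norm ?subr_ge0 ?cos_le1//.
apply: (le_trans (oneB_cos_le c)).
rewrite -real_normK ?num_real//.
have : `|c| ^+ 2 <= `|x| ^+ 2 by rewrite lerXn2r// nnegrE.
have : 1 + `|x| <= expR `|x| by exact: expR_ge1Dx.
have := normr_ge0 x; have := normr_ge0 c; have := sqr_ge0 `|x|; nra.
Qed.

End real_estimates.

Section complex_basics.
Context {R : realType}.
Implicit Types (z u s : R[i]) (x y : R).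

Lemma normc_sqrtE x y : normc (x +i* y) = Num.sqrt (x ^+ 2 + y ^+ 2).
Proof. by []. Qed.

Lemma normc_ge0 z : 0 <= normc z.
Proof. by case: z => a b; rewrite normc_sqrtE sqrtr_ge0. Qed.

Lemma normc_triangle z u : normc (z + u) <= normc z + normc u.
Proof. exact: (@le_normcD R z u). Qed.

Lemma normcM z u : normc (z * u) = normc z * normc u.
Proof. exact: ComplexField.Normc.normcM. Qed.

Lemma normc_opp z : normc (- z) = normc z.
Proof. exact: (@normcN R z). Qed.

Lemma normc_real x : normc (x%:C) = `|x|.
Proof. by rewrite normc_sqrtE expr0n addr0 sqrtr_sqr. Qed.

Lemma normc_imag x : normc (0 +i* x) = `|x|.
Proof. by rewrite normc_sqrtE expr0n add0r sqrtr_sqr. Qed.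

Lemma complex_split z : z = (Re z)%:C + (0 +i* Im z).
Proof. by case: z => a b; rewrite /= ; apply/eqP; rewrite eq_complex/= addr0 add0r !eqxx. Qed.

Lemma normc_le_l1 z : normc z <= `|Re z| + `|Im z|.
Proof. by rewrite {1}(complex_split z) (le_trans (normc_triangle _ _))// normc_real normc_imag. Qed.

Lemma norm_Re_le z : `|Re z| <= normc z.
Proof. by case: z => a b; rewrite normc_sqrtE -sqrtr_sqr ler_wsqrtr// lerDl sqr_ge0. Qed.

Lemma norm_Im_le z : `|Im z| <= normc z.
Proof. by case: z => a b; rewrite normc_sqrtE -sqrtr_sqr ler_wsqrtr// lerDr sqr_ge0. Qed.

Lemma normcK z : `|z| = (normc z)%:C.
Proof. by []. Qed.

Lemma cReD z u : Re (z + u) = Re z + Re u. Proof. by case: z u => [? ?] []. Qed.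
Lemma cImD z u : Im (z + u) = Im z + Im u. Proof. by case: z u => [? ?] []. Qed.
Lemma cReN z : Re (- z) = - Re z. Proof. by case: z. Qed.
Lemma cImN z : Im (- z) = - Im z. Proof. by case: z. Qed.
Lemma cReM z u : Re (z * u) = Re z * Re u - Im z * Im u. Proof. by case: z u => [? ?] []. Qed.
Lemma cImM z u : Im (z * u) = Re z * Im u + Im z * Re u. Proof. by case: z u => [? ?] []. Qed.

Lemma complex_eqP z u : Re z = Re u -> Im z = Im u -> z = u.
Proof. by case: z u => [? ?] [? ?] /= -> ->. Qed.

Lemma expCD z u : expC (z + u) = expC z * expC u.
Proof.
by apply: complex_eqP; rewrite ?cReM ?cImM /= cReD cImD expRD ?cosD ?sinD; ring.
Qed.

Lemma expC_real x : expC (x%:C) = (expR x)%:C.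
Proof. by rewrite /expC/= cos0 sin0 mulr1 mulr0. Qed.

Lemma expC0 : expC (0 : R[i]) = 1.
Proof. by rewrite (expC_real 0) expR0. Qed.

Lemma normc_expC z : normc (expC z) = expR (Re z).
Proof.
rewrite normc_sqrtE !exprMn -mulrDr cos2Dsin2 mulr1 sqrtr_sqr ger0_norm// expR_ge0//.
Qed.

Lemma expCN z : expC (- z) = (expC z)^-1.
Proof.
have h : expC z * expC (- z) = 1 by rewrite -expCD subrr expC0.
have z0 : expC z != 0 by apply/eqP => e; move: h; rewrite e mul0r => /esym/eqP; rewrite oner_eq0.
by apply: (mulfI z0); rewrite h divff.
Qed.

Lemma powCN z s : powC z (- s) = 1 / powC z s.
Proof. by rewrite /powC mulNr expCN div1r. Qed.

(** In units of [|z|^2 e^|z|] the real part costs [3/2] and the imaginary part [2]; their sum is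
    rounded up to [4]. *)
Lemma normc_expC_sub1_subz z :
  normc (expC z - 1 - z) <= 4 * normc z ^+ 2 * expR (normc z).
Proof.
apply: (le_trans (normc_le_l1 _)).
case: z => x y; set n := normc _.
have nx : `|x| <= n := norm_Re_le (x +i* y).
have ny : `|y| <= n := norm_Im_le (x +i* y).
have n0 : 0 <= n by exact: normc_ge0.
rewrite /= oppr0 addr0.
have hx : x ^+ 2 <= n ^+ 2.
  by rewrite -[leLHS]real_normK ?num_real// lerXn2r ?nnegrE.
have hy : y ^+ 2 <= n ^+ 2.
  by rewrite -[leLHS]real_normK ?num_real// lerXn2r ?nnegrE.
have hex : expR `|x| <= expR n by rewrite ler_expR.
have hex' : expR x <= expR n by rewrite ler_expR (le_trans _ nx)// ler_norm.
have hey : expR `|y| <= expR n by rewrite ler_expR.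
have en := expR_gt0 n.
have h1 : `|expR x * cos y - 1 - x| <= 3/2 * (n ^+ 2 * expR n).
  have -> : expR x * cos y - 1 - x = (expR x - 1 - x) - expR x * (1 - cos y) by ring.
  apply: (le_trans (ler_normB _ _)).
  have a1 : `|expR x - 1 - x| <= n ^+ 2 * expR n.
    apply: (le_trans (norm_expR_sub1_subx x)).
    by apply: ler_pM => //; rewrite ?sqr_ge0 ?expR_ge0.
  have a2 : `|expR x * (1 - cos y)| <= 1/2 * (n ^+ 2 * expR n).
    rewrite normrM [ `|expR x|]ger0_norm ?expR_ge0// ger0_norm ?subr_ge0 ?cos_le1//.
    have := oneB_cos_le y => c1.
    have c2 : 1 - cos y <= n ^+ 2 / 2 by lra.
    have -> : 1/2 * (n ^+ 2 * expR n) = expR n * (n ^+ 2 / 2) by field.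
    by apply: ler_pM => //; rewrite ?expR_ge0// subr_ge0 cos_le1.
  lra.
have h2 : `|expR x * sin y - y| <= 2 * (n ^+ 2 * expR n).
  have -> : expR x * sin y - y = (expR x - 1) * sin y + (sin y - y) by ring.
  apply: (le_trans (ler_normD _ _)).
  have a1 : `|(expR x - 1) * sin y| <= n ^+ 2 * expR n.
    rewrite normrM.
    have b1 : `|expR x - 1| <= n * expR n.
      apply: (le_trans (norm_expR_sub1 x)).
      by apply: ler_pM => //; rewrite expR_ge0.
    have b2 : `|sin y| <= n by apply: (le_trans (norm_sin_le y)).
    have -> : n ^+ 2 * expR n = n * expR n * n by ring.
    exact: ler_pM.
  have a2 : `|sin y - y| <= n ^+ 2 * expR n.
    apply: (le_trans (norm_sin_sub_le y)).
    by apply: ler_pM => //; rewrite ?sqr_ge0 ?expR_ge0.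
  lra.
have : 0 <= n ^+ 2 * expR n by rewrite mulr_ge0 ?sqr_ge0 ?expR_ge0.
lra.
Qed.

Lemma Re_gt0_normc z : 0 < Re z -> 0 < normc z.
Proof. by move=> h; apply: (lt_le_trans _ (norm_Re_le z)); rewrite normr_gt0 gt_eqF. Qed.

Lemma cos_atan_div y x : 0 < x -> cos (atan (y / x)) = x / normc (x +i* y).
Proof.
move=> x0; have y2 := sqr_ge0 y; have x2 : 0 < x ^+ 2 by exact: exprn_gt0.
rewrite cos_atan normc_sqrtE; have -> : x ^+ 2 + y ^+ 2 = x ^+ 2 * (1 + (y / x) ^+ 2).
  by field; rewrite lt0r_neq0.
rewrite sqrtrM ?ltW// sqrtr_sqr gtr0_norm// invfM mulrA divff ?lt0r_neq0// mul1r//.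
Qed.

(** On the right half-plane the case split in [argC] disappears, since [acos] inverts [cos] on the
    nonnegative side and [cos] is even. The [atan] form is visibly continuous in [y]. *)
Lemma argC_atan x y : 0 < x -> argC (x +i* y) = atan (y / x).
Proof.
move=> x0; rewrite /argC.
have n0 := @Re_gt0_normc (x +i* y) x0.
set t := atan (y / x).
rewrite [Re _]/= -(cos_atan_div y x0) -/t [Im _]/=.
have tb : - (pi / 2) < t < pi / 2 by rewrite atan_gtNpi2 atan_ltpi2.
have pi0 := pi_gt0 R.
case: ifPn => y0.
  have t0 : 0 <= t by rewrite -(@atan0 R) le_atan// divr_ge0// ltW.
  by rewrite cosK// in_itv/= t0; lra.
have t0 : t <= 0 by rewrite -(@atan0 R) le_atan// pmulr_lle0 ?invr_gt0// ltW// ltNge.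
by rewrite cosKN ?opprK// t0 andbT; lra.
Qed.

(** The strict bound makes [cos (arg z)] positive, which is what lets the integral along the line at
    height [arg z] converge. *)
Lemma LogC_Im_bound z : 0 < Re z -> `|Im (LogC z)| < pi / 2.
Proof.
by case: z => x y /= x0; rewrite argC_atan// ltr_norml atan_gtNpi2 atan_ltpi2.
Qed.

Lemma expC_LogC z : 0 < Re z -> expC (LogC z) = z.
Proof.
case: z => x y /= x0; have n0 := @Re_gt0_normc (x +i* y) x0.
have hc := cos_atan_div y x0.
have hs : sin (atan (y / x)) = y / normc (x +i* y).
  have := atanK (y / x); rewrite /tan hc.
  move=> /(congr1 (fun v => v * (x / normc (x +i* y)))).
  rewrite mulfVK ?mulf_neq0 ?invr_eq0 ?lt0r_neq0// => ->.
  by field; rewrite !lt0r_neq0.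
rewrite /expC /LogC [Re _]/= [Im _]/= argC_atan// lnK ?posrE// hc hs.
by congr (_ +i* _); rewrite mulrC mulfVK ?lt0r_neq0.
Qed.

Lemma LogC_real x : 0 < x -> LogC x%:C = (ln x)%:C.
Proof. by move=> x0; rewrite /LogC argC_atan// mul0r atan0 normc_real gtr0_norm. Qed.

End complex_basics.

(** * Measurability and integration of complex-valued functions *)

Section measurable_complex.
Context (d : measure_display) (T : measurableType d) (R : realType).
Implicit Types (f g : T -> R[i]) (h : T -> R).

(** Componentwise, to match [integralC], which integrates the real and imaginary parts
    separately. *)
Definition measurable_funC f :=
  measurable_fun setT (fun x => Re (f x)) /\ measurable_fun setT (fun x => Im (f x)).

Lemma measurable_funC_cst (c : R[i]) : measurable_funC (fun=> c).
Proof. by split; exact: measurable_cst. Qed.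

Lemma measurable_funC_real h : measurable_fun setT h -> measurable_funC (fun x => (h x)%:C).
Proof. by split => //=; exact: measurable_cst. Qed.

Lemma measurable_funCD f g : measurable_funC f -> measurable_funC g ->
  measurable_funC (fun x => f x + g x).
Proof.
move=> [f1 f2] [g1 g2]; split.
- by under eq_fun do rewrite cReD; exact: measurable_funD.
- by under eq_fun do rewrite cImD; exact: measurable_funD.
Qed.

Lemma measurable_funCM f g : measurable_funC f -> measurable_funC g ->
  measurable_funC (fun x => f x * g x).
Proof.
move=> [f1 f2] [g1 g2]; split.
- under eq_fun do rewrite cReM.
  by apply: measurable_funB; exact: measurable_funM.
- under eq_fun do rewrite cImM.
  by apply: measurable_funD; exact: measurable_funM.
Qed.

Lemma measurable_funCN f : measurable_funC f -> measurable_funC (fun x => - f x).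
Proof.
move=> mf; rewrite [X in measurable_funC X](_ : _ = fun x => -1 * f x).
  by apply: measurable_funCM => //; exact: measurable_funC_cst.
by apply/funext => x; rewrite mulN1r.
Qed.

Lemma measurable_funCB f g : measurable_funC f -> measurable_funC g ->
  measurable_funC (fun x => f x - g x).
Proof. by move=> mf mg; apply: measurable_funCD => //; exact: measurable_funCN. Qed.

Lemma measurable_funC_exp f : measurable_funC f -> measurable_funC (fun x => expC (f x)).
Proof.
move=> [f1 f2]; split => /=.
- apply: measurable_funM; first exact: measurableT_comp f1.
  apply: (@measurableT_comp _ _ _ _ _ _ (@cos R)) f2.
  by apply: continuous_measurable_fun; exact: continuous_cos.
- apply: measurable_funM; first exact: measurableT_comp f1.
  apply: (@measurableT_comp _ _ _ _ _ _ (@sin R)) f2.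
  by apply: continuous_measurable_fun; exact: continuous_sin.
Qed.

Lemma measurable_normc f : measurable_funC f -> measurable_fun setT (fun x => normc (f x)).
Proof.
move=> [f1 f2]; rewrite [X in measurable_fun _ X](_ : _ = fun x => Num.sqrt (Re (f x) ^+ 2 + Im (f x) ^+ 2)).
  apply: (@measurableT_comp _ _ _ _ _ _ (@Num.sqrt R)).
    by apply: continuous_measurable_fun; exact: sqrt_continuous.
  by apply: measurable_funD; exact: measurable_funX.
by apply/funext => x; case: (f x).
Qed.

End measurable_complex.

Section complex_integral_theory.
Context (d : measure_display) (T : measurableType d) (R : realType).
Variable mu : {measure set T -> \bar R}.
Implicit Types (f g : T -> R[i]) (h : T -> R).

Definition integrableC f :=
  mu.-integrable setT (fun x => (Re (f x))%:E) /\
  mu.-integrable setT (fun x => (Im (f x))%:E).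

Lemma integrable_dominated h h' : measurable_fun setT h ->
  mu.-integrable setT (fun x => (h' x)%:E) -> (forall x, `|h x| <= h' x) ->
  mu.-integrable setT (fun x => (h x)%:E).
Proof.
move=> mh ih' hh'; apply: (le_integrable measurableT _ _ ih').
  exact/measurable_EFinP.
by move=> x _; rewrite /= lee_fin (le_trans (hh' x))// ler_norm.
Qed.

Lemma integrableC_dominated f h : measurable_funC f ->
  mu.-integrable setT (fun x => (h x)%:E) -> (forall x, normc (f x) <= h x) ->
  integrableC f.
Proof.
move=> [f1 f2] ih fh; split; apply: (integrable_dominated _ ih) => // x.
  by rewrite (le_trans (norm_Re_le _)).
by rewrite (le_trans (norm_Im_le _)).
Qed.

Lemma integrableCD f g : integrableC f -> integrableC g -> integrableC (fun x => f x + g x).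
Proof.
move=> [f1 f2] [g1 g2]; split.
- by under eq_fun do rewrite cReD EFinD; exact: integrableD.
- by under eq_fun do rewrite cImD EFinD; exact: integrableD.
Qed.

Lemma integrableCZ f c : integrableC f -> integrableC (fun x => c * f x).
Proof.
move=> [f1 f2]; split.
- under eq_fun do rewrite cReM EFinB !EFinM.
  by apply: integrableB => //; exact: integrableZl.
- under eq_fun do rewrite cImM EFinD !EFinM.
  by apply: integrableD => //; exact: integrableZl.
Qed.

Lemma integrableCN f : integrableC f -> integrableC (fun x => - f x).
Proof. by move=> /(integrableCZ (-1)); under eq_fun do rewrite mulN1r. Qed.

Lemma integrableCB f g : integrableC f -> integrableC g -> integrableC (fun x => f x - g x).
Proof. by move=> h1 h2; apply: integrableCD => //; exact: integrableCN. Qed.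

Lemma integrableC0 : integrableC (fun=> 0).
Proof. by split; exact: integrable0. Qed.

Lemma integralCD f g : integrableC f -> integrableC g ->
  integralC mu (fun x => f x + g x) = integralC mu f + integralC mu g.
Proof.
move=> [f1 f2] [g1 g2]; apply: complex_eqP; rewrite /= -RintegralD//.
- by apply: eq_Rintegral => x _; rewrite cReD.
- by apply: eq_Rintegral => x _; rewrite cImD.
Qed.

Lemma integralCZ f c : integrableC f ->
  integralC mu (fun x => c * f x) = c * integralC mu f.
Proof.
move=> [f1 f2]; apply: complex_eqP; rewrite ?cReM ?cImM /= -!RintegralZl//.
- rewrite -RintegralB//; first by apply: eq_Rintegral => x _; rewrite cReM.
    exact: (integrableZl measurableT _ f1).
  exact: (integrableZl measurableT _ f2).
- rewrite -RintegralD//; first by apply: eq_Rintegral => x _; rewrite cImM.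
    exact: (integrableZl measurableT _ f2).
  exact: (integrableZl measurableT _ f1).
Qed.

Lemma integralCN f : integrableC f -> integralC mu (fun x => - f x) = - integralC mu f.
Proof. by move=> /(integralCZ (-1)); rewrite mulN1r => <-; congr integralC; apply/funext => x; rewrite mulN1r. Qed.

Lemma integralCB f g : integrableC f -> integrableC g ->
  integralC mu (fun x => f x - g x) = integralC mu f - integralC mu g.
Proof. by move=> fi gi; rewrite integralCD ?integralCN//; exact: integrableCN. Qed.

Lemma integralC0 : integralC mu (fun=> 0) = 0.
Proof. by apply: complex_eqP; rewrite /= /Rintegral integral0. Qed.

Lemma integrableC_sum (I : Type) (s : seq I) (F : I -> T -> R[i]) :
  (forall i, integrableC (F i)) -> integrableC (fun x => \sum_(i <- s) F i x).
Proof.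
move=> mF; elim: s => [|i s ih].
  by under eq_fun do rewrite big_nil; exact: integrableC0.
by under eq_fun do rewrite big_cons; exact: integrableCD.
Qed.

Lemma integralC_sum (I : Type) (s : seq I) (F : I -> T -> R[i]) :
  (forall i, integrableC (F i)) ->
  integralC mu (fun x => \sum_(i <- s) F i x) = \sum_(i <- s) integralC mu (F i).
Proof.
move=> mF; elim: s => [|i s ih].
  by rewrite big_nil -[RHS]integralC0; congr integralC; apply/funext => x; rewrite big_nil.
rewrite big_cons -ih -integralCD//; last exact: integrableC_sum.
by congr integralC; apply/funext => x; rewrite big_cons.
Qed.

(** The factor [2] comes from bounding the two components separately; it is harmless because every
    use needs only the order of magnitude. *)
Lemma normc_integralC_le f h : integrableC f -> mu.-integrable setT (fun x => (h x)%:E) ->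
  (forall x, normc (f x) <= h x) -> normc (integralC mu f) <= 2 * \int[mu]_x h x.
Proof.
move=> [f1 f2] ih fh; apply: (le_trans (normc_le_l1 _)) => /=.
rewrite mulr_natl mulr2n; apply: lerD.
- apply: (le_trans (le_normr_Rintegral _ _)) => //; apply: le_Rintegral => //.
    exact: integrable_norm.
  by move=> x _; rewrite (le_trans (norm_Re_le _)).
- apply: (le_trans (le_normr_Rintegral _ _)) => //; apply: le_Rintegral => //.
    exact: integrable_norm.
  by move=> x _; rewrite (le_trans (norm_Im_le _)).
Qed.

End complex_integral_theory.

Section complex_fubini.
Context (d1 d2 : measure_display) (T1 : measurableType d1) (T2 : measurableType d2) (R : realType).
Variables (P : probability T1 R) (m : {sigma_finite_measure set T2 -> \bar R}).

(** A bound depending on [y] alone is integrable on the product because [P] has total mass one. *)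
Lemma Rintegral_fubini_dominated (f : T1 * T2 -> R) (h : T2 -> R) :
  measurable_fun setT f -> m.-integrable setT (fun y => (h y)%:E) ->
  (forall x y, `|f (x, y)| <= h y) ->
  (forall x, m.-integrable setT (fun y => (f (x, y))%:E)) ->
  (forall y, P.-integrable setT (fun x => (f (x, y))%:E)) ->
  \int[P]_x (\int[m]_y f (x, y)) = \int[m]_y (\int[P]_x f (x, y)).
Proof.
move=> mf ih fh i1 i2; rewrite /Rintegral; congr fine.
under eq_integral do rewrite fineK ?integrable_fin_num//.
under [RHS]eq_integral do rewrite fineK ?integrable_fin_num//.
rewrite (@Fubini _ _ _ _ _ P m (EFin \o f))//.
apply/integrable12ltyP; first exact/measurable_EFinP.
apply: (@le_lt_trans _ _ (\int[P]_x \int[m]_y (h y)%:E)%E).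
  apply: ge0_le_integral => //.
  - by move=> x _; exact: integral_ge0.
  - apply: (@measurable_fun_fubini_tonelli_F _ _ _ _ _ m (fun z => `|(EFin \o f) z|%E)) => //.
    by apply: measurableT_comp => //; exact/measurable_EFinP.
  - move=> x _; apply: ge0_le_integral => //.
    + apply: measurableT_comp => //; exact: measurable_int (i1 x).
    + exact: measurable_int ih.
    + by move=> y _; rewrite lee_fin.
have /fineK <- := integrable_fin_num measurableT ih.
exact: (integrable_lty measurableT (finite_measure_integrable_cst P _ measurableT)).
Qed.

Lemma integralC_fubini (f : T1 -> T2 -> R[i]) (h : T2 -> R) :
  measurable_funC (fun z : T1 * T2 => f z.1 z.2) ->
  m.-integrable setT (fun y => (h y)%:E) ->
  (forall x y, normc (f x y) <= h y) ->
  integralC P (fun x => integralC m (f x)) = integralC m (fun y => integralC P (f^~ y)).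
Proof.
move=> [f1 f2] ih fh.
have i1 (k : T1 * T2 -> R) : measurable_fun setT k -> (forall x y, `|k (x, y)| <= h y) ->
    forall x, m.-integrable setT (fun y => (k (x, y))%:E).
  move=> mk kh x; apply: (integrable_dominated _ ih) => //.
  exact: measurableT_comp (pair1_measurable _).
have i2 (k : T1 * T2 -> R) : measurable_fun setT k -> (forall x y, `|k (x, y)| <= h y) ->
    forall y, P.-integrable setT (fun x => (k (x, y))%:E).
  move=> mk kh y; apply: (@integrable_dominated _ _ _ P _ (cst (h y))) => //.
    exact: measurableT_comp (pair2_measurable _).
  by apply: finite_measure_integrable_cst.
have rk x y : `|Re (f x y)| <= h y by rewrite (le_trans (norm_Re_le _)).
have ik x y : `|Im (f x y)| <= h y by rewrite (le_trans (norm_Im_le _)).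
apply: complex_eqP => /=.
- exact: (@Rintegral_fubini_dominated (fun z => Re (f z.1 z.2)) h f1 ih rk (i1 _ f1 rk) (i2 _ f1 rk)).
- exact: (@Rintegral_fubini_dominated (fun z => Im (f z.1 z.2)) h f2 ih ik (i1 _ f2 ik) (i2 _ f2 ik)).
Qed.

End complex_fubini.

Section continuous_complex.
Context {R : realType}.
Implicit Types f g : R -> R[i].

Definition continuousC f :=
  continuous (fun x => Re (f x)) /\ continuous (fun x => Im (f x)).

Lemma continuousC_cst c : continuousC (fun=> c).
Proof. by split; exact: cst_continuous. Qed.

Lemma continuousC_real (h : R -> R) : continuous h -> continuousC (fun x => (h x)%:C).
Proof. by split => //=; exact: cst_continuous. Qed.

Lemma continuousCD f g : continuousC f -> continuousC g -> continuousC (fun x => f x + g x).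
Proof.
move=> [f1 f2] [g1 g2]; split.
- by under eq_fun do rewrite cReD; move=> x; apply: cvgD; [exact: f1|exact: g1].
- by under eq_fun do rewrite cImD; move=> x; apply: cvgD; [exact: f2|exact: g2].
Qed.

Lemma continuousCM f g : continuousC f -> continuousC g -> continuousC (fun x => f x * g x).
Proof.
move=> [f1 f2] [g1 g2]; split.
- under eq_fun do rewrite cReM.
  by move=> x; apply: cvgB; apply: cvgM; [exact: f1|exact: g1|exact: f2|exact: g2].
- under eq_fun do rewrite cImM.
  by move=> x; apply: cvgD; apply: cvgM; [exact: f1|exact: g2|exact: f2|exact: g1].
Qed.

Lemma continuousC_exp f : continuousC f -> continuousC (fun x => expC (f x)).
Proof.
move=> [f1 f2]; split => /= x.
- apply: cvgM; first by apply: (continuous_comp (f1 x)); exact: continuous_expR.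
  by apply: (continuous_comp (f2 x)); exact: continuous_cos.
- apply: cvgM; first by apply: (continuous_comp (f1 x)); exact: continuous_expR.
  by apply: (continuous_comp (f2 x)); exact: continuous_sin.
Qed.

Lemma continuousC_measurable f : continuousC f -> measurable_funC (f : measurableTypeR R -> _).
Proof. by move=> [f1 f2]; split; exact: continuous_measurable_fun. Qed.

End continuous_complex.

(** * The Gamma function *)

Section lebesgue_translation.
Context {R : realType}.
Notation mu := (@lebesgue_measure R).

Lemma ge0_integral_translate (G : R -> R) h : continuous G -> (forall x, 0 <= G x) ->
  (\int[mu]_x (G (x + h))%:E = \int[mu]_x (G x)%:E)%E.
Proof.
move=> cG G0.
have dF (x : R) : is_derive x 1 (fun x => x + h) 1.
  rewrite -[X in is_derive _ _ _ X](addr0 1); apply: is_deriveD.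
have F1 : (fun x : R => x + h)^`()%classic = cst 1.
  by apply/funext => x; rewrite derive1E; have [_ ->] := dF x.
rewrite [RHS](@increasing_ge0_integration_by_substitutionT _ (fun x => x + h) G)//.
- by apply: eq_integral => x _; rewrite F1 /= mulr1.
- by move=> x y xy; rewrite ltrD2r.
- by rewrite F1; exact: cst_continuous.
- by rewrite F1; exact: is_cvg_cst.
- by rewrite F1; exact: is_cvg_cst.
- exact: cvg_addrr_Ny.
- exact: cvg_addrr.
Qed.

Lemma integrable_translate (G : R -> R) h : continuous G ->
  mu.-integrable setT (fun x => (G x)%:E) -> mu.-integrable setT (fun x => (G (x + h))%:E).
Proof.
move=> cG iG; apply/integrableP; split.
  apply/measurable_EFinP; apply: continuous_measurable_fun => x.
  apply: (@continuous_comp _ _ _ (fun x => x + h) G); last exact: cG.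
  by apply: cvgD => //; exact: cst_continuous.
have [_] := integrableP _ _ _ iG.
rewrite -(@ge0_integral_translate (fun x => `|G x|) h)//.
by move=> x; apply: continuous_comp; [exact: cG|exact: norm_continuous].
Qed.

(** Both [|G| + G] and [|G|] are continuous and nonnegative, so the nonnegative case applies to
    each, and [G] is their difference. *)
Lemma Rintegral_translate (G : R -> R) h : continuous G ->
  mu.-integrable setT (fun x => (G x)%:E) -> \int[mu]_x G (x + h) = \int[mu]_x G x.
Proof.
move=> cG iG.
have cN : continuous (fun x => `|G x|).
  by move=> x; apply: continuous_comp; [exact: cG|exact: norm_continuous].
have iN : mu.-integrable setT (fun x => `|G x|%:E) by exact: integrable_norm iG.
have cS : continuous (fun x => `|G x| + G x).
  by move=> x; apply: cvgD; [exact: cN|exact: cG].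
have iS : mu.-integrable setT (fun x => (`|G x| + G x)%:E).
  by under eq_fun do rewrite EFinD; exact: integrableD.
have e x : G x = (`|G x| + G x) - `|G x| by ring.
have -> : \int[mu]_x G (x + h) = \int[mu]_x ((`|G (x + h)| + G (x + h)) - `|G (x + h)|).
  by apply: eq_Rintegral => x _; rewrite -e.
have -> : \int[mu]_x G x = \int[mu]_x ((`|G x| + G x) - `|G x|).
  by apply: eq_Rintegral => x _; rewrite -e.
rewrite !RintegralB//; first congr (_ - _).
- rewrite /Rintegral (@ge0_integral_translate (fun x => `|G x| + G x))// => x.
  by rewrite -lerBlDl sub0r lerNl -normrN ler_norm.
- by rewrite /Rintegral (@ge0_integral_translate (fun x => `|G x|)).
- exact: (@integrable_translate (fun x => `|G x| + G x)).
- exact: (@integrable_translate (fun x => `|G x|)).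
Qed.

Lemma integralC_translate (f : R -> R[i]) h : continuousC f -> integrableC mu f ->
  integralC mu (fun x => f (x + h)) = integralC mu f.
Proof.
move=> [c1 c2] [i1 i2]; apply: complex_eqP => /=.
- exact: (@Rintegral_translate (fun x => Re (f x))).
- exact: (@Rintegral_translate (fun x => Im (f x))).
Qed.

Lemma integrableC_translate (f : R -> R[i]) h : continuousC f -> integrableC mu f ->
  integrableC mu (fun x => f (x + h)).
Proof.
move=> [c1 c2] [i1 i2]; split.
- exact: (@integrable_translate (fun x => Re (f x))).
- exact: (@integrable_translate (fun x => Im (f x))).
Qed.

End lebesgue_translation.

(** * Integrability of the kernel of Euler's integral *)

Section gamma_kernel.
Context {R : realType}.
Notation mu := (@lebesgue_measure R).
Implicit Types (a x v : R).

Lemma integrable_oneDsqrV : mu.-integrable setT (fun v => ((oneDsqr v)^-1)%:E).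
Proof.
have o0 (x : R) : 0 <= (oneDsqr x)^-1 by rewrite invr_ge0 (le_trans ler01)// oneDsqr_ge1.
apply/integrableP; split.
  apply/measurable_EFinP; apply: continuous_measurable_fun; exact: continuous_oneDsqrV.
under eq_integral do rewrite gee0_abs ?lee_fin//.
rewrite ge0_symfun_integralT//.
- rewrite (_ : [set x | _] = `[0, +oo[%classic); last first.
    by apply/seteqP; split => x /=; rewrite in_itv/= andbT.
  by rewrite integral0y_oneDsqr -EFinM ltry.
- exact: continuous_oneDsqrV.
- by move=> x /=; rewrite /oneDsqr sqrrN.
Qed.

(** The inequality [1 + t^2 / 2 <= e^t] at [t = c |v|] reduces two-sided exponential decay to the
    known integrable function [1 / (1 + v^2)]. *)
Lemma expR_Nabs_le (c v : R) : 0 < c ->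
  expR (- (c * `|v|)) <= (1 + 2 / c ^+ 2) * (oneDsqr v)^-1.
Proof.
move=> c0; have o1 := oneDsqr_ge1 v; have o0 := lt_le_trans ltr01 o1.
rewrite ler_pdivlMr// expRN mulrC ler_pdivrMr ?expR_gt0//.
have cv : 0 <= c * `|v| by rewrite mulr_ge0// ltW.
have := expR_ge1Dxn 1 cv; rewrite exprMn real_normK ?num_real// (_ : 2`!%:R = 2%:R :> R)//.
set E := expR _ => hE; rewrite /oneDsqr.
have c2 : 0 < c ^+ 2 by exact: exprn_gt0.
have v2 : v ^+ 2 <= 2 / c ^+ 2 * E.
  rewrite mulrAC ler_pdivlMr//; lra.
have : 1 <= E by rewrite (le_trans _ hE)// lerDl divr_ge0// mulr_ge0 ?sqr_ge0.
by rewrite mulrDl mul1r; lra.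
Qed.

(** This is [t^(a-1) e^(-x t) dt] after [t = e^v]; it is the modulus of all the complex kernels
    below and serves as their dominating function. *)
Definition gkern a x v := expR (a * v - x * expR v).

(** For [v < 0] the exponential is dropped, leaving slope [a]. For [v >= 0] it is replaced by its
    tangent at [c], where [x e^c = a + 1], so that the total slope becomes [-1]. *)
Lemma linear_sub_exp_le a x : 0 < a -> 0 < x ->
  exists2 K, 0 <= K & forall v, a * v - x * expR v <= K - Num.min a 1 * `|v|.
Proof.
move=> a0 x0; set c := ln ((a + 1) / x).
have a10 : 0 < a + 1 by lra.
have ec : x * expR c = a + 1.
  by rewrite lnK ?posrE ?divr_gt0// mulrCA divff ?mulr1// lt0r_neq0.
have h v : a * v - x * expR v <= (a + 1) * (c - 1) - v.
  have : (a + 1) * (1 + (v - c)) <= x * expR v.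
    rewrite -ec -mulrA ler_wpM2l ?(ltW x0)//.
    have -> : expR v = expR c * expR (v - c) by rewrite -expRD; congr expR; ring.
    by rewrite ler_wpM2l ?expR_ge0// expR_ge1Dx.
  lra.
exists `|(a + 1) * (c - 1)| => // v.
have m1 : Num.min a 1 <= 1 by rewrite ge_min lexx orbT.
have ma : Num.min a 1 <= a by rewrite ge_min lexx.
have m0 : 0 < Num.min a 1 by rewrite lt_min a0 ltr01.
have hh := h v; have K0 := ler_norm ((a + 1) * (c - 1)).
have KK := normr_ge0 ((a + 1) * (c - 1)).
have [v0|v0] := leP 0 v.
  rewrite (ger0_norm v0); have : Num.min a 1 * v <= v by rewrite ler_piMl.
  lra.
rewrite (ltr0_norm v0); have : Num.min a 1 * - v <= a * - v by rewrite ler_wpM2r// oppr_ge0 ltW.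
have : 0 <= x * expR v by rewrite mulr_ge0 ?expR_ge0// ltW.
lra.
Qed.

Lemma gkern_ge0 a x v : 0 <= gkern a x v.
Proof. exact: expR_ge0. Qed.

Lemma continuous_gkern a x : continuous (gkern a x).
Proof.
move=> v; apply: continuous_comp; last exact: continuous_expR.
apply: cvgB; apply: cvgM => //; try exact: cst_continuous.
exact: continuous_expR.
Qed.

Lemma measurable_gkern a x : measurable_fun setT (gkern a x : measurableTypeR R -> R).
Proof. by apply: continuous_measurable_fun; exact: continuous_gkern. Qed.

Lemma integrable_gkern a x : 0 < a -> 0 < x -> mu.-integrable setT (fun v => (gkern a x v)%:E).
Proof.
move=> a0 x0; have [K K0 hK] := linear_sub_exp_le a0 x0.
set c := Num.min a 1; have c0 : 0 < c by rewrite lt_min a0 ltr01.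
apply: (@integrable_dominated _ _ _ mu _ (fun v => expR K * (1 + 2 / c ^+ 2) * (oneDsqr v)^-1)).
- exact: measurable_gkern.
- under eq_fun do rewrite EFinM; apply: integrableZl => //; exact: integrable_oneDsqrV.
- move=> v; rewrite ger0_norm ?gkern_ge0// -mulrA.
  apply: (@le_trans _ _ (expR K * expR (- (c * `|v|)))).
    by rewrite -expRD ler_expR hK.
  by rewrite ler_wpM2l ?expR_ge0// expR_Nabs_le.
Qed.

End gamma_kernel.

(** * Contour shift, functional equation and non-vanishing of Gamma *)

Section gamma_function.
Context {R : realType}.
Notation mu := (@lebesgue_measure R).
Implicit Types (s z : R[i]) (v y : R).

(* The integrand of Euler's integral after the substitution t = e^v. *)
Definition gphi s z : R[i] := expC (s * z - expC z).

Definition GammaC s : R[i] := integralC mu (fun v => gphi s v%:C).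

Lemma expC_sub1_le z : normc z <= 1 -> normc (expC z - 1) <= (1 + 4 * expR 1) * normc z.
Proof.
move=> z1; have n0 := normc_ge0 z.
have -> : expC z - 1 = (expC z - 1 - z) + z by ring.
apply: (le_trans (normc_triangle _ _)); rewrite mulrDl mul1r addrC lerD2l.
apply: (le_trans (normc_expC_sub1_subz z)).
have e1 : expR (normc z) <= expR 1 by rewrite ler_expR.
have -> : 4 * normc z ^+ 2 * expR (normc z) = 4 * (expR (normc z) * normc z) * normc z by ring.
apply: ler_wpM2r => //; rewrite ler_pM2l//.
rewrite -[leRHS]mulr1; apply: ler_pM => //; exact: expR_ge0.
Qed.

(** At height [y] the decay for large [v] is governed by [cos y], so heights must stay inside
    []-pi/2, pi/2[]. *)
Lemma normc_gphi s v y :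
  normc (gphi s (v +i* y)) = expR (- (Im s * y)) * gkern (Re s) (cos y) v.
Proof.
rewrite normc_expC -expRD; congr expR; rewrite cReD cReN cReM /=; ring.
Qed.

Lemma continuousC_gphi s y : continuousC (fun v => gphi s (v +i* y)).
Proof.
have -> : (fun v => gphi s (v +i* y)) =
    (fun v => expC (s * (v%:C + (0 +i* y)) + (-1) * expC (v%:C + (0 +i* y)))).
  by apply/funext => v; rewrite /gphi (complex_split (v +i* y)) mulN1r.
have h : continuousC (fun v => v%:C + (0 +i* y)).
  apply: continuousCD; last exact: continuousC_cst.
  by apply: continuousC_real => x.
apply: continuousC_exp; apply: continuousCD; apply: continuousCM => //.
- exact: continuousC_cst.
- exact: continuousC_cst.
- exact: continuousC_exp.
Qed.

Lemma integrableC_gphi s y : 0 < Re s -> 0 < cos y ->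
  integrableC mu (fun v => gphi s (v +i* y)).
Proof.
move=> s0 y0; apply: (@integrableC_dominated _ _ _ mu _
    (fun v => expR (- (Im s * y)) * gkern (Re s) (cos y) v)).
- exact/continuousC_measurable/continuousC_gphi.
- by under eq_fun do rewrite EFinM; apply: integrableZl => //; exact: integrable_gkern.
- by move=> v; rewrite normc_gphi.
Qed.

(** Since [(s - e^z) gphi s z] is the complex derivative of [gphi s], this is a Taylor bound with a
    remainder uniform in [y] and integrable in [v]. Half of the decay rate [c] is spent on the
    exponential in the remainder. *)
Lemma gphi_second_order s (c : R) : 0 < c ->
  exists C delta : R, [/\ 0 <= C, 0 < delta & forall v y h, c <= cos y -> `|y| <= pi ->
    normc h <= delta ->
    normc (gphi s (v +i* y + h) - gphi s (v +i* y) - (s - expC (v +i* y)) * h * gphi s (v +i* y))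
      <= C * normc h ^+ 2 * (gkern (Re s) (c / 2) v + gkern (Re s + 2) (c / 2) v)].
Proof.
move=> c0; set S := normc s; set E : R := expR 1; set K := 1 + 4 * E.
have E0 : 0 < E := expR_gt0 _; have S0 : 0 <= S := normc_ge0 _.
have K0 : 0 < K by rewrite /K; lra.
pose B := 8 * (S ^+ 2 + K ^+ 2) * expR S + 4 * E.
have B0 : 0 <= B.
  rewrite addr_ge0 ?mulr_ge0 ?addr_ge0 ?sqr_ge0 ?expR_ge0//.
(* The radius gives [K |h| <= c / 2], so the remainder's exponential grows no faster than
   [e^(c e^v / 2)]. The factor [e^(|Im s| pi)] bounds [e^(- Im s y)] for [|y| <= pi]. *)
exists (expR (`|Im s| * pi) * B), (Num.min 1 (c / (2 * K))).
have d1 : Num.min 1 (c / (2 * K)) <= 1 by rewrite ge_min lexx.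
have dc : Num.min 1 (c / (2 * K)) <= c / (2 * K) by rewrite ge_min lexx orbT.
split; first by rewrite mulr_ge0// expR_ge0.
  by rewrite lt_min ltr01 divr_gt0// mulr_gt0.
move=> v y h cy ypi hd; set z := v +i* y; set n := normc h.
have n0 : 0 <= n := normc_ge0 _.
have n1 : n <= 1 := le_trans hd d1.
have nK : n * K <= c / 2.
  have : n <= c / (2 * K) := le_trans hd dc.
  by rewrite ler_pdivlMr ?mulr_gt0//; lra.
pose V := expR v; have V0 : 0 < V := expR_gt0 _.
have nz : normc (expC z) = V by rewrite normc_expC.
(* [W] is the increment of the exponent, whose linear part is [(s - e^z) h]; the error splits into
   that of [e^W] and that of [e^h]. *)
pose W := s * h - expC z * (expC h - 1).
have e1 : gphi s (z + h) = gphi s z * expC W.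
  by rewrite /gphi -expCD; congr expC; rewrite /W expCD; ring.
have e2 : gphi s (z + h) - gphi s z - (s - expC z) * h * gphi s z =
    gphi s z * ((expC W - 1 - W) - expC z * (expC h - 1 - h)).
  by rewrite e1 /W; ring.
rewrite e2 normcM.
have W1 : normc W <= n * (S + K * V).
  apply: (le_trans (normc_triangle _ _)); rewrite normc_opp !normcM nz -/S -/n mulrDr.
  rewrite [S * n]mulrC lerD2l -/V.
  have -> : n * (K * V) = V * (K * n) by ring.
  by rewrite ler_pM2l// expC_sub1_le.
have SKV0 : 0 <= S + K * V by rewrite addr_ge0// mulr_ge0// ltW.
have t1 : normc (expC W - 1 - W) <= 8 * (S ^+ 2 + K ^+ 2) * expR S * (n ^+ 2 * (1 + V ^+ 2) * expR (c / 2 * V)).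
  apply: (le_trans (normc_expC_sub1_subz W)).
  have -> : 8 * (S ^+ 2 + K ^+ 2) * expR S * (n ^+ 2 * (1 + V ^+ 2) * expR (c / 2 * V)) =
     (8 * (S ^+ 2 + K ^+ 2) * (n ^+ 2 * (1 + V ^+ 2))) * (expR S * expR (c / 2 * V)) by ring.
  apply: ler_pM; rewrite ?mulr_ge0 ?sqr_ge0 ?expR_ge0 ?normc_ge0//.
    have w2 : normc W ^+ 2 <= (n * (S + K * V)) ^+ 2.
      by rewrite lerXn2r ?nnegrE ?normc_ge0 ?mulr_ge0.
    have : (S + K * V) ^+ 2 <= 2 * (S ^+ 2 + K ^+ 2) * (1 + V ^+ 2).
      have := sqr_ge0 (S - K * V); have := sqr_ge0 (S * V); have := sqr_ge0 K.
      rewrite !exprMn; nra.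
    have n20 := sqr_ge0 n.
    move=> /(ler_wpM2l n20); rewrite exprMn in w2.
    lra.
  rewrite -expRD ler_expR; apply: (le_trans W1); rewrite mulrDr mulrA.
  by rewrite lerD// ?ler_piMl// ler_wpM2r// ltW.
have t2 : normc (expC z * (expC h - 1 - h)) <= 4 * E * (n ^+ 2 * (1 + V ^+ 2) * expR (c / 2 * V)).
  rewrite normcM nz.
  have a1 : normc (expC h - 1 - h) <= 4 * E * n ^+ 2.
    apply: (le_trans (normc_expC_sub1_subz h)); rewrite -/n [leRHS]mulrAC.
    by rewrite ler_wpM2l ?mulr_ge0 ?sqr_ge0// ler_expR.
  have a2 : V <= (1 + V ^+ 2) * expR (c / 2 * V).
    rewrite -[leLHS]mulr1; apply: ler_pM => //; first exact: ltW.
      have := sqr_ge0 (V - 1); nra.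
    by rewrite -expR0 ler_expR mulr_ge0// ltW// divr_gt0.
  have -> : 4 * E * (n ^+ 2 * (1 + V ^+ 2) * expR (c / 2 * V)) =
     ((1 + V ^+ 2) * expR (c / 2 * V)) * (4 * E * n ^+ 2) by ring.
  by apply: ler_pM => //; rewrite ?normc_ge0// ltW.
have t3 : normc ((expC W - 1 - W) - expC z * (expC h - 1 - h)) <=
    B * (n ^+ 2 * (1 + V ^+ 2) * expR (c / 2 * V)).
  apply: (le_trans (normc_triangle _ _)); rewrite normc_opp /B mulrDl.
  exact: lerD.
have p1 : normc (gphi s z) <= expR (`|Im s| * pi) * gkern (Re s) c v.
  rewrite normc_gphi; apply: ler_pM; rewrite ?expR_ge0 ?gkern_ge0//.
    rewrite ler_expR (le_trans (ler_norm _))// normrN normrM ler_wpM2l//.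
  by rewrite /gkern ler_expR lerD2l lerN2 ler_wpM2r ?expR_ge0.
apply: (le_trans (ler_pM (normc_ge0 _) (normc_ge0 _) p1 t3)).
(* The factor [V^2 = e^(2v)] raises the first parameter by [2], and [e^(c V / 2)] lowers the second
   from [c] to [c / 2]. *)
have -> : gkern (Re s) (c / 2) v + gkern (Re s + 2) (c / 2) v =
    gkern (Re s) c v * ((1 + V ^+ 2) * expR (c / 2 * V)).
  rewrite mulrDl mul1r mulrDr /gkern /V -!expRD; congr (expR _ + _); first by field.
  by rewrite -expRM_natl -!expRD; congr expR; field.
rewrite le_eqVlt; apply/orP; left; apply/eqP; ring.
Qed.

(** Cutting the way from [0] to [y] into [n] equal steps gives a total variation of at most
    [n C (y / n)^2], which tends to [0]. *)
Lemma quadratic_increment_cst (H : R -> R[i]) (C delta y : R) : 0 <= C -> 0 < delta ->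
  (forall t h, `|t| <= `|y| -> `|t + h| <= `|y| -> `|h| <= delta ->
     normc (H (t + h) - H t) <= C * h ^+ 2) -> H y = H 0.
Proof.
move=> C0 d0 hH.
have step (n : nat) : `|y| / n.+1%:R <= delta -> normc (H y - H 0) <= C * y ^+ 2 / n.+1%:R.
  move=> hn; pose h := y / n.+1%:R.
  have n0 : 0 < n.+1%:R :> R by rewrite ltr0n.
  have nh : `|h| = `|y| / n.+1%:R by rewrite normrM normfV (gtr0_norm n0).
  have kh (k : nat) : (k <= n.+1)%N -> `|k%:R * h| <= `|y|.
    move=> kn; rewrite normrM nh ger0_norm ?ler0n// mulrCA ler_piMr//.
    by rewrite ler_pdivrMr// mul1r ler_nat.
  have key (k : nat) : (k <= n.+1)%N -> normc (H (k%:R * h) - H 0) <= k%:R * (C * h ^+ 2).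
    elim: k => [|k ih] kn.
      by rewrite !mul0r subrr (normc_real 0) normr0.
    have e : k.+1%:R * h = k%:R * h + h by rewrite -natr1 mulrDl mul1r.
    have -> : H (k.+1%:R * h) - H 0 = (H (k%:R * h + h) - H (k%:R * h)) + (H (k%:R * h) - H 0).
      by rewrite e; ring.
    apply: (le_trans (normc_triangle _ _)).
    rewrite -natr1 mulrDl mul1r addrC; apply: lerD; first by apply: ih; exact: ltnW.
    by apply: hH; rewrite -?e ?kh// ?nh// ltnW.
  have := key n.+1 (leqnn _).
  have -> : n.+1%:R * h = y by rewrite /h mulrCA divff ?mulr1// lt0r_neq0.
  move=> /le_trans; apply; rewrite le_eqVlt; apply/orP; left; apply/eqP; rewrite /h.
  by field; rewrite lt0r_neq0.
apply/eqP; rewrite -subr_eq0; apply/eqP/ComplexField.Normc.eq0_normc/eqP.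
rewrite eq_le normc_ge0 andbT leNgt; apply/negP; set e := normc _ => e0.
(* Beyond the first summand the step length is below [delta]; beyond the second the accumulated
   error is below [e]. *)
pose B := `|y| / delta + C * y ^+ 2 / e; pose n := Num.bound B.
have b1 : 0 <= `|y| / delta by rewrite divr_ge0// ltW.
have b2 : 0 <= C * y ^+ 2 / e by rewrite divr_ge0 ?(ltW e0)// mulr_ge0// sqr_ge0.
have Bn : B < n.+1%:R.
  by rewrite (lt_le_trans (archi_boundP _)) ?addr_ge0// ler_nat.
have n0 : 0 < n.+1%:R :> R by rewrite ltr0n.
have c1 : `|y| / n.+1%:R <= delta.
  by rewrite ler_pdivrMr// mulrC -ler_pdivrMr// ltW// (le_lt_trans _ Bn)// lerDl.
have c2 : C * y ^+ 2 / n.+1%:R < e.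
  by rewrite ltr_pdivrMr// -ltr_pdivrMl//; apply: le_lt_trans Bn; rewrite mulrC lerDr.
by have := le_lt_trans (step n c1) c2; rewrite ltxx.
Qed.

(* Stands in for Cauchy's theorem: up to [O(h^2)], the increment of [gphi] in the
   direction [i h] is [i] times its increment in the direction [h], and the latter
   integrates to [0] by translation invariance. *)
Lemma gphi_vertical_step s (c : R) : 0 < Re s -> 0 < c ->
  exists C delta : R, [/\ 0 <= C, 0 < delta & forall y h : R, c <= cos y -> c <= cos (y + h) ->
    `|y| <= pi -> `|h| <= delta ->
    normc (integralC mu (fun v => gphi s (v +i* (y + h))) - integralC mu (fun v => gphi s (v +i* y)))
      <= C * h ^+ 2].
Proof.
move=> s0 c0; have [C [delta [C0 d0 hC]]] := gphi_second_order s c0.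
pose G v := gkern (Re s) (c / 2) v + gkern (Re s + 2) (c / 2) v.
have c20 : 0 < c / 2 by rewrite divr_gt0.
have iG : mu.-integrable setT (fun v => (G v)%:E).
  under eq_fun do rewrite EFinD; apply: integrableD => //; apply: integrable_gkern => //.
  by rewrite addr_gt0.
have G0 v : 0 <= G v by rewrite addr_ge0// gkern_ge0.
have IG0 : 0 <= \int[mu]_v G v by apply: Rintegral_ge0 => v _.
exists (2 * (2 * C * \int[mu]_v G v)), delta; split => //.
  by rewrite !mulr_ge0.
move=> y h cy cyh ypi hd.
have cy0 : 0 < cos y := lt_le_trans c0 cy.
have cyh0 : 0 < cos (y + h) := lt_le_trans c0 cyh.
have i1 := integrableC_gphi s0 cy0.
have i2 := integrableC_gphi s0 cyh0.
have i3 := integrableC_translate h (continuousC_gphi s y) i1.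
pose ii : R[i] := 0 +i* 1.
have -> : integralC mu (fun v => gphi s (v +i* (y + h))) - integralC mu (fun v => gphi s (v +i* y)) =
    integralC mu (fun v => (gphi s (v +i* (y + h)) - gphi s (v +i* y))
       - ii * (gphi s ((v + h) +i* y) - gphi s (v +i* y))).
  have j1 := integrableCB i2 i1; have j2 := integrableCB i3 i1.
  rewrite (integralCB j1 (integrableCZ ii j2)) (integralCZ ii j2) (integralCB i2 i1) (integralCB i3 i1).
  by rewrite (integralC_translate h (continuousC_gphi s y) i1) subrr mulr0 subr0.
have -> : 2 * (2 * C * \int[mu]_v G v) * h ^+ 2 = 2 * (\int[mu]_v ((2 * C * h ^+ 2) * G v)).
  by rewrite RintegralZl//; ring.
apply: normc_integralC_le.
- apply: integrableCB; first exact: integrableCB.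
  by apply: integrableCZ; exact: integrableCB.
- by under eq_fun do rewrite EFinM; exact: integrableZl.
move=> v; set z := v +i* y.
have e1 : v +i* (y + h) = z + ii * h%:C by apply: complex_eqP; rewrite /=; ring.
have e2 : (v + h) +i* y = z + h%:C by apply: complex_eqP; rewrite /=; ring.
have n1 : normc h%:C = `|h| by exact: normc_real.
have nii : normc ii = 1 by rewrite normc_imag normr1.
have n2 : normc (ii * h%:C) = `|h| by rewrite normcM nii mul1r.
have b1 := hC v y (ii * h%:C) cy ypi; rewrite n2 in b1; move/(_ hd) in b1.
have b2 := hC v y h%:C cy ypi; rewrite n1 in b2; move/(_ hd) in b2.
rewrite real_normK ?num_real// -/z -/(G v) in b1 b2.
rewrite e1 e2.
have -> : gphi s (z + ii * h%:C) - gphi s z - ii * (gphi s (z + h%:C) - gphi s z) =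
  (gphi s (z + ii * h%:C) - gphi s z - (s - expC z) * (ii * h%:C) * gphi s z)
  - ii * (gphi s (z + h%:C) - gphi s z - (s - expC z) * h%:C * gphi s z) by ring.
apply: (le_trans (normc_triangle _ _)); rewrite normc_opp normcM nii mul1r.
lra.
Qed.

Lemma gphi_vertical s y : 0 < Re s -> `|y| < pi / 2 ->
  integralC mu (fun v => gphi s (v +i* y)) = GammaC s.
Proof.
move=> s0 ypi; have pi0 := pi_gt0 R.
have cpos (t : R) : `|t| < pi / 2 -> 0 < cos t.
  by move=> /ltr_normlP[h1 h2]; apply: cos_gt0_pihalf; lra.
(* [cos] decreases with [|t|] on [[0, pi]], so [cos y] is a lower bound valid on the whole segment
   from [0] to [y], and one pair [C], [delta] serves all steps. *)
have cle t : `|t| <= `|y| -> cos y <= cos t.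
  have yp : `|y| <= pi by lra.
  move=> ty; rewrite -(cos_norm t) -(cos_norm y) leNgt ltr_cos -?leNgt// in_itv/= normr_ge0//=.
  exact: le_trans ty yp.
have [C [delta [C0 d0 hC]]] := gphi_vertical_step s0 (cpos _ ypi).
apply: (quadratic_increment_cst (H := fun y => integralC mu (fun v => gphi s (v +i* y))) C0 d0).
move=> t h ty thy hd; apply: hC => //; try exact: cle.
by apply: ltW; apply: (le_lt_trans ty); apply: (lt_trans ypi); lra.
Qed.

Lemma gphi_shift1 s v : expC v%:C * gphi s v%:C = gphi (s + 1) v%:C.
Proof. by rewrite /gphi -expCD; congr expC; ring. Qed.

Lemma integrableC_gphi0 s : 0 < Re s -> integrableC mu (fun v => gphi s v%:C).
Proof. by move=> s0; apply: integrableC_gphi => //; rewrite cos0. Qed.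

(** Along the real line the derivative of [gphi s] is [s gphi s - gphi (s + 1)]. Its integral [I]
    vanishes: translation by [h] does not change the integral of [gphi s], so [h |I|] is bounded by
    the Taylor remainder [C' h^2]. *)
Lemma GammaC_functional s : 0 < Re s -> GammaC (s + 1) = s * GammaC s.
Proof.
move=> s0; have c0 : (0 : R) < 1 by [].
have [C [delta [C0 d0 hC]]] := gphi_second_order s c0.
pose G v := gkern (Re s) (1 / 2) v + gkern (Re s + 2) (1 / 2) v.
have c20 : (0 : R) < 1 / 2 by rewrite divr_gt0.
have iG : mu.-integrable setT (fun v => (G v)%:E).
  under eq_fun do rewrite EFinD; apply: integrableD => //; apply: integrable_gkern => //.
  by rewrite addr_gt0.
have G0 v : 0 <= G v by rewrite addr_ge0// gkern_ge0.
have IG0 : 0 <= \int[mu]_v G v by apply: Rintegral_ge0 => v _.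
have i1 := integrableC_gphi0 s0.
have s10 : 0 < Re (s + 1) by rewrite cReD addr_gt0.
have i2 := integrableC_gphi0 s10.
have i3 h := integrableC_translate h (continuousC_gphi s 0) i1.
pose I := integralC mu (fun v => (s - expC v%:C) * gphi s v%:C).
have eI v : (s - expC v%:C) * gphi s v%:C = s * gphi s v%:C - gphi (s + 1) v%:C.
  by rewrite mulrBl gphi_shift1.
have iI : integrableC mu (fun v => (s - expC v%:C) * gphi s v%:C).
  by under eq_fun do rewrite eI; apply: integrableCB => //; exact: integrableCZ.
have IE : I = s * GammaC s - GammaC (s + 1).
  rewrite /I /GammaC -integralCZ// -integralCB//; last exact: integrableCZ.
  by congr integralC; apply/funext => v; rewrite eI.
suff I0 : I = 0 by apply/esym/eqP; rewrite -subr_eq0 -IE I0.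
apply: ComplexField.Normc.eq0_normc; apply/eqP; rewrite eq_le normc_ge0 andbT leNgt.
apply/negP; set e := normc I => e0.
pose C' := 2 * (C * \int[mu]_v G v).
have C'0 : 0 <= C' by rewrite !mulr_ge0.
(* Chosen with [C' h < e], which contradicts [h e <= C' h^2]; the [+ 1] keeps the denominator
   positive. *)
pose h := Num.min delta (e / (C' + 1)).
have h0 : 0 < h by rewrite lt_min d0 divr_gt0//; lra.
have hd : h <= delta by rewrite ge_min lexx.
have he : h * (C' + 1) <= e.
  by rewrite -ler_pdivlMr; [rewrite ge_min lexx orbT|lra].
have key : h * e <= C' * h ^+ 2.
  have -> : h * e = normc (- (h%:C * I)) by rewrite normc_opp normcM normc_real gtr0_norm.
  have -> : - (h%:C * I) = integralC mu (fun v => (gphi s ((v + h) +i* 0) - gphi s v%:C)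
       - h%:C * ((s - expC v%:C) * gphi s v%:C)).
    have j1 := integrableCB (i3 h) i1.
    rewrite (integralCB j1 (integrableCZ h%:C iI)) (integralCZ h%:C iI) (integralCB (i3 h) i1).
    by rewrite (integralC_translate h (continuousC_gphi s 0) i1) subrr sub0r.
  have -> : C' * h ^+ 2 = 2 * (\int[mu]_v ((C * h ^+ 2) * G v)).
    by rewrite RintegralZl// /C'; ring.
  apply: normc_integralC_le.
  - by apply: integrableCB; [exact: integrableCB|exact: integrableCZ].
  - by under eq_fun do rewrite EFinM; exact: integrableZl.
  move=> v; have := hC v 0 h%:C; rewrite cos0 lexx normr0 pi_ge0 normc_real gtr0_norm//.
  move=> /(_ isT isT hd).
  have -> : v +i* 0 + h%:C = (v + h) +i* 0 by apply: complex_eqP; rewrite /=; ring.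
  by rewrite -/(G v) [h%:C * _]mulrA [h%:C * _]mulrC.
have : e <= C' * h by rewrite -(ler_pM2l h0); apply: (le_trans key); rewrite le_eqVlt; apply/orP; left; apply/eqP; ring.
rewrite leNgt => /negP; apply; apply: lt_le_trans he; lra.
Qed.

Lemma normc_laplace_kernel s z v :
  normc (expC (s * v%:C - z * (expR v)%:C)) = gkern (Re s) (Re z) v.
Proof. by rewrite normc_expC cReD cReN !cReM /gkern /= !mulr0 !subr0. Qed.

Lemma continuousC_laplace_kernel s z : continuousC (fun v => expC (s * v%:C - z * (expR v)%:C)).
Proof.
apply: continuousC_exp; rewrite [X in continuousC X](_ : _ = fun v => s * v%:C + (- z) * (expR v)%:C).
  apply: continuousCD; apply: continuousCM; try exact: continuousC_cst.
    by apply: continuousC_real => x.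
  by apply: continuousC_real; exact: continuous_expR.
by apply/funext => v; rewrite mulNr.
Qed.

Lemma integrableC_laplace_kernel s z : 0 < Re s -> 0 < Re z ->
  integrableC mu (fun v => expC (s * v%:C - z * (expR v)%:C)).
Proof.
move=> s0 z0; apply: (@integrableC_dominated _ _ _ mu _ (gkern (Re s) (Re z))).
- exact/continuousC_measurable/continuousC_laplace_kernel.
- exact: integrable_gkern.
- by move=> v; rewrite normc_laplace_kernel.
Qed.

(** Shifting the variable by [Log z = u + i y] multiplies the kernel by [z^s]. The shift by [u] is a
    translation of the line, and the shift by [i y] is [gphi_vertical]. *)
Lemma integralC_laplace_kernel s z : 0 < Re s -> 0 < Re z ->
  integralC mu (fun v => expC (s * v%:C - z * (expR v)%:C)) = GammaC s * powC z (- s).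
Proof.
move=> s0 z0; have yb := LogC_Im_bound z0.
case E : (LogC z) yb => [u y] /= yb.
have cy : 0 < cos y by move/ltr_normlP: yb => [h1 h2]; apply: cos_gt0_pihalf; lra.
have := gphi_vertical s0 yb.
rewrite -(integralC_translate u (continuousC_gphi s y) (integrableC_gphi s0 cy)) => <-.
rewrite powCN div1r.
have pz : powC z s != 0.
  apply/eqP => h; have := normc_expC (s * LogC z).
  by rewrite -/(powC z s) h ComplexField.Normc.normc0 => /esym/eqP; rewrite gt_eqF ?expR_gt0.
have -> : (fun v : R => gphi s ((v + u) +i* y)) =
    (fun v => powC z s * expC (s * v%:C - z * (expR v)%:C)).
  apply/funext => v; rewrite /powC /gphi -expCD; congr expC.
  have -> : (v + u) +i* y = v%:C + LogC z by rewrite E; apply: complex_eqP; rewrite /=; ring.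
  by rewrite expCD expC_LogC// expC_real; ring.
rewrite integralCZ; last exact: integrableC_laplace_kernel.
by rewrite mulrC mulKf.
Qed.

Definition rgamma (a : R) := \int[mu]_v gkern a 1 v.

Lemma GammaC_real (a : R) : GammaC a%:C = (rgamma a)%:C.
Proof.
have e v : gphi a%:C v%:C = (gkern a 1 v)%:C.
  rewrite /gphi expC_real (_ : _ - _ = (a * v - 1 * expR v)%:C) ?expC_real//.
  by apply: complex_eqP; rewrite /=; ring.
rewrite /GammaC; under eq_fun do rewrite e.
by apply: complex_eqP => //=; rewrite /Rintegral integral0.
Qed.

Lemma rgamma_functional (a : R) : 0 < a -> rgamma (a + 1) = a * rgamma a.
Proof.
move=> a0; have := @GammaC_functional a%:C a0.
have -> : a%:C + 1 = (a + 1)%:C by apply: complex_eqP; rewrite /=; ring.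
rewrite !GammaC_real => /(congr1 (@complex.Re R)) /=.
by rewrite mul0r subr0.
Qed.

Lemma rgamma_gt0 (a : R) : 0 < a -> 0 < rgamma a.
Proof.
move=> a0; have ig := integrable_gkern a0 (@ltr01 R).
rewrite /rgamma /Rintegral; apply: fine_gt0; apply/andP; split; last first.
  by have /fin_numPlt/andP[] := integrable_fin_num measurableT ig.
pose D : set (measurableTypeR R) := `[0, 1]%classic.
have mg : measurable_fun setT (fun v : measurableTypeR R => (gkern a 1 v)%:E) := measurable_int _ ig.
have mD : measurable D by exact: measurable_itv.
(* On [[0, 1]] one has [a v >= 0] and [e^v <= e], so the integrand is at least [e^(-e)]. *)
apply: (@lt_le_trans _ _ (\int[mu]_(v in D) (expR (- expR 1))%:E)%E).
  have m1 : mu D = 1%:E by rewrite /D lebesgue_measure_itv/= lte_fin ltr01 sube0.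
  by rewrite integral_cst// [X in (_ * X)%E]m1 mule1 lte_fin expR_gt0.
apply: (@le_trans _ _ (\int[mu]_(v in D) (gkern a 1 v)%:E)%E).
  apply: ge0_le_integral => //.
  - exact: measurable_funTS.
  - move=> v; rewrite /D /= in_itv/= => /andP[v0 v1].
    rewrite lee_fin ler_expR mul1r.
    have : 0 <= a * v by rewrite mulr_ge0// ltW.
    have : expR v <= expR 1 by rewrite ler_expR.
    by lra.
by apply: ge0_subset_integral => // v _; rewrite lee_fin expR_ge0.
Qed.

(** With [A = e^(u/2)] and [B = 1 / A] the bound is [4 (A - B)^2], and [|A - B| >= |u| / 2]. It
    trades the second moment of [u] for exponential moments, which are values of Gamma at [a + 1]
    and [a - 1]. *)
Lemma sqr_le_cosh (u : R) : u ^+ 2 <= 4 * (expR u + expR (- u) - 2).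
Proof.
pose A := expR (u / 2); pose B := expR (- (u / 2)).
have AB : A * B = 1 by rewrite /A /B -expRD subrr expR0.
have A2 : expR u = A ^+ 2 by rewrite /A -expRM_natl; congr expR; field.
have B2 : expR (- u) = B ^+ 2 by rewrite /B -expRM_natl; congr expR; field.
have a1 : 1 + u / 2 <= A by exact: expR_ge1Dx.
have b1 : 1 - u / 2 <= B by exact: expR_ge1Dx.
have A0 : 0 < A by exact: expR_gt0.
have B0 : 0 < B by exact: expR_gt0.
have -> : expR u + expR (- u) - 2 = (A - B) ^+ 2.
  have -> : (A - B) ^+ 2 = A ^+ 2 + B ^+ 2 - 2 * (A * B) by ring.
  by rewrite A2 B2 AB mulr1.
have [u0|u0] := leP 0 u.
  have : 1 <= A by lra.
  have : B <= 1 by rewrite -expR0 ler_expR; lra.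
  nra.
have : A <= 1 by rewrite -expR0 ler_expR; lra.
have : 1 <= B by lra.
nra.
Qed.

Lemma GammaC_shift_eq0 s n : 0 < Re s -> GammaC s = 0 -> GammaC (s + n%:R) = 0.
Proof.
move=> s0 h; elim: n => [|n ih]; first by rewrite addr0.
have sn : 0 < Re (s + n%:R).
  have -> : (n%:R : R[i]) = (n%:R)%:C by rewrite rmorph_nat.
  by rewrite cReD/= (lt_le_trans s0)// lerDl ler0n.
by rewrite -natr1 addrA GammaC_functional// ih mulr0.
Qed.

(* Recentring at [ln a] makes the phase [t (v - ln a)] small on average under the
   density proportional to [e^(a v - e^v)], so the integral cannot cancel. *)
Lemma GammaC_neq0_large (a t : R) : 1 < a -> 2 * t ^+ 2 < a - 1 -> GammaC (a +i* t) != 0.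
Proof.
move=> a1 ta; have a0 : 0 < a by lra.
have am0 : 0 < a - 1 by lra.
have ap0 : 0 < a + 1 by lra.
pose c := ln a; have ec : expR c = a by rewrite lnK.
have ig (x : R) : 0 < x -> mu.-integrable setT (fun v => (gkern x 1 v)%:E).
  by move=> x0; exact: integrable_gkern.
have eP v : gkern a 1 v * expR (v - c) = a^-1 * gkern (a + 1) 1 v.
  by rewrite /gkern -[X in _ = X^-1 * _]ec -expRN -!expRD; congr expR; ring.
have eM v : gkern a 1 v * expR (- (v - c)) = a * gkern (a - 1) 1 v.
  rewrite /gkern -[X in _ = X * _]ec -!expRD; congr expR; ring.
pose q v := gkern a 1 v * cos (t * (v - c)).
(* A lower bound for the cosine integrand, from [1 - cos x <= x^2 / 2] and [sqr_le_cosh], whose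
   integral is computable. *)
pose l v := gkern a 1 v - 2 * t ^+ 2 * (a^-1 * gkern (a + 1) 1 v + a * gkern (a - 1) 1 v - 2 * gkern a 1 v).
have lq v : l v <= q v.
  rewrite /l -eP -eM.
  have -> : gkern a 1 v - 2 * t ^+ 2 * (gkern a 1 v * expR (v - c) + gkern a 1 v * expR (- (v - c)) - 2 * gkern a 1 v)
    = gkern a 1 v * (1 - 2 * t ^+ 2 * (expR (v - c) + expR (- (v - c)) - 2)) by ring.
  rewrite ler_wpM2l ?gkern_ge0//.
  have := oneB_cos_le (t * (v - c)); rewrite exprMn.
  have := ler_wpM2l (sqr_ge0 t) (sqr_le_cosh (v - c)); lra.
have iq : mu.-integrable setT (fun v => (q v)%:E).
  apply: (integrable_dominated _ (ig a a0)) => [|v].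
    apply: measurable_funM; first by have /measurable_EFinP := measurable_int _ (ig a a0).
    apply: continuous_measurable_fun => v.
    apply: continuous_comp; last exact: continuous_cos.
    by apply: cvgM; [exact: cvg_cst|apply: cvgB => //; exact: cvg_cst].
  by rewrite normrM ger0_norm ?gkern_ge0// ler_piMr ?gkern_ge0// ler_norml cos_le1 cos_geN1.
have iz (k x : R) : 0 < x -> mu.-integrable setT (fun v => (k * gkern x 1 v)%:E).
  by move=> x0; under eq_fun do rewrite EFinM; apply: integrableZl => //; exact: ig.
have i1 : mu.-integrable setT (fun v => (a^-1 * gkern (a + 1) 1 v + a * gkern (a - 1) 1 v)%:E).
  by under eq_fun do rewrite EFinD; apply: integrableD => //; exact: iz.
have i2 : mu.-integrable setT (fun v => (a^-1 * gkern (a + 1) 1 v + a * gkern (a - 1) 1 v - 2 * gkern a 1 v)%:E).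
  by under eq_fun do rewrite EFinB; apply: integrableB => //; exact: iz.
have i3 : mu.-integrable setT (fun v => (2 * t ^+ 2 * (a^-1 * gkern (a + 1) 1 v + a * gkern (a - 1) 1 v - 2 * gkern a 1 v))%:E).
  by under eq_fun do rewrite EFinM; exact: integrableZl.
have il : mu.-integrable setT (fun v => (l v)%:E).
  by rewrite /l; under eq_fun do rewrite EFinB; apply: integrableB => //; exact: ig.
(* By the functional equation the bracket integrates to [Gamma(a) (1 + a / (a - 1) - 2) = Gamma(a) /
   (a - 1)]; this is where the condition [2 t^2 < a - 1] comes from. *)
have el : \int[mu]_v l v = rgamma a * (1 - 2 * t ^+ 2 / (a - 1)).
  rewrite /l RintegralB//; last exact: ig.
  rewrite RintegralZl// RintegralB//; last exact: iz.
  rewrite RintegralD//; [|exact: iz|exact: iz].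
  rewrite !RintegralZl//; [|exact: ig|exact: ig|exact: ig].
  rewrite -/(rgamma a) -/(rgamma (a + 1)) -/(rgamma (a - 1)) rgamma_functional//.
  have := rgamma_functional am0; rewrite subrK => ->.
  by field; rewrite !lt0r_neq0.
have q0 : 0 < \int[mu]_v q v.
  apply: (@lt_le_trans _ _ (\int[mu]_v l v)); last exact: le_Rintegral.
  rewrite el mulr_gt0 ?rgamma_gt0//.
  by rewrite subr_gt0 ltr_pdivrMr// mul1r.
have iC : integrableC mu (fun v => gphi (a +i* t) v%:C) by apply: integrableC_gphi0.
apply/eqP => g0; move: q0.
(* Multiplication by [e^(-i t c)] recentres the phase and does not affect whether Gamma vanishes. *)
suff -> : \int[mu]_v q v = Re (expC (0 +i* (- (t * c))) * GammaC (a +i* t)).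
  by rewrite g0 mulr0 ltxx.
rewrite /GammaC -integralCZ//=; apply: eq_Rintegral => v _.
by rewrite cos0 sin0 !mulr0 !add0r !subr0 mulr1 expR0 !mul1r cosN sinN /q /gkern mul1r mulrBr cosB; ring.
Qed.

(** A zero at [s] persists at [s + n]; for [n > 2 (Im s)^2 + 1] this contradicts
    [GammaC_neq0_large]. *)
Lemma GammaC_neq0 s : 0 < Re s -> GammaC s != 0.
Proof.
move=> s0; apply/eqP => h; pose B := 2 * Im s ^+ 2 + 1; pose n := Num.bound B.
have B0 : 0 <= B by rewrite addr_ge0// mulr_ge0// sqr_ge0.
have Bn : B < n%:R by exact: archi_boundP.
have := GammaC_shift_eq0 n s0 h; apply/eqP.
have -> : s + n%:R = (Re s + n%:R) +i* Im s.
  by rewrite -(rmorph_nat (real_complex R)); case: (s) => u w; apply: complex_eqP; rewrite /= ?addr0.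
have i0 := sqr_ge0 (Im s).
by apply: GammaC_neq0_large; move: Bn; rewrite /B; lra.
Qed.

End gamma_function.

(** * Expectations of products of independent variables *)

Section bounded_measurable.
Context (d : measure_display) (T : measurableType d) (R : realType).
Implicit Types f g : T -> R.

Definition bounded_measurable f :=
  measurable_fun setT f /\ exists B, forall x, `|f x| <= B.

Lemma bounded_measurable_cst c : bounded_measurable (fun=> c).
Proof. by split; [exact: measurable_cst|exists `|c|]. Qed.

Lemma bounded_measurableM f g : bounded_measurable f -> bounded_measurable g ->
  bounded_measurable (fun x => f x * g x).
Proof.
move=> [mf [B hB]] [mg [C hC]]; split; first exact: measurable_funM.
by exists (B * C) => x; rewrite normrM; apply: ler_pM.
Qed.

Lemma bounded_measurableD f g : bounded_measurable f -> bounded_measurable g ->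
  bounded_measurable (fun x => f x + g x).
Proof.
move=> [mf [B hB]] [mg [C hC]]; split; first exact: measurable_funD.
by exists (B + C) => x; rewrite (le_trans (ler_normD _ _))// lerD.
Qed.

Lemma bounded_measurable_indic (A : set T) : measurable A -> bounded_measurable (\1_A : T -> R).
Proof.
move=> mA; split; first exact: measurable_indic.
by exists 1 => x; rewrite indicE; case: (x \in A); rewrite ?normr1 ?normr0.
Qed.

Lemma bounded_measurable_prod (I : Type) (s : seq I) (Q : pred I) (f : I -> T -> R) :
  (forall i, bounded_measurable (f i)) ->
  bounded_measurable (fun x => \prod_(i <- s | Q i) f i x).
Proof.
move=> hf; elim: s => [|i s ih].
  by under eq_fun do rewrite big_nil; exact: bounded_measurable_cst.
under eq_fun do rewrite big_cons; case: (Q i) => //.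
exact: bounded_measurableM.
Qed.

Lemma bounded_measurable_sum (I : Type) (s : seq I) (Q : pred I) (f : I -> T -> R) :
  (forall i, bounded_measurable (f i)) ->
  bounded_measurable (fun x => \sum_(i <- s | Q i) f i x).
Proof.
move=> hf; elim: s => [|i s ih].
  by under eq_fun do rewrite big_nil; exact: bounded_measurable_cst.
under eq_fun do rewrite big_cons; case: (Q i) => //.
exact: bounded_measurableD.
Qed.

Variable P : probability T R.

Lemma bounded_measurable_integrable f : bounded_measurable f ->
  P.-integrable setT (fun x => (f x)%:E).
Proof.
move=> [mf [B hB]]; apply: (@integrable_dominated _ _ _ P _ (cst B)) => //.
exact: (finite_measure_integrable_cst P B measurableT).
Qed.

Lemma Rintegral_prob_cst c : \int[P]_x c = c.
Proof.
rewrite /Rintegral (_ : (fun _ => c%:E) = cst c%:E)// integral_cst// [X in (_ * X)%E]probability_setT.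
by rewrite mule1.
Qed.

Lemma Rintegral_prob_bound f B : bounded_measurable f -> (forall x, `|f x| <= B) ->
  `|\int[P]_x f x| <= B.
Proof.
move=> bf hB; have i0 := bounded_measurable_integrable bf.
apply: (le_trans (le_normr_Rintegral _ i0)) => //.
rewrite -[leRHS]Rintegral_prob_cst; apply: le_Rintegral => //.
  exact: integrable_norm.
exact: (finite_measure_integrable_cst P B measurableT).
Qed.

Lemma Rintegral_sum_bounded (I : Type) (s : seq I) (f : I -> T -> R) :
  (forall i, bounded_measurable (f i)) ->
  \int[P]_x \sum_(i <- s) f i x = \sum_(i <- s) \int[P]_x f i x.
Proof.
move=> bf; elim: s => [|i s ih].
  by under eq_Rintegral do rewrite big_nil; rewrite big_nil Rintegral_prob_cst.
under eq_Rintegral do rewrite big_cons.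
rewrite big_cons RintegralD ?ih//; apply: bounded_measurable_integrable => //.
exact: bounded_measurable_sum.
Qed.

End bounded_measurable.

Lemma bounded_measurable_comp (d d' : measure_display) (T : measurableType d)
    (T' : measurableType d') (R : realType) (X : T' -> T) (f : T -> R) :
  measurable_fun setT X -> bounded_measurable f -> bounded_measurable (fun x => f (X x)).
Proof.
by move=> mX [mf [B hB]]; split; [exact: measurableT_comp mX|exists B].
Qed.

Section independence.
Context (d : measure_display) (T : measurableType d) (R : realType).
Variable P : probability T R.

Lemma sum_ord_lt (n m : nat) : (m <= n)%N -> (\sum_(j < n) ((j < m)%N)%:R : R) = m%:R.
Proof.
move=> mn; rewrite -natr_sum; congr (_%:R).
rewrite -[RHS](card_ord m) -sum1_card (big_ord_widen n (fun=> 1%N) mn) [RHS]big_mkcond.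
by apply: eq_bigr => i _; case: ifP.
Qed.

(** The sum counts the positive integers below or equal to [n x], that is the integer part of
    [n x]. *)
Lemma layer_cake_approx (n : nat) (x : R) : (0 < n)%N -> 0 <= x <= 1 ->
  `|x - n%:R^-1 * \sum_(j < n) ((j.+1%:R <= n%:R * x)%R)%:R| <= n%:R^-1.
Proof.
move=> n0 /andP[x0 x1]; have nR : 0 < n%:R :> R by rewrite ltr0n.
have nx0 : 0 <= n%:R * x by rewrite mulr_ge0.
have /andP[m1 m2] := truncn_itv nx0.
set m := Num.truncn _ in m1 m2.
have mn : (m <= n)%N.
  by rewrite -(ler_nat R) (le_trans m1)// ler_piMr// ltW.
have -> : \sum_(j < n) ((j.+1%:R <= n%:R * x)%R)%:R = m%:R :> R.
  rewrite -(sum_ord_lt mn); apply: eq_bigr => j _; congr (_%:R).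
  congr nat_of_bool; apply/idP/idP => h.
    by rewrite -ltnS -(ltr_nat R) (le_lt_trans h).
  by rewrite (le_trans _ m1)// ler_nat.
have -> : x - n%:R^-1 * m%:R = (n%:R * x - m%:R) / n%:R by field; rewrite lt0r_neq0.
rewrite normrM normfV [ `|n%:R|]gtr0_norm// ler_piMl ?invr_ge0 ?ler0n//.
rewrite ger0_norm ?subr_ge0// lerBlDr addrC natr1; exact: ltW.
Qed.

(** An affine change brings [f] into [[0, 1]], where it is uniformly within [1 / n] of an average of
    indicators of its superlevel sets. Both sides are linear in [f] and stable under uniform limits
    because [Y] is bounded. *)
Lemma indep_extend (Y : T -> R) (X : {RV P >-> R}) (c : R) : bounded_measurable Y ->
  (forall A, measurable A -> \int[P]_w (Y w * \1_A (X w)) = c * \int[P]_w \1_A (X w)) ->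
  forall f : R -> R, bounded_measurable f ->
    \int[P]_w (Y w * f (X w)) = c * \int[P]_w f (X w).
Proof.
move=> bY hA.
have mX : measurable_fun setT X by exact: measurable_funPT.
have bX (g : R -> R) : bounded_measurable g -> bounded_measurable (fun w => g (X w)).
  by move=> [mg [B hB]]; split; [exact: measurableT_comp mX|exists B].
have bi (g : T -> R) : bounded_measurable g -> P.-integrable setT (EFin \o g).
  exact: bounded_measurable_integrable.
suff h01 (f : R -> R) : measurable_fun setT f -> (forall x, 0 <= f x <= 1) ->
    \int[P]_w (Y w * f (X w)) = c * \int[P]_w f (X w).
  move=> f [mf [B0 hB0]]; pose B := `|B0| + 1.
  have Bp : 0 < B by rewrite ltr_wpDl.
  have hB x : `|f x| <= B.
    by rewrite (le_trans (hB0 x))// (le_trans (ler_norm B0))// lerDl.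
  pose g x := (f x + B) / (2 * B).
  have g01 x : 0 <= g x <= 1.
    have /ler_normlP[h1 h2] := hB x.
    have B2 : 0 < 2 * B by lra.
    by rewrite ler_pdivlMr// mul0r ler_pdivrMr// mul1r; lra.
  have mg : measurable_fun setT g.
    by apply: measurable_funM => //; apply: measurable_funD.
  have bg : bounded_measurable g.
    by split=> //; exists 1 => x; have /andP[? ?] := g01 x; rewrite ger0_norm.
  have fE x : f x = 2 * B * g x - B by rewrite /g; field; rewrite lt0r_neq0.
  have hg := h01 _ mg g01.
  have hT := hA _ measurableT.
  have e1 : \int[P]_w (Y w * f (X w)) = 2 * B * \int[P]_w (Y w * g (X w)) - B * \int[P]_w Y w.
    rewrite -!RintegralZl//; try by apply: bi => //; apply: bounded_measurableM => //; exact: bX.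
    rewrite -RintegralB//.
    - by apply: eq_Rintegral => w _; rewrite fE; ring.
    - apply: bi; apply: bounded_measurableM; first exact: bounded_measurable_cst.
      by apply: bounded_measurableM => //; exact: bX.
    - by apply: bi; apply: bounded_measurableM => //; exact: bounded_measurable_cst.
  have e2 : \int[P]_w f (X w) = 2 * B * \int[P]_w g (X w) - B.
    transitivity (\int[P]_w (2 * B * g (X w) - B)); first by apply: eq_Rintegral => w _; rewrite fE.
    rewrite RintegralB//; first by rewrite RintegralZl ?Rintegral_prob_cst//; apply: bi; exact: bX.
      apply: bi; apply: bounded_measurableM; first exact: bounded_measurable_cst.
      exact: bX.
    by apply: bi; exact: bounded_measurable_cst.
  (* The case [A = setT] identifies [c] with the mean of [Y], so the additive constant of the affine
     change also satisfies the identity. *)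
  have e3 : \int[P]_w Y w = c.
    transitivity (\int[P]_w (Y w * \1_setT (X w))).
      by apply: eq_Rintegral => w _; rewrite indicE in_setT mulr1.
    rewrite hT; under eq_Rintegral do rewrite indicE in_setT.
    by rewrite Rintegral_prob_cst mulr1.
  by rewrite e1 e2 e3 hg; ring.
move=> mf f01.
have bf : bounded_measurable f.
  by split=> //; exists 1 => x; have /andP[? ?] := f01 x; rewrite ger0_norm.
have [mY [K hK]] := bY.
pose A n j : set R := [set x | (j.+1%:R <= n%:R * f x)%R].
have mA n j : measurable (A n j).
  rewrite (_ : A n j = (fun x => n%:R * f x) @^-1` `[j.+1%:R, +oo[); last first.
    by apply/seteqP; split => x; rewrite /A /= in_itv/= andbT.
  rewrite -[X in measurable X]setTI; apply: measurable_funM => //.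
pose fn (n : nat) x := n%:R^-1 * \sum_(j < n) (\1_(A n j) x : R).
have bfn n : bounded_measurable (fn n).
  apply: bounded_measurableM; first exact: bounded_measurable_cst.
  by apply: bounded_measurable_sum => j; exact: bounded_measurable_indic.
have fnP n x : (0 < n)%N -> `|f x - fn n x| <= n%:R^-1.
  move=> n0; rewrite (_ : fn n x = n%:R^-1 * \sum_(j < n) ((j.+1%:R <= n%:R * f x)%R)%:R).
    exact: layer_cake_approx.
  congr (_ * _); apply: eq_bigr => j _; rewrite indicE; congr (_%:R).
  by congr nat_of_bool; apply/idP/idP; rewrite inE.
have hn n : \int[P]_w (Y w * fn n (X w)) = c * \int[P]_w fn n (X w).
  have eL : \int[P]_w (Y w * fn n (X w)) = n%:R^-1 * \sum_(j < n) \int[P]_w (Y w * \1_(A n j) (X w)).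
    transitivity (\int[P]_w (n%:R^-1 * \sum_(j < n) (Y w * \1_(A n j) (X w)))).
      by apply: eq_Rintegral => w _; rewrite /fn mulrCA mulr_sumr.
    have bb j : bounded_measurable (fun w => Y w * \1_(A n j) (X w)).
      by apply: bounded_measurableM => //; apply: bX; exact: bounded_measurable_indic.
    rewrite RintegralZl//; last by apply: bi; exact: bounded_measurable_sum.
    by rewrite Rintegral_sum_bounded.
  have eR : \int[P]_w fn n (X w) = n%:R^-1 * \sum_(j < n) \int[P]_w \1_(A n j) (X w).
    have bb j : bounded_measurable (fun w => \1_(A n j) (X w) : R).
      by apply: bX; exact: bounded_measurable_indic.
    rewrite RintegralZl//; last by apply: bi; exact: bounded_measurable_sum.
    by rewrite Rintegral_sum_bounded.
  rewrite eL eR [RHS]mulrCA; congr (_ * _); rewrite mulr_sumr; apply: eq_bigr => j _; exact: hA.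
apply/eqP; rewrite -subr_eq0 -normr_le0; apply/ler_addgt0Pl => e e0; rewrite addr0.
(* Replacing [f] by [fn n] costs at most [|K| / n] on the left and [|c| / n] on the right. *)
pose n := (Num.bound ((`|K| + `|c|) / e)).+1.
have nb : (`|K| + `|c|) / e < n%:R.
  by rewrite /n -natr1 ltr_pwDr// ltW// archi_boundP// divr_ge0 ?addr_ge0// ltW.
have n0 : 0 < n%:R :> R by rewrite ltr0n.
have bd : bounded_measurable (fun x => f x - fn n x).
  split; first by apply: measurable_funB => //; exact: (bfn n).1.
  by exists n%:R^-1 => x; exact: fnP.
have d1 : \int[P]_w (Y w * f (X w)) = \int[P]_w (Y w * fn n (X w)) + \int[P]_w (Y w * (f (X w) - fn n (X w))).
  rewrite -RintegralD//; first by apply: eq_Rintegral => w _; ring.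
    by apply: bi; apply: bounded_measurableM => //; exact: bX.
  by apply: bi; apply: bounded_measurableM => //; exact: (bX _ bd).
have d2 : \int[P]_w f (X w) = \int[P]_w fn n (X w) + \int[P]_w (f (X w) - fn n (X w)).
  rewrite -RintegralD//; first by apply: eq_Rintegral => w _; ring.
    by apply: bi; exact: bX.
  by apply: bi; exact: (bX _ bd).
have b1 : `|\int[P]_w (Y w * (f (X w) - fn n (X w)))| <= `|K| * n%:R^-1.
  apply: Rintegral_prob_bound; first by apply: bounded_measurableM => //; exact: (bX _ bd).
  move=> w; rewrite normrM; apply: ler_pM => //; last exact: fnP.
  by rewrite (le_trans (hK w))// ler_norm.
have b2 : `|\int[P]_w (f (X w) - fn n (X w))| <= n%:R^-1.
  by apply: Rintegral_prob_bound; [exact: (bX _ bd)|move=> w; exact: fnP].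
rewrite d1 d2 hn.
set u := \int[P]_w (Y w * (f (X w) - fn n (X w))) in b1 *.
set v := \int[P]_w (f (X w) - fn n (X w)) in b2 *.
have -> : c * \int[P]_w fn n (X w) + u - c * (\int[P]_w fn n (X w) + v) = u - c * v by ring.
apply: (le_trans (ler_normB _ _)); rewrite normrM.
apply: (@le_trans _ _ ((`|K| + `|c|) / n%:R)).
  by rewrite mulrDl lerD// ler_wpM2l.
by rewrite ler_pdivrMr// mulrC -ler_pdivrMr// ltW.
Qed.

(** Induction on a list outside which every [f k] is an indicator. If all are indicators this is the
    definition of independence; [indep_extend] then frees one index at a time. *)
Lemma indep_expectation (I : finType) (X : I -> {RV P >-> R}) (f : I -> R -> R) :
  mutually_independent X -> (forall k, bounded_measurable (f k)) ->
  \int[P]_w \prod_k f k (X k w) = \prod_k \int[P]_w f k (X k w).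
Proof.
move=> iX; have mX k : measurable_fun setT (X k) by exact: measurable_funPT.
suff H (s : seq I) : forall f : I -> R -> R, (forall k, bounded_measurable (f k)) ->
    (forall k, k \notin s -> exists2 A, measurable A & f k = \1_A) ->
    \int[P]_w \prod_k f k (X k w) = \prod_k \int[P]_w f k (X k w).
  by move=> bf; apply: (H (enum I)) => // k; rewrite mem_enum.
elim: s => [|k0 s ih] {}f bf hf.
  have /choice[A hAf] : forall k, exists A, measurable A /\ f k = \1_A.
    by move=> k; have [A ? ?] := hf k isT; exists A.
  have mA k : measurable (A k) by have [] := hAf k.
  have fA k : f k = \1_(A k) by have [] := hAf k.
  have mXA k : measurable (X k @^-1` A k).
    by rewrite -[X in measurable X]setTI; exact: mX.
  have e0 : P (\bigcap_(i in [set` [set: I]%SET]) X i @^-1` A i) =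
      (\prod_(i in [set: I]%SET) P (X i @^-1` A i))%E by exact: iX.
  transitivity (fine (P (\bigcap_(i in [set` [set: I]%SET]) X i @^-1` A i))).
    rewrite /Rintegral -[in RHS](setIT (\bigcap_(i in _) _)) -integral_indic//; last first.
      by apply: fin_bigcap_measurable.
    congr fine; apply: eq_integral => w _; congr EFin.
    rewrite indicE; case: (boolP (w \in _)) => [|/negP] h.
      rewrite big1// => k _; rewrite fA indicE.
      by move: h; rewrite inE => /(_ k); rewrite /= inE => /(_ isT) /mem_set ->.
    apply/eqP/prodf_eq0.
    have : ~ (forall k, A k (X k w)).
      by move=> hh; apply: h; rewrite inE => k _; exact: hh.
    move=> /existsNP[k hk]; exists k => //; rewrite fA indicE.
    by rewrite memNset.
  rewrite e0.
  have e1 k : P (X k @^-1` A k) = (\int[P]_w f k (X k w))%:E.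
    have pE : (\int[P]_w (\1_(A k) (X k w))%:E = P (X k @^-1` A k))%E.
      transitivity (\int[P]_w (\1_(X k @^-1` A k) w)%:E)%E; first by [].
      by rewrite integral_indic// setIT.
    by rewrite fA /Rintegral pE fineK// fin_num_measure.
  rewrite (eq_bigr (fun k => (\int[P]_w f k (X k w))%:E)); last by move=> k _; exact: e1.
  rewrite (eq_bigl xpredT); last by move=> i; rewrite inE.
  by rewrite prodEFin.
(* All factors other than the one at [k0] are kept fixed while [f k0] passes from indicators to a
   general function. *)
pose Y w := \prod_(k | k != k0) f k (X k w).
have bY : bounded_measurable Y.
  apply: bounded_measurable_prod => k.
  exact: (bounded_measurable_comp (mX k) (bf k)).
have eY (g : R -> R) w : (\prod_k (if k == k0 then g else f k) (X k w)) = Y w * g (X k0 w).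
  rewrite (bigD1 k0)//= eqxx mulrC; congr (_ * _); apply: eq_bigr => k /negPf ->//.
pose c := \prod_(k | k != k0) \int[P]_w f k (X k w).
have ec (g : R -> R) : \prod_k \int[P]_w (if k == k0 then g else f k) (X k w) = c * \int[P]_w g (X k0 w).
  rewrite (bigD1 k0)//= eqxx mulrC; congr (_ * _); apply: eq_bigr => k /negPf ->//.
have ef : f = fun k => if k == k0 then f k0 else f k.
  by apply/funext => k; case: eqP => [->|].
transitivity (\int[P]_w (Y w * f k0 (X k0 w))).
  by apply: eq_Rintegral => w _; rewrite -eY; apply: eq_bigr => k _; case: eqP => [->|].
transitivity (c * \int[P]_w f k0 (X k0 w)); last first.
  by rewrite -ec; apply: eq_bigr => k _; case: eqP => [->|].
apply: indep_extend => // A mA.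
rewrite -(ec \1_A) -[RHS](ih (fun k => if k == k0 then \1_A else f k)).
- by apply: eq_Rintegral => w _; rewrite eY.
- by move=> k; case: eqP => _ //; exact: bounded_measurable_indic.
- move=> k ks; case: eqP => kk0; first by exists A.
  by apply: hf; rewrite inE negb_or ks andbT; apply/eqP.
Qed.

Lemma integralC_real (mu : {measure set T -> \bar R}) (h : T -> R) :
  integralC mu (fun x => (h x)%:C) = (\int[mu]_x h x)%:C.
Proof. by apply: complex_eqP => //=; rewrite /Rintegral integral0. Qed.

(** Each factor is the sum of its real part and [i] times its imaginary part. Expanding the product
    over all choices [g] of a part for each index leaves only real products. *)
Lemma indep_expectationC (I : finType) (X : I -> {RV P >-> R}) (f : I -> R -> R[i]) :
  mutually_independent X ->
  (forall k, bounded_measurable (fun x => Re (f k x))) ->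
  (forall k, bounded_measurable (fun x => Im (f k x))) ->
  integralC P (fun w => \prod_k f k (X k w)) = \prod_k integralC P (fun w => f k (X k w)).
Proof.
move=> iX rf jf; have mX k : measurable_fun setT (X k) by exact: measurable_funPT.
pose kap (e : bool) : R[i] := if e then 1 else 0 +i* 1.
pose h k (e : bool) x : R := if e then Re (f k x) else Im (f k x).
have bh k e : bounded_measurable (h k e) by case: e; [exact: rf|exact: jf].
have bhX k e : bounded_measurable (fun w => h k e (X k w)).
  exact: (bounded_measurable_comp (mX k) (bh k e)).
have cs (z : R[i]) : z = \sum_(e : bool) kap e * (if e then Re z else Im z)%:C.
  by rewrite big_bool /=; apply: complex_eqP; rewrite ?cReD ?cImD ?cReM ?cImM /=; ring.
have i1 (g : {ffun I -> bool}) : integrableC P (fun w => (\prod_k h k (g k) (X k w))%:C).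
  split => /=; last exact: integrable0.
  by apply: bounded_measurable_integrable; exact: bounded_measurable_prod.
transitivity (integralC P (fun w => \sum_(g : {ffun I -> bool})
    (\prod_k kap (g k)) * (\prod_k h k (g k) (X k w))%:C)).
  congr integralC; apply/funext => w.
  rewrite (eq_bigr _ (fun k _ => cs (f k (X k w)))) bigA_distr_bigA/=.
  apply: eq_bigr => g _; rewrite big_split/=; congr (_ * _).
  by rewrite rmorph_prod.
rewrite integralC_sum; last by move=> g; exact: integrableCZ.
transitivity (\sum_(g : {ffun I -> bool}) \prod_k (kap (g k) * (\int[P]_w h k (g k) (X k w))%:C)).
  apply: eq_bigr => g _; rewrite integralCZ// integralC_real big_split/=; congr (_ * _).
  by rewrite (indep_expectation (f := fun k => h k (g k)) iX)// rmorph_prod.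
rewrite -(bigA_distr_bigA (fun k e => kap e * (\int[P]_w h k e (X k w))%:C)).
apply: eq_bigr => k _; rewrite [RHS]cs; apply: eq_bigr => -[] _ //=.
Qed.

End independence.

(** * Moments from the characteristic function *)

Section polynomial_approximation.
Context {R : realType}.
Implicit Types (f g : R -> R) (p q : {poly R}) (N : nat).

(** A Taylor expansion of order [N] at [0] stated without derivatives, which makes closure under
    sums and products direct. The restriction [delta <= 1] bounds polynomials and [|x|^N] on the
    interval. *)
Definition poly_approx N f := exists p, exists C delta : R,
  [/\ 0 <= C, 0 < delta <= 1 & forall x, `|x| <= delta -> `|f x - p.[x]| <= C * `|x| ^+ N].

Lemma horner_bounded p : exists2 B : R, 0 <= B & forall x, `|x| <= 1 -> `|p.[x]| <= B.
Proof.
exists (\sum_(i < size p) `|p`_i|) => [|x x1]; first exact: sumr_ge0.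
rewrite horner_coef (le_trans (ler_norm_sum _ _ _))//; apply: ler_sum => i _.
by rewrite normrM normrX ler_piMr// exprn_ile1.
Qed.

Lemma poly_approx_poly N p : poly_approx N (horner p).
Proof.
exists p, 0, 1; split => //; first by rewrite ltr01 lexx.
by move=> x _; rewrite subrr normr0 mul0r.
Qed.

Lemma poly_approx_cst N c : poly_approx N (fun=> c).
Proof.
rewrite (_ : (fun=> c) = horner (c%:P)); first exact: poly_approx_poly.
by apply/funext => x; rewrite hornerC.
Qed.

Lemma poly_approxD N f g : poly_approx N f -> poly_approx N g ->
  poly_approx N (fun x => f x + g x).
Proof.
move=> [p [C [d [C0 /andP[d0 d1] hp]]]] [q [D [e [D0 /andP[e0 e1] hq]]]].
exists (p + q), (C + D), (Num.min d e); split; first exact: addr_ge0.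
  by rewrite lt_min d0 e0 ge_min d1.
move=> x; rewrite le_min => /andP[xd xe].
rewrite hornerD (_ : _ - _ = (f x - p.[x]) + (g x - q.[x])); last by ring.
by rewrite (le_trans (ler_normD _ _))// mulrDl lerD ?hp ?hq.
Qed.

Lemma poly_approxM N f g : poly_approx N f -> poly_approx N g ->
  poly_approx N (fun x => f x * g x).
Proof.
move=> [p [C [d [C0 /andP[d0 d1] hp]]]] [q [D [e [D0 /andP[e0 e1] hq]]]].
have [B B0 hB] := horner_bounded p; have [B' B'0 hB'] := horner_bounded q.
exists (p * q), (C * (B' + D) + B * D), (Num.min d e); split.
- by rewrite addr_ge0 ?mulr_ge0 ?addr_ge0.
- by rewrite lt_min d0 e0 ge_min d1.
move=> x; rewrite le_min => /andP[xd xe].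
have x1 : `|x| <= 1 := le_trans xd d1.
have xN : `|x| ^+ N <= 1 by rewrite exprn_ile1.
have xN0 : 0 <= `|x| ^+ N by rewrite exprn_ge0.
have gb : `|g x| <= B' + D.
  rewrite (_ : g x = q.[x] + (g x - q.[x])); last by ring.
  rewrite (le_trans (ler_normD _ _))// lerD ?hB'// (le_trans (hq _ xe))//.
  by rewrite ler_piMr.
rewrite hornerM (_ : _ - _ = (f x - p.[x]) * g x + p.[x] * (g x - q.[x])); last by ring.
rewrite (le_trans (ler_normD _ _))// [leRHS]mulrDl !normrM; apply: lerD.
  by rewrite mulrAC; apply: ler_pM => //; exact: hp.
by rewrite -mulrA; apply: ler_pM => //; [exact: hB|exact: hq].
Qed.

Lemma poly_approxX N f n : poly_approx N f -> poly_approx N (fun x => f x ^+ n).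
Proof.
move=> hf; elim: n => [|n ih].
  by under eq_fun do rewrite expr0; exact: poly_approx_cst.
by under eq_fun do rewrite exprS; exact: poly_approxM.
Qed.

Lemma poly_approx_sum N (I : Type) (s : seq I) (F : I -> R -> R) :
  (forall i, poly_approx N (F i)) -> poly_approx N (fun x => \sum_(i <- s) F i x).
Proof.
move=> hF; elim: s => [|i s ih].
  by under eq_fun do rewrite big_nil; exact: poly_approx_cst.
by under eq_fun do rewrite big_cons; exact: poly_approxD.
Qed.

Lemma poly_approx_prod N (I : Type) (s : seq I) (F : I -> R -> R) :
  (forall i, poly_approx N (F i)) -> poly_approx N (fun x => \prod_(i <- s) F i x).
Proof.
move=> hF; elim: s => [|i s ih].
  by under eq_fun do rewrite big_nil; exact: poly_approx_cst.
by under eq_fun do rewrite big_cons; exact: poly_approxM.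
Qed.

Lemma poly_approx_scale N f c : poly_approx N f -> poly_approx N (fun x => f (c * x)).
Proof.
move=> [p [C [d [C0 /andP[d0 d1] hp]]]].
have c1 : 0 < 1 + `|c| by rewrite ltr_pwDl.
exists (p \Po (c *: 'X)), (C * `|c| ^+ N), (d / (1 + `|c|)); split.
- by rewrite mulr_ge0// exprn_ge0.
- rewrite divr_gt0//= ler_pdivrMr// mul1r (le_trans d1)// lerDl//.
move=> x; rewrite ler_pdivlMr// => xd.
rewrite horner_comp hornerZ hornerX -mulrA -exprMn -normrM; apply: hp.
rewrite normrM mulrC (le_trans _ xd)// ler_wpM2l// lerDr//.
Qed.

(** The derivative of each Taylor polynomial is the preceding one, so one application of the mean
    value theorem gains one power of [|x|] and keeps the constant [e]. *)
Lemma exp_taylor N : exists p, exists2 C : R, 0 <= C &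
  forall x, `|x| <= 1 -> `|expR x - p.[x]| <= C * `|x| ^+ N.
Proof.
pose P n : {poly R} := \sum_(k < n) ((k`!%:R)^-1 *: 'X^k).
have P0 n : (P n.+1).[0] = 1.
  rewrite /P horner_sum big_ord_recl /= hornerZ hornerXn expr0 invr1 mul1r big1 ?addr0// => i _.
  by rewrite hornerZ hornerXn expr0n mulr0.
have dP n : (P n.+1)^`() = P n.
  rewrite /P linear_sum big_ord_recl /= derivZ expr0 derivC scaler0 add0r.
  apply: eq_bigr => i _; rewrite derivZ derivXn /= /bump leq0n add1n /= -scalerMnr.
  rewrite add0n scalerMnl.
  rewrite -mulr_natr; congr (_ *: _); rewrite factS natrM invfM mulrAC mulVf ?mul1r//.
exists (P N), (expR 1) => [|x x1]; first exact: expR_ge0.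
elim: N x x1 => [|N ih] x x1.
  rewrite /P big_ord0 horner0 subr0 expr0 mulr1 ger0_norm ?expR_ge0// ler_expR.
  by rewrite (le_trans (ler_norm _)).
have h (z : R) : is_derive z 1 (fun z => expR z - (P N.+1).[z]) (expR z - (P N).[z]).
  by have hp := is_derive_poly (P N.+1) z; rewrite dP in hp; apply: is_deriveB.
have [c cx] := mean_value0 h x.
rewrite expR0 P0 subrr subr0 => ->; rewrite normrM exprSr mulrA ler_wpM2r//.
apply: (le_trans (ih c _)); first exact: le_trans cx x1.
by rewrite ler_wpM2l ?expR_ge0// lerXn2r ?nnegrE.
Qed.

Lemma poly_approx_exp N c : poly_approx N (fun x => expR (c * x)).
Proof.
apply: (@poly_approx_scale N expR c).
have [p [C C0 hC]] := exp_taylor N.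
by exists p, C, 1; split => //; rewrite ltr01 lexx.
Qed.

(** With [u = 1 - cosh x], the finite geometric sum gives [1 / cosh x = sum_(k < N) u^k + u^N / cosh
    x], where [|u| <= e |x|] for [|x| <= 1] and [cosh x >= 1]. *)
Lemma poly_approx_cosh_inv N : poly_approx N (fun x => ((expR x + expR (- x)) / 2)^-1).
Proof.
pose c x : R := (expR x + expR (- x)) / 2; pose u x : R := 1 - c x.
have e N' : poly_approx N' (fun x => expR x).
  by have := poly_approx_exp N' 1; under eq_fun do rewrite mul1r.
have e' N' : poly_approx N' (fun x => expR (- x)).
  by have := poly_approx_exp N' (-1); under eq_fun do rewrite mulN1r.
have hc N' : poly_approx N' c.
  apply: poly_approxM; last exact: poly_approx_cst.
  exact: poly_approxD.
have hu : poly_approx N u.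
  rewrite (_ : u = fun x => 1 + (-1) * c x); last by apply/funext => x; rewrite mulN1r.
  by apply: poly_approxD; [|apply: poly_approxM => //]; exact: poly_approx_cst.
have c1 x : 1 <= c x.
  have h1 : 1 + x <= expR x by exact: expR_ge1Dx.
  have h2 : 1 - x <= expR (- x) by exact: expR_ge1Dx.
  rewrite /c; lra.
have [p [C [d [C0 /andP[d0 d1] hp]]]] : poly_approx N (fun x => \sum_(k < N) u x ^+ k).
  by apply: poly_approx_sum => k; exact: poly_approxX.
exists p, (C + expR 1 ^+ N), d; split; [by rewrite addr_ge0// exprn_ge0 ?expR_ge0|by rewrite d0|].
move=> x xd; have x1 := le_trans xd d1.
have cx0 : c x != 0 by rewrite lt0r_neq0// (lt_le_trans ltr01).
have ->: ((expR x + expR (- x)) / 2)^-1 = \sum_(k < N) u x ^+ k + u x ^+ N / c x.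
  rewrite -/(c x); apply: (mulfI cx0); rewrite mulrDr divff// mulrCA divff// mulr1.
  have := subrX1 (u x) N; rewrite {2}/u => h.
  have -> : c x * \sum_(k < N) u x ^+ k = 1 - u x ^+ N.
    by rewrite -opprB h; ring.
  by rewrite subrK.
rewrite addrAC (le_trans (ler_normD _ _))// mulrDl lerD ?hp//.
rewrite normrM normfV -exprMn normrX -[leRHS]mulr1; apply: ler_pM => //.
- rewrite lerXn2r ?nnegrE ?mulr_ge0 ?expR_ge0// mulrC.
  have h1 := norm_expR_sub1 x; have h2 := norm_expR_sub1 (- x); rewrite normrN in h2.
  have h3 : expR `|x| <= expR 1 by rewrite ler_expR.
  have h4 : `|x| * expR `|x| <= `|x| * expR 1 by rewrite ler_wpM2l.
  rewrite (_ : u x = - ((expR x - 1) + (expR (- x) - 1)) / 2); last by rewrite /u /c; field.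
  rewrite normrM normrN normfV [ `|2|]ger0_norm// ler_pdivrMr//.
  rewrite (le_trans (ler_normD _ _))//; lra.
- by rewrite invf_le1 ?(ger0_norm (le_trans ler01 (c1 x)))// (lt_le_trans ltr01).
Qed.

Definition sinhc (x : R) := if x == 0 then 1 else (expR x - expR (- x)) / 2 / x.

Lemma sinhc_sub1 (x : R) : `|x| <= 1 -> `|sinhc x - 1| <= expR 1 * `|x|.
Proof.
move=> x1; rewrite /sinhc; case: eqP => [->|/eqP x0].
  by rewrite subrr normr0 mulr0.
have -> : (expR x - expR (- x)) / 2 / x - 1 = ((expR x - 1 - x) - (expR (- x) - 1 + x)) / 2 / x.
  by field.
have h1 := norm_expR_sub1_subx x; have h2 := norm_expR_sub1_subx (- x).
rewrite normrN sqrrN opprK in h2.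
have h3 : expR `|x| <= expR 1 by rewrite ler_expR.
have h4 : x ^+ 2 * expR `|x| <= x ^+ 2 * expR 1 by rewrite ler_wpM2l ?sqr_ge0.
have nx : 0 < `|x| by rewrite normr_gt0.
rewrite normrM normfV ler_pdivrMr// normrM normfV [ `|2|]ger0_norm// ler_pdivrMr//.
have -> : expR 1 * `|x| * `|x| * 2 = 2 * (x ^+ 2 * expR 1).
  by rewrite -[x ^+ 2]real_normK ?num_real//; ring.
rewrite (le_trans (ler_normB _ _))//; lra.
Qed.

(** An expansion [p] of [sinh] is divisible by [x], and its quotient [q] approximates [sinhc] off
    [0]; at [0] itself it remains to see that [q] takes the conventional value [1]. *)
Lemma poly_approx_sinhc N : poly_approx N sinhc.
Proof.
pose S (x : R) := (expR x - expR (- x)) / 2.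
(* Division by [x] costs one order. The other spare order makes the error tend to [0] with [x] even
   when [N = 0], which determines [q.[0]]. *)
have [p [C [d [C0 /andP[d0 d1] hp]]]] : poly_approx N.+2 S.
  apply: poly_approxM; last exact: poly_approx_cst.
  rewrite (_ : (fun _ => _) = fun x => expR (1 * x) + (-1) * expR (-1 * x)).
    by apply: poly_approxD; [|apply: poly_approxM; first exact: poly_approx_cst]; exact: poly_approx_exp.
  by apply/funext => x; rewrite mul1r !mulN1r.
have p0 : root p 0.
  have := hp 0; rewrite normr0 => /(_ (ltW d0)); rewrite expr0n mulr0 normr_le0 subr_eq0.
  by rewrite /S oppr0 subrr mul0r eq_sym.
have /factor_theorem[q pq] := p0.
have pE x : p.[x] = q.[x] * x by rewrite pq hornerM hornerXsubC subr0.
have h1 x : x != 0 -> `|x| <= d -> `|sinhc x - q.[x]| <= C * `|x| ^+ N.+1.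
  move=> x0 xd; rewrite /sinhc (negPf x0).
  have nx : 0 < `|x| by rewrite normr_gt0.
  rewrite -(ler_pM2r nx) -normrM -[leRHS]mulrA -exprSr mulrBl mulfVK// -pE; exact: hp.
have [q' qq'] : exists q', q = q' * ('X - 0%:P) + (q.[0])%:P.
  have /factor_theorem[q' e] : root (q - (q.[0])%:P) 0 by rewrite rootE hornerD hornerN hornerC subrr.
  by exists q'; rewrite -e subrK.
have [B B0 hB] := horner_bounded q'.
(* For small [x], [1] is close to [sinhc x], which is close to [q.[x]], which is close to [q.[0]],
   each time within a multiple of [x]. *)
have q1 : q.[0] = 1.
  apply/eqP; rewrite -subr_eq0 -normr_le0; apply/ler_addgt0Pl => e e0; rewrite addr0.
  pose K := expR 1 + C + B.
  have K0 : 0 < K by rewrite /K -addrA ltr_pwDl ?expR_gt0// addr_ge0.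
  pose x := Num.min d (e / K).
  have x0 : 0 < x by rewrite lt_min d0 divr_gt0.
  have xd : `|x| <= d by rewrite gtr0_norm// ge_min lexx.
  have xe : x * K <= e by rewrite -ler_pdivlMr// ge_min lexx orbT.
  have x1 := le_trans xd d1.
  have a1 := sinhc_sub1 x1.
  have a2 := h1 x (lt0r_neq0 x0) xd.
  have a3 : `|q.[x] - q.[0]| <= B * `|x|.
    rewrite {1}qq' hornerD hornerC addrK hornerM hornerXsubC subr0 normrM.
    by rewrite ler_wpM2r// hB.
  have a4 : C * `|x| ^+ N.+1 <= C * `|x|.
    by rewrite ler_wpM2l// exprS ler_piMr// exprn_ile1.
  rewrite [ `|x|]gtr0_norm// in a1 a2 a3 a4.
  have -> : q.[0] - 1 = (sinhc x - 1) - (sinhc x - q.[x]) - (q.[x] - q.[0]) by ring.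
  rewrite (le_trans (ler_normB _ _))// (le_trans _ xe)// /K.
  have := ler_normB (sinhc x - 1) (sinhc x - q.[x]); lra.
exists q, C, d; split => //; first by rewrite d0.
move=> x xd; have [->|x0] := eqVneq x 0.
  by rewrite /sinhc eqxx q1 subrr normr0 mulr_ge0// exprn_ge0.
apply: (le_trans (h1 _ x0 xd)); rewrite ler_wpM2l// exprS ler_piMl// ?exprn_ge0//.
exact: le_trans xd d1.
Qed.

Lemma poly_approx_tanhc N : poly_approx N (@tanhc R).
Proof.
rewrite (_ : @tanhc R = fun x => sinhc x * ((expR x + expR (- x)) / 2)^-1).
  by apply: poly_approxM; [exact: poly_approx_sinhc|exact: poly_approx_cosh_inv].
apply/funext => x; rewrite /tanhc /sinhc; case: eqP => [->|/eqP x0].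
  by rewrite oppr0 expR0 mul1r divff// invr1.
by rewrite /tanh; field; rewrite ?x0 ?lt0r_neq0 ?addr_gt0 ?expR_gt0.
Qed.

(** Terms of degree at least [N] belong to the error; removing them leaves a polynomial that enough
    differences annihilate. *)
Lemma poly_approx_small N f : poly_approx N f -> exists p, exists C delta : R,
  [/\ (size p <= N)%N, 0 <= C, 0 < delta &
      forall x, `|x| <= delta -> `|f x - p.[x]| <= C * `|x| ^+ N].
Proof.
move=> [p [C [d [C0 /andP[d0 d1] hp]]]].
have [B B0 hB] := horner_bounded (drop_poly N p).
exists (take_poly N p), (C + B), d; split => //; first exact: size_take_poly.
  exact: addr_ge0.
move=> x xd; have := hp x xd.
rewrite -{1}(poly_take_drop N p) hornerD hornerM hornerXn => h.
rewrite (_ : _ - _ = (f x - ((take_poly N p).[x] + (drop_poly N p).[x] * x ^+ N)) + (drop_poly N p).[x] * x ^+ N); last by ring.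
rewrite (le_trans (ler_normD _ _))// mulrDl lerD// normrM normrX ler_wpM2r ?exprn_ge0//.
by apply: hB; exact: le_trans xd d1.
Qed.

End polynomial_approximation.

(** * Symmetric second differences *)

Section second_difference.
Context {R : realType}.
Implicit Types (f g : R -> R) (p : {poly R}) (h : R).

(** The sign is the one for which [x |-> cos (x a)] is an eigenfunction with the nonnegative
    eigenvalue [2 - 2 cos (h a)]. *)
Definition second_diff h f (x : R) : R := 2 * f x - f (x + h) - f (x - h).

Definition poly_shift_diff h p : {poly R} := p \Po ('X + h%:P) - p.

Lemma horner_poly_shift_diff h p x : (poly_shift_diff h p).[x] = p.[x + h] - p.[x].
Proof. by rewrite hornerD hornerN horner_comp hornerD hornerX hornerC. Qed.

Lemma size_poly_shift_diff h p n : (size p <= n.+1)%N -> (size (poly_shift_diff h p) <= n)%N.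
Proof.
move=> pn; have s2 : size ('X + h%:P) = 2%N by rewrite size_XaddC.
have sc : size (p \Po ('X + h%:P)) = size p by rewrite size_comp_poly2.
apply/leq_sizeP => j; rewrite leq_eqVlt => /predU1P[<-|nj]; last first.
  by rewrite coefB !nth_default ?subrr// ?sc (leq_trans pn).
rewrite coefB; have [sp|sp] := leqP (size p) n.
  by rewrite !nth_default ?subrr// sc.
have e : size p = n.+1 by apply/eqP; rewrite eqn_leq pn.
have := @lead_coef_comp R p ('X + h%:P); rewrite s2 => /(_ isT).
rewrite lead_coefXaddC expr1n mulr1 !lead_coefE sc e /= => ->.
by rewrite subrr.
Qed.

(** A symmetric difference is the composite of the differences with steps [h] and [-h], each of
    which lowers the degree by one. *)
Lemma iter_second_diff_poly h k p : (size p <= k.*2)%N ->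
  iter k (second_diff h) (horner p) = fun=> 0.
Proof.
elim: k p => [|k ih] p.
  by rewrite leqn0 size_poly_eq0 => /eqP -> /=; apply/funext => x; rewrite horner0.
rewrite doubleS iterSr => sp.
rewrite (_ : second_diff h (horner p) = horner (poly_shift_diff h (poly_shift_diff (- h) p))).
  by apply: ih; apply: size_poly_shift_diff; exact: size_poly_shift_diff.
by apply/funext => x; rewrite !horner_poly_shift_diff /second_diff addrK; ring.
Qed.

Lemma iter_second_diffD h k f g :
  iter k (second_diff h) (fun x => f x + g x) =
  fun x => iter k (second_diff h) f x + iter k (second_diff h) g x.
Proof.
elim: k f g => [//|k ih] f g; rewrite !iterSr -ih; congr iter.
by apply/funext => x; rewrite /second_diff; ring.
Qed.

(** Each application moves the argument by at most [|h|], and its coefficients [2, -1, -1] have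
    absolute sum [4]. *)
Lemma iter_second_diff_le h k g (M r : R) x :
  (forall y, `|y| <= r -> `|g y| <= M) -> `|x| + k%:R * `|h| <= r ->
  `|iter k (second_diff h) g x| <= 4 ^+ k * M.
Proof.
move=> hg; elim: k x => [|k ih] x xr.
  by rewrite expr0 mul1r; apply: hg; rewrite mul0r addr0 in xr.
rewrite iterS /second_diff; set D := iter _ _ _.
rewrite -natr1 mulrDl mul1r in xr.
have h0 := normr_ge0 h; have t1 := ler_normD x h; have t2 := ler_normB x h.
have b0 : `|D x| <= 4 ^+ k * M by apply: ih; lra.
have b1 : `|D (x + h)| <= 4 ^+ k * M by apply: ih; lra.
have b2 : `|D (x - h)| <= 4 ^+ k * M by apply: ih; lra.
rewrite exprS; move: b0 b1 b2; rewrite !ler_norml => /andP[? ?] /andP[? ?] /andP[? ?].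
apply/andP; split; lra.
Qed.

Lemma second_diff_order k f : poly_approx k.*2 f -> exists C delta : R,
  [/\ 0 <= C, 0 < delta & forall h, `|h| <= delta ->
    `|iter k (second_diff h) f 0| <= C * `|h| ^+ k.*2].
Proof.
move=> /poly_approx_small[p [C [d [sp C0 d0 hp]]]].
exists (4 ^+ k * (C * k%:R ^+ k.*2)), (d / k.+1%:R); split.
- by rewrite !mulr_ge0 ?exprn_ge0.
- by rewrite divr_gt0.
move=> h; rewrite ler_pdivlMr// => hd.
have kh : k%:R * `|h| <= d.
  by rewrite (le_trans _ hd)// mulrC ler_wpM2l// ler_nat.
rewrite (_ : f = fun x => p.[x] + (f x - p.[x])); last by apply/funext => x; ring.
rewrite iter_second_diffD iter_second_diff_poly// add0r -!mulrA -exprMn.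
apply: (@iter_second_diff_le _ _ _ _ (k%:R * `|h|)).
  move=> y yr; apply: (le_trans (hp _ (le_trans yr kh))).
  by rewrite ler_wpM2l// lerXn2r ?nnegrE ?mulr_ge0.
by rewrite normr0 add0r.
Qed.

Lemma iter_second_diff_cos h k (a x : R) :
  iter k (second_diff h) (fun x => cos (x * a)) x = cos (x * a) * (2 - 2 * cos (h * a)) ^+ k.
Proof.
elim: k x => [|k ih] x; first by rewrite expr0 mulr1.
rewrite iterS /second_diff !ih exprS.
have -> : (x + h) * a = x * a + h * a by ring.
have -> : (x - h) * a = x * a - h * a by ring.
by rewrite cosD cosB; ring.
Qed.

(** Here [2 - 2 cos y = (2 sin (y / 2))^2], and the mean value theorem gives
    [sin (y / 2) = cos c * (y / 2)] with [|c| <= 1], hence [cos c >= cos 1]. *)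
Lemma one_sub_cos_ge (y : R) : `|y| <= 1 -> cos 1 ^+ 2 * y ^+ 2 <= 2 - 2 * cos y.
Proof.
move=> y1; have c1 := cos1_gt0 R.
have [c cy] := mean_value0 (fun x => is_derive_sin x) (y / 2).
rewrite sin0 subr0 => e.
have -> : 2 - 2 * cos y = (2 * sin (y / 2)) ^+ 2.
  have -> : cos y = cos ((y / 2) *+ 2) by congr cos; rewrite -mulr_natr; field.
  by rewrite cos_mulr2n cos2sin2; ring.
have hc : cos 1 <= cos c.
  have cc : `|c| <= 1.
    rewrite (le_trans cy)// normrM normfV [ `|2|]ger0_norm//; lra.
  have pi1 : 1 <= pi :> R by rewrite (le_trans _ (pi_ge2 R))//; lra.
  rewrite -(cos_norm c) leNgt ltr_cos -?leNgt// in_itv/= ?ler01 ?normr_ge0//=.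
  exact: le_trans cc pi1.
rewrite e (_ : 2 * (cos c * (y / 2)) = cos c * y); last by field.
rewrite exprMn ler_wpM2r ?sqr_ge0// lerXn2r ?nnegrE ?(ltW c1)//.
exact: le_trans (ltW c1) hc.
Qed.

End second_difference.

(** * Existence of even moments *)

Section moments.
Context (d : measure_display) (T : measurableType d) (R : realType).
Variables (P : probability T R) (W : {RV P >-> R}) (phi : R -> R).
Hypothesis phiE : forall x, \int[P]_w cos (x * W w) = phi x.

Lemma measurable_RV : measurable_fun setT W.
Proof. exact: measurable_funPT. Qed.

Lemma bounded_measurable_cosRV x : bounded_measurable (fun w => cos (x * W w)).
Proof.
split; last by exists 1 => w; exact: cos_max.
apply: (@measurableT_comp _ _ _ _ _ _ (@cos R)).
  by apply: continuous_measurable_fun; exact: continuous_cos.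
exact: measurable_funM measurable_RV.
Qed.

Lemma bounded_measurable_second_diff h k (f : R -> T -> R) x :
  (forall x, bounded_measurable (f x)) ->
  bounded_measurable (fun w => iter k (second_diff h) (f^~ w) x).
Proof.
move=> bf; elim: k x => [//|k ih] x.
under eq_fun do rewrite iterS /second_diff.
have bN g : bounded_measurable g -> @bounded_measurable _ T R (fun w => - g w).
  move=> bg; under eq_fun do rewrite -mulN1r.
  by apply: bounded_measurableM => //; exact: bounded_measurable_cst.
apply: bounded_measurableD; last exact: bN.
apply: bounded_measurableD; last exact: bN.
by apply: bounded_measurableM => //; exact: bounded_measurable_cst.
Qed.

Lemma Rintegral_second_diff h k (f : R -> T -> R) x : (forall x, bounded_measurable (f x)) ->
  \int[P]_w iter k (second_diff h) (f^~ w) x =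
  iter k (second_diff h) (fun x => \int[P]_w f x w) x.
Proof.
move=> bf; elim: k x => [//|k ih] x.
pose D := iter k (second_diff h) (fun x => \int[P]_w f x w).
have -> : iter k.+1 (second_diff h) (fun x => \int[P]_w f x w) x = 2 * D x - D (x + h) - D (x - h) by [].
rewrite /D -!ih.
have b0 y : bounded_measurable (fun w => iter k (second_diff h) (f^~ w) y).
  exact: bounded_measurable_second_diff.
have i0 y : P.-integrable setT (EFin \o (fun w => iter k (second_diff h) (f^~ w) y)).
  exact: bounded_measurable_integrable.
have i2 : P.-integrable setT (EFin \o (fun w => 2 * iter k (second_diff h) (f^~ w) x)).
  exact: (integrableZl measurableT 2 (i0 x)).
rewrite -RintegralZl// -RintegralB// -RintegralB//.
exact: (integrableB measurableT i2 (i0 (x + h))).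
Qed.

(* The [2k]-th symmetric difference of [cos (x w)] at [x = 0] is
   [(2 - 2 cos (h w))^k], which dominates a multiple of [(h w)^2k] on [|h w| <= 1];
   take expectations with [h = 1 / n]. *)
Lemma truncated_moment_bound k : poly_approx k.*2 phi ->
  exists2 M : R, 0 <= M & forall n : nat,
    \int[P]_w (W w ^+ k.*2 * (`|W w| <= n%:R)%R%:R) <= M.
Proof.
move=> /second_diff_order[C [dl [C0 d0 hC]]].
have c1 := cos1_gt0 R; set c := cos (1 : R) ^+ 2.
have c0 : 0 < c by exact: exprn_gt0.
pose M := C / c ^+ k.
have M0 : 0 <= M by rewrite divr_ge0// exprn_ge0// ltW.
have mW := measurable_RV.
have bt n : bounded_measurable (fun w => W w ^+ k.*2 * (`|W w| <= n%:R)%R%:R).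
  split.
    apply: measurable_funM; first exact: measurable_funX.
    have -> : (fun w => (`|W w| <= n%:R)%R%:R) = \1_((fun w => `|W w|) @^-1` `]-oo, (n%:R : R)]) :> (T -> R).
      apply/funext => w; rewrite indicE; congr (_%:R); congr nat_of_bool.
      by apply/idP/idP; rewrite inE /= in_itv.
    apply: measurable_indic; rewrite -[X in measurable X]setTI.
    by apply: (measurableT_comp (@normr_measurable R setT) mW) => //.
  exists (n%:R ^+ k.*2) => w; case: (leP `|W w| n%:R) => h /=; last by rewrite mulr0 normr0 exprn_ge0.
  by rewrite mulr1 normrX lerXn2r ?nnegrE.
have mono (n m : nat) : (n <= m)%N ->
    \int[P]_w (W w ^+ k.*2 * (`|W w| <= n%:R)%R%:R) <= \int[P]_w (W w ^+ k.*2 * (`|W w| <= m%:R)%R%:R).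
  move=> nm; apply: le_Rintegral => //; try exact: bounded_measurable_integrable.
  move=> w _; rewrite ler_wpM2l ?exprn_even_ge0 ?odd_double//.
  case: (leP `|W w| n%:R) => h /=; last by case: (_ <= m%:R).
  by rewrite (le_trans h) ?ler_nat.
exists M => // n.
(* Truncated moments increase with the level, so the level may be raised until the step [1 / m] lies
   within the range [dl] of the difference bound. *)
pose m := maxn n (Num.bound dl^-1).+1.
apply: (le_trans (mono _ m _)); first exact: leq_maxl.
have m0 : 0 < m%:R :> R by rewrite ltr0n (leq_trans _ (leq_maxr _ _)).
have md : m%:R^-1 <= dl.
  rewrite invf_ple ?posrE//; apply: (@le_trans _ _ (Num.bound dl^-1).+1%:R); last by rewrite ler_nat leq_maxr.
  by rewrite -natr1 ler_wpDr// ltW// archi_boundP// invr_ge0 ltW.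
have := hC m%:R^-1; rewrite ger0_norm ?invr_ge0// => /(_ md).
rewrite -(funext phiE) -Rintegral_second_diff; last exact: bounded_measurable_cosRV.
under eq_Rintegral do rewrite iter_second_diff_cos mul0r cos0 mul1r.
move=> hle.
have bs : bounded_measurable (fun w => (2 - 2 * cos (m%:R^-1 * W w)) ^+ k).
  have := @bounded_measurable_second_diff m%:R^-1 k (fun x w => cos (x * W w)) 0 bounded_measurable_cosRV.
  by under eq_fun do rewrite iter_second_diff_cos mul0r cos0 mul1r.
have key : c ^+ k * m%:R ^- k.*2 * \int[P]_w (W w ^+ k.*2 * (`|W w| <= m%:R)%R%:R) <=
    \int[P]_w (2 - 2 * cos (m%:R^-1 * W w)) ^+ k.
  rewrite -RintegralZl//; last exact: bounded_measurable_integrable.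
  apply: le_Rintegral => //.
  - apply: bounded_measurable_integrable; apply: bounded_measurableM => //; exact: bounded_measurable_cst.
  - exact: bounded_measurable_integrable.
  move=> w _; have sc : 0 <= 2 - 2 * cos (m%:R^-1 * W w) by have := cos_le1 (m%:R^-1 * W w); lra.
  case: (leP `|W w| m%:R) => h /=; last by rewrite !mulr0 exprn_ge0.
  rewrite mulr1 -exprVn -mulrA -exprMn -muln2 mulnC exprM -exprMn lerXn2r ?nnegrE//; first exact: mulr_ge0 (ltW c0) (sqr_ge0 _).
  by apply: one_sub_cos_ge; rewrite normrM normfV [ `|m%:R|]ger0_norm// mulrC ler_pdivrMr// mul1r.
have {}key := le_trans key (le_trans (ler_norm _) hle).
have mk : 0 < m%:R ^- k.*2 :> R by rewrite invr_gt0 exprn_gt0.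
rewrite exprVn in key.
rewrite /M ler_pdivlMr ?exprn_gt0// -(ler_pM2r mk) (le_trans _ key)//.
by rewrite le_eqVlt; apply/orP; left; apply/eqP; ring.
Qed.

(** The bound on truncated moments is uniform in the level, and monotone convergence removes the
    truncation. *)
Lemma moment_integrable k : poly_approx k.*2 phi ->
  P.-integrable setT (fun w => (W w ^+ k.*2)%:E).
Proof.
move=> /truncated_moment_bound[M M0 hM]; have mW := measurable_RV.
pose g (n : nat) w := (W w ^+ k.*2 * (`|W w| <= n%:R)%R%:R)%:E.
have W0 w : 0 <= W w ^+ k.*2 by rewrite exprn_even_ge0 ?odd_double.
have mb n : measurable_fun setT (fun w => W w ^+ k.*2 * (`|W w| <= n%:R)%R%:R).
  apply: measurable_funM; first exact: measurable_funX.
  have -> : (fun w => (`|W w| <= n%:R)%R%:R) = \1_((fun w => `|W w|) @^-1` `]-oo, (n%:R : R)]) :> (T -> R).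
    apply/funext => w; rewrite indicE; congr (_%:R); congr nat_of_bool.
    by apply/idP/idP; rewrite inE /= in_itv.
  apply: measurable_indic; rewrite -[X in measurable X]setTI.
  by apply: (measurableT_comp (@normr_measurable R setT) mW) => //.
have gb n : (\int[P]_w g n w <= M%:E)%E.
  have i : P.-integrable setT (g n).
    apply: bounded_measurable_integrable; split=> //; exists (n%:R ^+ k.*2) => w; case: (leP `|W w| n%:R) => h /=; last by rewrite mulr0 normr0 exprn_ge0.
    by rewrite mulr1 normrX lerXn2r ?nnegrE.
  by rewrite -(fineK (integrable_fin_num measurableT i)) lee_fin; exact: hM.
apply/integrableP; split; first by apply/measurable_EFinP; exact: measurable_funX.
under eq_integral do rewrite gee0_abs ?lee_fin//.
apply: (@le_lt_trans _ _ M%:E); last exact: ltry.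
(* For fixed [w] the truncations are constant once the level exceeds [|W w|]. *)
have lg w : (W w ^+ k.*2)%:E = limn (g^~ w).
  apply/esym/cvg_lim => //; apply: cvg_near_cst.
  exists (Num.bound `|W w|) => // n /= hn.
  rewrite /g (_ : (_ <= _)%R) ?mulr1//.
  by rewrite (le_trans (ltW (archi_boundP (normr_ge0 (W w)))))// ler_nat.
under eq_integral do rewrite lg.
have := @cvg_monotone_convergence _ _ _ P setT measurableT g.
move=> H; have {}H : (\int[P]_w g n w)%E @[n --> \oo] --> (\int[P]_w limn (g^~ w))%E.
  apply: H.
  - by move=> n; exact/measurable_EFinP.
  - by move=> n w _; rewrite lee_fin mulr_ge0.
  - move=> w _ n m nm; rewrite lee_fin ler_wpM2l//.
    case: (leP `|W w| n%:R) => h /=; last by case: (_ <= m%:R).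
    by rewrite (le_trans h) ?ler_nat.
rewrite -(cvg_lim _ H)//; apply: lime_le; first by apply/cvg_ex; eexists; exact: H.
by apply: nearW => n; exact: gb.
Qed.

End moments.

(** * Negative binomial series in several variables *)

Section negative_binomial_series.
Context {R : realType}.
Implicit Types (x y : R) (k n N : nat).

Lemma gbinom_opp k n : gbinom R (- (k.+1)%:Z) n = (-1) ^+ n * 'C(k + n, n)%:R.
Proof.
elim: n => [|n ih].
  by rewrite /gbinom big_ord0 fact0 invr1 mulr1 expr0 bin0 mulr1.
have f0 m : m`!%:R != 0 :> R by rewrite pnatr_eq0 -lt0n fact_gt0.
have n0 : n.+1%:R != 0 :> R by rewrite pnatr_eq0.
have -> : gbinom R (- (k.+1)%:Z) n.+1 = gbinom R (- (k.+1)%:Z) n * ((- (k.+1)%:Z)%:~R - n%:R) / n.+1%:R.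
  rewrite /gbinom big_ord_recr /= factS natrM; field.
  by rewrite f0 nat1r n0.
rewrite ih.
have := mul_bin_diag (k + n).+1 n; rewrite /= => /(congr1 (fun m => m%:R : R)).
rewrite !natrM -addnS => h.
have -> : 'C(k + n.+1, n.+1)%:R = (k + n.+1)%:R * 'C(k + n, n)%:R / n.+1%:R :> R.
  by rewrite h mulrC mulKf.
rewrite exprS mulrNz -pmulrn !natrD -!(natr1 n) -!(natr1 k); field.
by rewrite natr1.
Qed.

Definition negbin_sum k y N : R := \sum_(n < N) 'C(k + n, n)%:R * y ^+ n.

(** Pascal's rule telescopes: multiplication by [1 - y] lowers [k] by one at the price of one
    boundary term. Bounds and limits then follow by induction on [k] from the geometric series. *)
Lemma negbin_sum_rec k y N :
  (1 - y) * negbin_sum k.+1 y N.+1 = negbin_sum k y N.+1 - 'C(k.+1 + N, N)%:R * y ^+ N.+1.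
Proof.
elim: N => [|N ih].
  by rewrite /negbin_sum !big_ord1 !bin0 expr0 expr1; ring.
rewrite /negbin_sum big_ord_recr [in RHS]big_ord_recr /= mulrDr -!/(negbin_sum _ _ _) ih.
have -> : 'C(k.+1 + N.+1, N.+1) = ('C(k + N.+1, N.+1) + 'C(k.+1 + N, N))%N.
  by rewrite addSn binS addnS addSn.
by rewrite natrD !exprS; ring.
Qed.

Lemma negbin_sum_ge0 k y N : 0 <= y -> 0 <= negbin_sum k y N.
Proof. by move=> y0; apply: sumr_ge0 => n _; rewrite mulr_ge0// exprn_ge0. Qed.

Lemma negbin_sum_le k y N : 0 <= y < 1 -> negbin_sum k y N <= ((1 - y) ^- k.+1).
Proof.
move=> /andP[y0 y1]; have y10 : 0 < 1 - y by rewrite subr_gt0.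
case: N => [|N]; first by rewrite /negbin_sum big_ord0 invr_ge0 exprn_ge0// ltW.
elim: k => [|k ih].
  rewrite expr1 -div1r ler_pdivlMr// mulrC.
  have -> : negbin_sum 0 y N.+1 = \sum_(i < N.+1) y ^+ i.
    by apply: eq_bigr => i _; rewrite add0n binn mul1r.
  have := subrX1 y N.+1 => h.
  have -> : (1 - y) * \sum_(i < N.+1) y ^+ i = 1 - y ^+ N.+1.
    by rewrite -(opprB y 1) mulNr -h opprB.
  by rewrite gerBl exprn_ge0.
rewrite exprSr invfM -(ler_pM2l y10) negbin_sum_rec mulrA [_ / _ * _]mulrC.
apply: (@le_trans _ _ (negbin_sum k y N.+1)).
  by rewrite gerBl mulr_ge0// exprn_ge0.
by rewrite mulrCA mulrA divff ?lt0r_neq0// mul1r.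
Qed.

(** At a point [z] strictly between [|y|] and [1] the terms are bounded by the full sum
    [(1 - z)^-(k+1)], so at [y] they decay like [(|y| / z)^N]. *)
Lemma cvg_negbin_sum_remainder k y : `|y| < 1 -> ('C(k + N, N)%:R * y ^+ N) @[N --> \oo] --> (0 : R).
Proof.
move=> y1; pose z := (1 + `|y|) / 2.
have z0 : 0 < z by rewrite divr_gt0// ltr_pwDl.
have z1 : z < 1 by rewrite ltr_pdivrMr// mul1r; lra.
have yz : `|y| / z < 1 by rewrite ltr_pdivrMr// mul1r ltr_pdivlMr//; lra.
pose K := (1 - z) ^- k.+1.
apply: norm_cvg0.
apply: (@squeeze_cvgr _ _ _ _ (fun=> 0) (fun N => K * (`|y| / z) ^+ N)).
- apply: nearW => N; rewrite normr_ge0/= normrM normrX ger0_norm// expr_div_n.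
  have h : 'C(k + N, N)%:R * z ^+ N <= K.
    apply: le_trans (negbin_sum_le k N.+1 _); last by rewrite (ltW z0).
    by rewrite /negbin_sum big_ord_recr /= lerDr negbin_sum_ge0// ltW.
  by rewrite mulrA ler_pdivlMr ?exprn_gt0// mulrAC ler_wpM2r ?exprn_ge0.
- exact: cvg_cst.
- have : K * (`|y| / z) ^+ N @[N --> \oo] --> K * 0.
    apply: cvgM; first exact: cvg_cst.
    by apply: cvg_expr; rewrite ger0_norm ?divr_ge0 ?(ltW z0).
  by rewrite mulr0.
Qed.

Lemma cvg_negbin_sum k y : `|y| < 1 -> negbin_sum k y N @[N --> \oo] --> (1 - y) ^- k.+1.
Proof.
move=> y1; have y10 : 1 - y != 0.
  by rewrite lt0r_neq0// subr_gt0 (le_lt_trans (ler_norm _)).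
rewrite -(@cvg_shiftS _ (negbin_sum k y)).
elim: k => [|k ih].
  rewrite (_ : (fun N => negbin_sum 0 y N.+1) = (fun N => (1 - y)^-1 * (1 - y * y ^+ N))).
    have : (1 - y)^-1 * (1 - y * y ^+ N) @[N --> \oo] --> (1 - y)^-1 * (1 - y * 0).
      by apply: cvgM; [exact: cvg_cst|apply: cvgB; [exact: cvg_cst|apply: cvgM; [exact: cvg_cst|exact: cvg_expr]]].
    by rewrite expr1 mulr0 subr0 mulr1.
  apply/funext => N; apply: (mulfI y10); rewrite mulrA divff// mul1r.
  have -> : negbin_sum 0 y N.+1 = \sum_(i < N.+1) y ^+ i.
    by apply: eq_bigr => i _; rewrite add0n binn mul1r.
  rewrite -exprS; have := subrX1 y N.+1 => h; by rewrite -(opprB y 1) mulNr -h opprB.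
rewrite (_ : (fun N => negbin_sum k.+1 y N.+1) = (fun N => (1 - y)^-1 * (negbin_sum k y N.+1 - y * ('C(k.+1 + N, N)%:R * y ^+ N)))).
  have : (1 - y)^-1 * (negbin_sum k y N.+1 - y * ('C(k.+1 + N, N)%:R * y ^+ N)) @[N --> \oo] --> (1 - y)^-1 * ((1 - y) ^- k.+1 - y * 0).
    apply: cvgM; first exact: cvg_cst.
    apply: cvgB; first exact: ih.
    apply: cvgM; first exact: cvg_cst.
    exact: cvg_negbin_sum_remainder.
  by rewrite mulr0 subr0 [in X in _ -> X]exprS invfM.
apply/funext => N; apply: (mulfI y10); rewrite negbin_sum_rec [RHS]mulrA divff// mul1r exprS; ring.
Qed.

End negative_binomial_series.

(** * Summation over finite sets of multi-indices *)

Section box_sums.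
Context {R : realType} (r : nat).
Implicit Types (F : 'I_r -> nat -> R) (J : {fset {ffun 'I_r -> nat}}) (N : nat).

(** The cubes [{0, ..., N-1}^r] are cofinal among finite index sets, and on them a sum of products
    factors. *)
Definition box N : {fset {ffun 'I_r -> nat}} :=
  [fset [ffun j => nat_of_ord ((g : {ffun 'I_r -> 'I_N}) j)] | g in {ffun 'I_r -> 'I_N}]%fset.

Lemma box_sum F N :
  \sum_(n <- box N) \prod_j F j (n j) = \prod_j \sum_(k < N) F j k.
Proof.
rewrite bigA_distr_bigA /box big_imfset /=; last first.
  move=> g g' _ _ /ffunP h; apply/ffunP => j; apply: val_inj.
  by have := h j; rewrite !ffunE.
rewrite big_enum_cond /=; apply: eq_bigr => g _; apply: eq_bigr => j _; by rewrite ffunE.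
Qed.

Lemma box_sub J : exists N0, forall N, (N0 <= N)%N -> (J `<=` box N)%fset.
Proof.
(* This crude sum bounds every coordinate of every element of [J]. *)
exists (\sum_(n <- J) \sum_j n j).+1 => N hN; apply/fsubsetP => n nJ.
have nN j : (n j < N)%N.
  apply: leq_trans hN; rewrite ltnS.
  rewrite (big_fsetD1 n)//= (leq_trans _ (leq_addr _ _))//.
  by rewrite (bigD1 j)//= leq_addr.
apply/imfsetP; exists [ffun j => Ordinal (nN j)] => //.
by apply/ffunP => j; rewrite !ffunE.
Qed.

Lemma fset_sum_sub (f : {ffun 'I_r -> nat} -> R) J J' : (J `<=` J')%fset ->
  \sum_(n <- J') f n = \sum_(n <- J) f n + \sum_(n <- (J' `\` J)%fset) f n.
Proof.
move=> JJ'; rewrite (big_fsetID _ (fun n => n \in J))/=; congr (_ + _).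
- apply: eq_fbigl => n; rewrite !inE/=; case: (boolP (n \in J)) => h; last by rewrite andbF.
  by rewrite (fsubsetP JJ').
- by apply: eq_fbigl => n; rewrite !inE/= andbC.
Qed.

Variables (F : 'I_r -> nat -> R) (L A : 'I_r -> R).
Hypothesis cF : forall j, \sum_(k < N) F j k @[N --> \oo] --> L j.
Hypothesis cA : forall j, \sum_(k < N) `|F j k| @[N --> \oo] --> A j.

Lemma cvg_prod_seq (s : seq 'I_r) (u : 'I_r -> nat -> R) (l : 'I_r -> R) :
  (forall j, u j N @[N --> \oo] --> l j) -> \prod_(j <- s) u j N @[N --> \oo] --> \prod_(j <- s) l j.
Proof.
move=> h; elim: s => [|j s ih].
  by under eq_fun do rewrite big_nil; rewrite big_nil; exact: cvg_cst.
by under eq_fun do rewrite big_cons; rewrite big_cons; apply: cvgM.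
Qed.

Local Notation w n := (\prod_j F j (n j)).

Lemma cvg_box_sum : \sum_(n <- box N) w n @[N --> \oo] --> \prod_j L j.
Proof. by under eq_fun do rewrite box_sum; exact: cvg_prod_seq. Qed.

Lemma cvg_box_abs_sum : \sum_(n <- box N) `|w n| @[N --> \oo] --> \prod_j A j.
Proof.
rewrite (_ : (fun N => \sum_(n <- box N) `|w n|) = fun N => \prod_j \sum_(k < N) `|F j k|).
  exact: cvg_prod_seq.
apply/funext => N; rewrite -(box_sum (fun j k => `|F j k|)).
by apply: eq_bigr => n _; rewrite normr_prod.
Qed.

(** For a cube containing [J], the sum over the complement of [J] in it is at most the sum of
    absolute values there; letting the cube grow gives the bound. *)
Lemma fset_sum_remainder J : `|\prod_j L j - \sum_(n <- J) w n| <= \prod_j A j - \sum_(n <- J) `|w n|.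
Proof.
have [N0 hN0] := box_sub J.
have c1 : `|\sum_(n <- box N) w n - \sum_(n <- J) w n| @[N --> \oo] --> `|\prod_j L j - \sum_(n <- J) w n|.
  by apply: cvg_norm; apply: cvgB; [exact: cvg_box_sum|exact: cvg_cst].
have c2 : (\sum_(n <- box N) `|w n| - \sum_(n <- J) `|w n|) @[N --> \oo] --> \prod_j A j - \sum_(n <- J) `|w n|.
  by apply: cvgB; [exact: cvg_box_abs_sum|exact: cvg_cst].
apply: ler_cvg_to c1 c2 _; exists N0 => // N /= hN.
have e (x y : R) : x + y - x = y by ring.
rewrite !(fset_sum_sub _ (hN0 N hN)) !e.
exact: ler_norm_sum.
Qed.

End box_sums.

(** A positive element of [R[i]] is real, so convergence in the normed module [R[i]^o] can be tested
    with real tolerances. *)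
Lemma partial_sum_cvg {R : realType} (I : choiceType) (x : I -> R[i]) (S : R[i]) :
  (forall e : R, 0 < e -> exists J0 : {fset I}, forall J : {fset I}, (J0 `<=` J)%fset ->
     normc (S - \sum_(n <- J) x n) <= e) ->
  summability.partial_sum (x : I -> R[i]^o) @ summability.totally --> (S : R[i]^o).
Proof.
move=> h; have tF : ProperFilter (@summability.totally I) := summability.totally_filter.
apply/cvgrPdist_le => /= e e0.
have eE : e = (Re e)%:C.
  by case: e e0 => a b0; rewrite ltcE /= => /andP[/eqP -> _].
have re0 : 0 < Re e by rewrite eE ltcR in e0.
have [J0 hJ] := h _ re0.
exists J0 => // J /= /hJ hle.
rewrite /summability.partial_sum eE normcK lecR -(@big_seq_fsetE _ _ _ _ J xpredT x).
exact: hle.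
Qed.

(** * The series as a Mellin integral *)

Section expectation_integral.
Context (d : measure_display) (T : measurableType d) (R : realType).
Variable P : probability T R.

Lemma expectationCE (f : T -> R[i]) : expectationC P f = integralC P f.
Proof. by rewrite /expectationC unlock. Qed.

Lemma integralC_ae_eq (f g : T -> R[i]) : measurable_funC f -> measurable_funC g ->
  {ae P, forall x, f x = g x} -> integralC P f = integralC P g.
Proof.
move=> [f1 f2] [g1 g2] fg; apply: complex_eqP => /=; congr fine; apply: ae_eq_integral => //.
- exact/measurable_EFinP.
- exact/measurable_EFinP.
- by apply: filterS fg => x e _; rewrite e.
- exact/measurable_EFinP.
- exact/measurable_EFinP.
- by apply: filterS fg => x e _; rewrite e.
Qed.

End expectation_integral.

(** * The Laplace transform of a uniform variable *)

Section uniform_laplace.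
Context {R : realType}.
Notation mu := (@lebesgue_measure R).

Lemma Rintegral_exp01 (x : R) : 0 < x ->
  (\int[mu]_(u in `[0%R, 1%R]) (expR (- (x * u)))%:E = ((1 - expR (- x)) / x)%:E)%E.
Proof.
move=> x0; pose F (u : R) := - expR (- (x * u)) / x.
have dF (u : R) : is_derive u 1 F (expR (- (x * u))).
  have -> : expR (- (x * u)) = - (- x * expR (- (x * u))) / x by field; rewrite lt0r_neq0.
  have d1 : is_derive u 1 (fun u => - (x * u)) (- x).
    have -> : (fun u : R => - (x * u)) = (fun u => (- x) *: u) by apply/funext => v; rewrite /GRing.scale /= mulNr.
    rewrite -[X in is_derive _ _ _ X]mulr1; apply: is_deriveZ.
  have d2 : is_derive u 1 (fun u => expR (- (x * u))) (- x * expR (- (x * u))).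
    by rewrite mulrC; exact: (is_derive1_comp (is_derive_expR _) d1).
  have -> : F = (fun u => (- x^-1) *: expR (- (x * u))).
    by apply/funext => v; rewrite /F /GRing.scale /= mulrC mulrN mulNr.
  have -> : - (- x * expR (- (x * u))) / x = (- x^-1) *: (- x * expR (- (x * u))).
    by rewrite /GRing.scale /=; ring.
  exact: is_deriveZ.
have cF : continuous F.
  by move=> u; apply/differentiable_continuous/derivable1_diffP; have [] := dF u.
have ce : continuous (fun u => expR (- (x * u))).
  move=> u; apply: continuous_comp; last exact: continuous_expR.
  by apply: cvgN; apply: cvgM; [exact: cvg_cst|exact: cvg_id].
rewrite (@continuous_FTC2 _ _ F)//.
- rewrite /F mulr0 oppr0 expR0 mulr1 -EFinB; congr EFin; field; exact: lt0r_neq0.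
- exact: continuous_subspaceT.
- split; first by move=> u _; have [] := dF u.
  + apply: cvg_at_right_filter; exact: cF.
  + apply: cvg_at_left_filter; exact: cF.
- by move=> u _; rewrite derive1E; have [_ ->] := dF u.
Qed.

(* A uniform variable lies in [0, 1] only almost surely; clamping it makes the
   bounds needed for Fubini hold everywhere. *)
Definition clamp (u : R) : R := Num.max 0 (Num.min 1 u).

Lemma clamp_bounds u : 0 <= clamp u <= 1.
Proof. by rewrite /clamp le_max lexx /= ge_max ler01 ge_min lexx. Qed.

Lemma clamp_id u : 0 <= u <= 1 -> clamp u = u.
Proof. by move=> /andP[u0 u1]; rewrite /clamp (min_idPr u1) (max_idPr u0). Qed.

Lemma measurable_clamp : measurable_fun setT clamp.
Proof.
by apply: measurable_maxr; [exact: measurable_cst|apply: measurable_minr; [exact: measurable_cst|exact: measurable_id]].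
Qed.

Context (d : measure_display) (T : measurableType d) (P : probability T R).
Variable U : {RV P >-> R}.
Hypothesis U_unif : forall A : set R, measurable A ->
  distribution P U A = uniform_prob (@ltr01 R) A.

Lemma bounded_measurable_clamp_exp x : 0 <= x ->
  bounded_measurable (fun u => expR (- (x * clamp u))).
Proof.
move=> x0; split.
  apply: measurableT_comp => //; apply: measurableT_comp => //.
  by apply: measurable_funM => //; exact: measurable_clamp.
exists 1 => u; rewrite ger0_norm ?expR_ge0// -expR0 ler_expR oppr_le0 mulr_ge0//.
by have /andP[] := clamp_bounds u.
Qed.

Lemma uniform_clamp_laplace x : 0 < x ->
  \int[P]_w expR (- (x * clamp (U w))) = (1 - expR (- x)) / x.
Proof.
move=> x0; have [mg _] := bounded_measurable_clamp_exp (ltW x0).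
rewrite /Rintegral.
have mU : measurable_fun setT (U : T -> measurableTypeR R).
  by move=> mT A mA; exact: (@measurable_funPT _ _ _ _ U mT A mA).
have me : measurable_fun setT (fun u : measurableTypeR R => (expR (- (x * clamp u)))%:E).
  exact/measurable_EFinP.
have ge0 (u : measurableTypeR R) : (0 <= (expR (- (x * clamp u)))%:E)%E by rewrite lee_fin expR_ge0.
have := @ge0_integral_pushforward _ _ _ _ _ _ mU P setT _ measurableT me (fun u _ => ge0 u).
rewrite preimage_setT /= => <-.
rewrite (eq_measure_integral (uniform_prob (@ltr01 R))); last by move=> A mA _; exact: U_unif.
rewrite integral_uniform// subr0 invr1 mul1e.
have -> : (\int[mu]_(u in `[0%R, 1%R]) (expR (- (x * clamp u)))%:E =
    \int[mu]_(u in `[0%R, 1%R]) (expR (- (x * u)))%:E)%E.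
  by apply: eq_integral => u; rewrite inE /= in_itv /= => h; rewrite clamp_id.
by rewrite Rintegral_exp01.
Qed.

Lemma uniform_ae01 : {ae P, forall w, 0 <= U w <= 1}.
Proof.
have mU : measurable_fun setT U by exact: measurable_funPT.
pose A : set R := ~` `[0, 1]%classic.
have mA : measurable A by exact: measurableC.
exists (U @^-1` A); split.
- by rewrite -[X in measurable X]setTI; exact: mU.
- transitivity (distribution P U A); first by [].
  rewrite U_unif// /uniform_prob integral0_eq// => u; rewrite /A /= in_itv /= => /negP/negPf h.
  by rewrite /uniform_pdf h.
- by move=> w /= h; rewrite /A /= in_itv /=.
Qed.

End uniform_laplace.

Section measurable_powC.
Context {R : realType}.

Lemma measurable_LogC_real : measurable_funC (fun y : measurableTypeR R => LogC (y : R)%:C).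
Proof.
split => /=.
- apply: measurableT_comp; first exact: measurable_ln.
  rewrite [X in measurable_fun _ X](_ : _ = fun y : R => `|y|); first exact: normr_measurable.
  by apply/funext => y; rewrite -[RHS]normc_real.
(* On the real line the argument takes three values, according to the sign of [y]; at [0] it is
   [acos 0] because [0 / 0 = 0]. *)
- rewrite [X in measurable_fun _ X](_ : _ = fun y : R =>
    acos 1 * \1_(`]0, +oo[%classic : set R) y + acos (-1) * \1_(`]-oo, 0[%classic : set R) y + acos 0 * \1_[set (0 : R)] y).
    apply: measurable_funD; [apply: measurable_funD|]; apply: measurable_funM; try exact: measurable_cst;
    exact: measurable_indic.
  apply/funext => y; have -> : argC y%:C = acos (y / `|y|) by rewrite /argC normc_real /= lexx.
  rewrite !indicE.
  have m1 : (y \in (`]0, +oo[%classic : set R)) = (0 < y).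
    by apply/idP/idP; rewrite inE /= in_itv /= andbT.
  have m2 : (y \in (`]-oo, 0[%classic : set R)) = (y < 0).
    by apply/idP/idP; rewrite inE /= in_itv.
  have m3 : (y \in [set (0 : R)]) = (y == 0).
    by apply/idP/idP; rewrite inE /= => /eqP.
  rewrite m1 m2 m3; case: (ltgtP y 0) => [y0|y0|->].
  + by rewrite ltr0_norm// invrN mulrN divff ?lt_eqF//; rewrite !mulr0 !mulr1 add0r addr0.
  + by rewrite gtr0_norm// divff ?gt_eqF//; rewrite !mulr0 !mulr1 !addr0.
  + by rewrite mul0r /= !mulr0 !mulr1 !add0r.
Qed.

Lemma measurable_funC_comp (d d' : measure_display) (T : measurableType d) (T' : measurableType d')
  (X : T' -> T) (f : T -> R[i]) : measurable_fun setT X -> measurable_funC f ->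
  measurable_funC (fun x => f (X x)).
Proof. by move=> mX [f1 f2]; split; [exact: measurableT_comp f1 mX|exact: measurableT_comp f2 mX]. Qed.

End measurable_powC.

(** * One term of the series as a Mellin integral *)

Section term_laplace.
Context (R : realType) (d : measure_display) (T : measurableType d).
Context (P : probability T R) (r : nat) (alpha : 'I_r -> nat) (a : 'I_r -> R).
Context (b : R) (U : forall j : 'I_r, 'I_(alpha j) -> {RV P >-> R}).
Hypothesis a_gt0 : forall j, 0 < a j.
Hypothesis b_gt0 : 0 < b.
Hypothesis U_unif : forall j (l : 'I_(alpha j)) (A : set R), measurable A ->
  distribution P (U l) A = uniform_prob (@ltr01 R) A.
Hypothesis U_indep : mutually_independent
  (fun k : {j : 'I_r & 'I_(alpha j)} => U (tagged k)).
Notation mu := (@lebesgue_measure R).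

(** The base of the power with clamped uniforms: almost surely the original one, but bounded below
    by [b] everywhere. *)
Definition term_base (n : 'I_r -> nat) w : R :=
  \sum_j a j * ((n j)%:R + \sum_(l < alpha j) clamp (U l w)) + b.

Lemma term_base_ge n w : b <= term_base n w.
Proof.
rewrite /term_base lerDr; apply: sumr_ge0 => j _; apply: mulr_ge0; first exact: ltW.
apply: addr_ge0 => //; apply: sumr_ge0 => l _; by have /andP[] := clamp_bounds (U l w).
Qed.

Lemma measurable_term_base n : measurable_fun setT (term_base n).
Proof.
apply: measurable_funD => //; apply: measurable_sum => j; apply: measurable_funM => //.
apply: measurable_funD => //; apply: measurable_sum => l.
apply: measurableT_comp; [exact: measurable_clamp|exact: measurable_funPT].
Qed.

(* The Laplace transform of a uniform variable on [0, 1], at [x * e^v]. *)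
Definition unif_lt (x v : R) := (1 - expR (- (x * expR v))) * (expR (- v) / x).

(** The exponential turns the sum into a product over the pairs [(j, l)], which independence
    separates; grouping by [j] gives the power [alpha j]. *)
Lemma expectation_exp_term_base n v :
  \int[P]_w expR (- (expR v * term_base n w)) =
  expR (- (b * expR v)) *
  \prod_j (expR (- (a j * expR v * (n j)%:R)) * unif_lt (a j) v ^+ alpha j).
Proof.
pose I := {j : 'I_r & 'I_(alpha j)}.
pose f (k : I) (u : R) := expR (- (a (tag k) * expR v * clamp u)).
have x0 j : 0 < a j * expR v by rewrite mulr_gt0 ?expR_gt0.
have bf k : bounded_measurable (f k) by apply: bounded_measurable_clamp_exp; exact: ltW.
pose K := expR (- (b * expR v)) * \prod_j expR (- (a j * expR v * (n j)%:R)).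
have e1 w : expR (- (expR v * term_base n w)) = K * \prod_(k : I) f k (U (tagged k) w).
  have -> : \prod_(k : I) f k (U (tagged k) w) =
      \prod_(j < r) \prod_(l < alpha j) expR (- (a j * expR v * clamp (U l w))).
    by rewrite (@sig_big_dep _ _ _ _ (fun j => 'I_(alpha j)) xpredT (fun _ _ => true)
         (fun j l => expR (- (a j * expR v * clamp (U l w))))).
  have es (I0 : finType) (F : I0 -> R) : \prod_i expR (F i) = expR (\sum_i F i) by rewrite expR_sum.
  rewrite /K es; under [X in _ = _ * X]eq_bigr do rewrite es.
  rewrite es -!expRD.
  congr expR; rewrite /term_base mulrDr opprD addrC -addrA; congr (_ + _); first by rewrite mulrC.
  rewrite -big_split /= mulr_sumr -sumrN; apply: eq_bigr => j _.
  rewrite mulrA mulrDr opprD [expR v * _]mulrC; congr (_ + _).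
  by rewrite mulr_sumr sumrN.
under eq_Rintegral do rewrite e1.
have bP : bounded_measurable (fun w => \prod_(k : I) f k (U (tagged k) w)).
  apply: bounded_measurable_prod => k; apply: bounded_measurable_comp => //; exact: measurable_funPT.
rewrite RintegralZl//; last exact: bounded_measurable_integrable.
rewrite (@indep_expectation _ _ _ P I (fun k => U (tagged k)) f)// /K -mulrA; congr (_ * _).
rewrite big_split /=; congr (_ * _).
transitivity (\prod_(j < r) \prod_(l < alpha j) unif_lt (a j) v).
  rewrite (@sig_big_dep _ _ _ _ (fun j => 'I_(alpha j)) xpredT (fun _ _ => true) (fun j l => unif_lt (a j) v)).
  apply: eq_bigr => k _; rewrite /f (uniform_clamp_laplace (@U_unif _ _) (x0 _)) /unif_lt (expRN v).
  by field; rewrite !lt0r_neq0 ?expR_gt0.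
by apply: eq_bigr => j _; rewrite prodr_const card_ord.
Qed.

Lemma normc_powC_term_base s n w : 0 < Re s ->
  normc (powC (term_base n w)%:C (- s)) <= expR (- (Re s * ln b)).
Proof.
move=> s0; have Y0 : 0 < term_base n w := lt_le_trans b_gt0 (term_base_ge n w).
rewrite normc_expC LogC_real// cReM /= mulr0 subr0 ler_expR cReN mulNr lerN2 ler_wpM2l ?(ltW s0)//.
by rewrite ler_ln ?posrE// term_base_ge.
Qed.

Lemma measurable_powC_real (Y : T -> R) s : measurable_fun setT Y ->
  measurable_funC (fun w => powC (Y w)%:C s).
Proof.
move=> mY; apply: measurable_funC_exp; apply: measurable_funCM; first exact: measurable_funC_cst.
exact: (measurable_funC_comp mY measurable_LogC_real).
Qed.

Lemma integrableC_powC_term_base s n : 0 < Re s -> integrableC P (fun w => powC (term_base n w)%:C (- s)).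
Proof.
move=> s0; apply: (@integrableC_dominated _ _ _ P _ (fun=> expR (- (Re s * ln b)))).
- by apply: measurable_powC_real; exact: measurable_term_base.
- exact: (finite_measure_integrable_cst P _ measurableT).
- by move=> w; exact: normc_powC_term_base.
Qed.

Lemma term_clampE s n : 0 < Re s ->
  tanh_moment_term a b U s n =
  (\prod_j gbinom R (- (alpha j)%:Z) (n j))%:C * integralC P (fun w => powC (term_base n w)%:C (- s)).
Proof.
move=> s0; rewrite /tanh_moment_term expectationCE.
set c := (\prod_j gbinom R _ _)%:C.
have mV : measurable_fun setT (fun w => \sum_j a j * ((n j)%:R + Vsum U j w) + b).
  apply: measurable_funD => //; apply: measurable_sum => j; apply: measurable_funM => //.
  apply: measurable_funD => //; apply: measurable_sum => l; exact: measurable_funPT.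
have mY := measurable_term_base n.
rewrite -integralCZ; last exact: integrableC_powC_term_base.
apply: integralC_ae_eq.
- rewrite [X in measurable_funC X](_ : _ = fun w => c * powC ((\sum_j a j * ((n j)%:R + Vsum U j w) + b)%:C) (- s)).
    by apply: measurable_funCM; [exact: measurable_funC_cst|exact: measurable_powC_real].
  by apply/funext => w; rewrite powCN div1r.
- by apply: measurable_funCM; [exact: measurable_funC_cst|exact: measurable_powC_real].
have : {ae P, forall w, forall k : {j : 'I_r & 'I_(alpha j)}, 0 <= U (tagged k) w <= 1}.
  by apply: filter_forall => k; exact: (uniform_ae01 (@U_unif _ _)).
apply: filterS => w hw.
have -> : term_base n w = \sum_j a j * ((n j)%:R + Vsum U j w) + b.
  rewrite /term_base; congr (_ + b); apply: eq_bigr => j _; congr (_ * (_ + _)); apply: eq_bigr => l _.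
  by rewrite clamp_id//; exact: (hw (Tagged (fun j => 'I_(alpha j)) l)).
by rewrite powCN div1r.
Qed.

Lemma bounded_measurable_exp_term_base n v :
  bounded_measurable (fun w => expR (- (expR v * term_base n w))).
Proof.
split.
  apply: measurableT_comp => //; apply: measurableT_comp => //; apply: measurable_funM => //; exact: measurable_term_base.
exists (expR (- (b * expR v))) => w; rewrite ger0_norm ?expR_ge0// ler_expR lerN2 mulrC.
by rewrite ler_wpM2l ?expR_ge0// term_base_ge.
Qed.

Lemma integralC_laplace_term_base s n v :
  integralC P (fun w => expC (s * v%:C - (term_base n w)%:C * (expR v)%:C)) =
  expC (s * v%:C) * (\int[P]_w expR (- (expR v * term_base n w)))%:C.
Proof.
have -> : (fun w => expC (s * v%:C - (term_base n w)%:C * (expR v)%:C)) =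
    (fun w => expC (s * v%:C) * (expR (- (expR v * term_base n w)))%:C).
  apply/funext => w; rewrite -(expC_real (- (expR v * term_base n w))) -expCD; congr expC.
  by rewrite mulrC [expR v * _]mulrC rmorphN rmorphM /= [_%:C * s]mulrC.
rewrite integralCZ ?integralC_real//; split => /=; last exact: integrable0.
exact: bounded_measurable_integrable (bounded_measurable_exp_term_base n v).
Qed.

Lemma continuous_exp_lin (x : R) : continuous (fun v : R => expR (- (x * expR v))).
Proof.
rewrite (_ : (fun _ => _) = gkern 0 x); first exact: continuous_gkern.
by apply/funext => v; rewrite /gkern mul0r add0r.
Qed.

Lemma continuous_unif_lt x : continuous (unif_lt x).
Proof.
have -> : unif_lt x = fun v => (1 - expR (- (x * expR v))) * (gkern (-1) 0 v / x).
  by apply/funext => v; rewrite /unif_lt /gkern mulN1r mul0r subr0.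
move=> v; apply: cvgM; first by apply: cvgB; [exact: cvg_cst|exact: continuous_exp_lin].
by apply: cvgM; [exact: continuous_gkern|exact: cvg_cst].
Qed.

Lemma measurable_exp_lin (x : R) : measurable_fun setT (fun v : measurableTypeR R => expR (- (x * expR v))).
Proof. by apply: continuous_measurable_fun; exact: continuous_exp_lin. Qed.

Lemma measurable_expC_lin s : measurable_funC (fun v : measurableTypeR R => expC (s * v%:C)).
Proof.
apply: measurable_funC_exp; apply: measurable_funCM; first exact: measurable_funC_cst.
exact: measurable_funC_real.
Qed.

Lemma normc_expC_lin s (v : R) : normc (expC (s * v%:C)) = expR (Re s * v).
Proof. by rewrite normc_expC cReM /= mulr0 subr0. Qed.

Lemma integrableC_expectation_exp_term_base s n : 0 < Re s ->
  integrableC mu (fun v => expC (s * v%:C) * (\int[P]_w expR (- (expR v * term_base n w)))%:C).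
Proof.
move=> s0; apply: (@integrableC_dominated _ _ _ mu _ (gkern (Re s) b)).
- apply: measurable_funCM; first exact: measurable_expC_lin.
  under eq_fun do rewrite expectation_exp_term_base.
  apply: measurable_funC_real; apply: measurable_funM; first exact: measurable_exp_lin.
  apply: measurable_prod => j _; apply: measurable_funM.
    rewrite [X in measurable_fun _ X](_ : _ = fun v => expR (- ((a j * (n j)%:R) * expR v))).
      exact: measurable_exp_lin.
    by apply/funext => v; congr expR; ring.
  by apply: measurable_funX; apply: continuous_measurable_fun; exact: continuous_unif_lt.
- exact: integrable_gkern.
move=> v; rewrite normcM normc_expC_lin normc_real /gkern expRD ler_wpM2l ?expR_ge0//.
apply: Rintegral_prob_bound; first exact: bounded_measurable_exp_term_base.
move=> w; rewrite ger0_norm ?expR_ge0// ler_expR lerN2 mulrC.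
by rewrite ler_wpM2l ?expR_ge0// term_base_ge.
Qed.

(** After the interchange of integrals, [n] enters only through powers of [e^(- a_j e^v)], so the
    integrand is a product of terms of one-variable series times a weight independent of [n]. *)
Lemma GammaC_term s n : 0 < Re s ->
  GammaC s * tanh_moment_term a b U s n =
  integralC mu (fun v => expC (s * v%:C) *
    ((\prod_j (gbinom R (- (alpha j)%:Z) (n j) * expR (- (a j * expR v)) ^+ n j)) *
     (expR (- (b * expR v)) * \prod_j unif_lt (a j) v ^+ alpha j))%:C).
Proof.
move=> s0; rewrite term_clampE//; set c := \prod_j gbinom R _ _.
have i0 := integrableC_powC_term_base n s0.
have eY : GammaC s * integralC P (fun w => powC (term_base n w)%:C (- s)) =
    integralC P (fun w => integralC mu (fun v => expC (s * v%:C - (term_base n w)%:C * (expR v)%:C))).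
  rewrite -integralCZ//; congr integralC; apply/funext => w.
  by rewrite integralC_laplace_kernel//= (lt_le_trans b_gt0)// term_base_ge.
rewrite mulrCA eY (@integralC_fubini _ _ _ _ _ P mu _ (gkern (Re s) b)).
- rewrite -integralCZ.
    congr integralC; apply/funext => v.
    rewrite integralC_laplace_term_base expectation_exp_term_base mulrCA -rmorphM /=; congr (_ * _%:C).
    rewrite /c !big_split /=.
    have -> : \prod_(i < r) expR (- (a i * expR v * (n i)%:R)) = \prod_(i < r) expR (- (a i * expR v)) ^+ n i.
      by apply: eq_bigr => j _; rewrite -expRM_natl; congr expR; ring.
    by ring.
  under eq_fun do rewrite integralC_laplace_term_base.
  exact: integrableC_expectation_exp_term_base.
- apply: measurable_funC_exp; apply: measurable_funCB; apply: measurable_funCM.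
  + exact: measurable_funC_cst.
  + by apply: measurable_funC_real; exact: measurable_snd.
  + by apply: measurable_funC_real; apply: measurableT_comp; [exact: measurable_term_base|exact: measurable_fst].
  + by apply: measurable_funC_real; apply: measurableT_comp; [exact: measurable_expR|exact: measurable_snd].
- exact: integrable_gkern.
- move=> w v; rewrite normc_laplace_kernel /= /gkern ler_expR lerD2l lerN2 ler_wpM2r ?expR_ge0//.
  exact: term_base_ge.
Qed.

End term_laplace.

(** * Unconditional convergence of the series *)

Section series_convergence.
Context (R : realType) (r : nat) (alpha : 'I_r -> nat) (a : 'I_r -> R) (b : R).
Hypothesis alpha_gt0 : forall j, (0 < alpha j)%N.
Hypothesis a_gt0 : forall j, 0 < a j.
Hypothesis b_gt0 : 0 < b.
Notation mu := (@lebesgue_measure R).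
Notation beta := (\sum_j alpha j)%N.
Implicit Types (J : {fset {ffun 'I_r -> nat}}) (v : R).

Definition lt_weight v : R := expR (- (b * expR v)) * \prod_j unif_lt (a j) v ^+ alpha j.

Definition bin_factor v (j : 'I_r) (k : nat) : R :=
  gbinom R (- (alpha j)%:Z) k * expR (- (a j * expR v)) ^+ k.

Definition bin_limit v (j : 'I_r) : R := (1 + expR (- (a j * expR v))) ^- alpha j.

Definition bin_abs_limit v (j : 'I_r) : R := (1 - expR (- (a j * expR v))) ^- alpha j.

Lemma exp_arg_itv v j : 0 < expR (- (a j * expR v)) < 1.
Proof. by rewrite expR_gt0 -expR0 ltr_expR oppr_lt0 mulr_gt0 ?expR_gt0. Qed.

Lemma cvg_bin_factor v j : \sum_(k < N) bin_factor v j k @[N --> \oo] --> bin_limit v j.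
Proof.
have /andP[y0 y1] := exp_arg_itv v j; set y := expR _ in y0 y1.
(* [negbin_sum k] converges to the power [-(k + 1)], hence the predecessor of [alpha j]. *)
have := @cvg_negbin_sum R (alpha j).-1 (- y); rewrite normrN gtr0_norm// => /(_ y1).
rewrite opprK prednK// /bin_limit -/y; apply: cvg_trans; apply: near_eq_cvg.
apply: nearW => N; apply: eq_bigr => k _.
by rewrite /bin_factor -/y -[X in - X%:Z](prednK (alpha_gt0 j)) gbinom_opp [(- y) ^+ k]exprNn mulrCA mulrA.
Qed.

Lemma cvg_bin_factor_abs v j : \sum_(k < N) `|bin_factor v j k| @[N --> \oo] --> bin_abs_limit v j.
Proof.
have /andP[y0 y1] := exp_arg_itv v j; set y := expR _ in y0 y1.
have := @cvg_negbin_sum R (alpha j).-1 y; rewrite gtr0_norm// => /(_ y1).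
rewrite prednK// /bin_abs_limit -/y; apply: cvg_trans; apply: near_eq_cvg.
apply: nearW => N; apply: eq_bigr => k _.
rewrite /bin_factor -/y -[X in - X%:Z](prednK (alpha_gt0 j)) gbinom_opp !normrM normrX normrN1.
by rewrite expr1n mul1r normr_nat normrX gtr0_norm.
Qed.

Definition bin_term v (n : 'I_r -> nat) : R := \prod_j bin_factor v j (n j).

Lemma bin_remainder J v :
  `|\prod_j bin_limit v j - \sum_(n <- J) bin_term v n| <=
  \prod_j bin_abs_limit v j - \sum_(n <- J) `|bin_term v n|.
Proof.
exact: (@fset_sum_remainder R r (bin_factor v) (bin_limit v) (bin_abs_limit v)
  (@cvg_bin_factor v) (@cvg_bin_factor_abs v) J).
Qed.

Lemma bin_limit_le v : `|\prod_j bin_limit v j| <= \prod_j bin_abs_limit v j.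
Proof. by have := bin_remainder fset0 v; rewrite !big_seq_fset0 !subr0. Qed.

(** The right-hand side of [bin_remainder] for a singleton is nonnegative. *)
Lemma bin_term_le v n : `|bin_term v n| <= \prod_j bin_abs_limit v j.
Proof.
have := bin_remainder [fset [ffun j => n j]]%fset v; rewrite !big_seq_fset1.
have -> : bin_term v [ffun j => n j] = bin_term v n by apply: eq_bigr => j _; rewrite ffunE.
by move=> h; rewrite -subr_ge0 (le_trans _ h).
Qed.

Lemma unif_lt_ge0 v j : 0 <= unif_lt (a j) v.
Proof.
have /andP[_ y1] := exp_arg_itv v j.
by rewrite mulr_ge0 ?subr_ge0 ?(ltW y1)// divr_ge0 ?expR_ge0 ?ltW.
Qed.

Lemma lt_weight_ge0 v : 0 <= lt_weight v.
Proof. by rewrite mulr_ge0 ?expR_ge0//; apply: prodr_ge0 => j _; rewrite exprn_ge0 ?unif_lt_ge0. Qed.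

(** The powers of [1 - e^(- a_j e^v)] cancel exactly. What is left shifts the exponent by [beta], so
    integrability as [v] tends to minus infinity is what requires [Re s > beta]. *)
Lemma bin_abs_limit_weight (x v : R) :
  expR (x * v) * ((\prod_j bin_abs_limit v j) * lt_weight v) =
  \prod_j (a j) ^- alpha j * gkern (x - beta%:R) b v.
Proof.
have e1 : \prod_j bin_abs_limit v j * \prod_j unif_lt (a j) v ^+ alpha j =
    \prod_j (a j) ^- alpha j * expR (- (beta%:R * v)).
  have -> : expR (- (beta%:R * v)) = \prod_j expR (- v) ^+ alpha j.
    by rewrite prodrXr -expRM_natl; congr expR; ring.
  rewrite -!big_split; apply: eq_bigr => j _ /=.
  have /andP[_ y1] := exp_arg_itv v j.
  rewrite /bin_abs_limit /unif_lt -!exprVn -!exprMn; congr (_ ^+ _).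
  by field; rewrite !lt0r_neq0 ?subr_gt0.
rewrite /lt_weight /gkern mulrCA [X in _ * X]mulrC.
rewrite -[expR (- (b * expR v)) * _]mulrC.
have -> : expR ((x - beta%:R) * v - b * expR v) = expR (x * v) * expR (- (beta%:R * v)) * expR (- (b * expR v)).
  by rewrite -!expRD; congr expR; ring.
transitivity (expR (x * v) * expR (- (b * expR v)) * (\prod_j bin_abs_limit v j * \prod_j unif_lt (a j) v ^+ alpha j)).
  ring.
by rewrite e1; ring.
Qed.

Lemma measurable_lt_weight : measurable_fun setT (lt_weight : measurableTypeR R -> R).
Proof.
apply: measurable_funM; first exact: measurable_exp_lin.
apply: measurable_prod => j _; apply: measurable_funX; apply: continuous_measurable_fun.
exact: continuous_unif_lt.
Qed.

Lemma measurable_bin_term n : measurable_fun setT (fun v : measurableTypeR R => bin_term v n).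
Proof.
apply: measurable_prod => j _; apply: measurable_funM => //.
apply: measurable_funX; exact: measurable_exp_lin.
Qed.

Lemma measurable_bin_limit : measurable_fun setT (fun v : measurableTypeR R => \prod_j bin_limit v j).
Proof.
apply: measurable_prod => j _; rewrite /bin_limit.
under eq_fun do rewrite -exprVn.
apply: measurable_funX; apply: continuous_measurable_fun => v.
apply: cvgV; last by apply: cvgD; [exact: cvg_cst|exact: continuous_exp_lin].
by rewrite lt0r_neq0// addr_gt0 ?expR_gt0.
Qed.

Variable s : R[i].
Hypothesis s_gt : beta%:R < Re s.

Let K : R := \prod_j (a j) ^- alpha j.

Definition mellin_bound v : R := K * gkern (Re s - beta%:R) b v.

Lemma integrable_mellin_bound : mu.-integrable setT (fun v => (mellin_bound v)%:E).
Proof.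
under eq_fun do rewrite EFinM; apply: integrableZl => //.
by apply: integrable_gkern => //; rewrite subr_gt0.
Qed.

Lemma integrableC_mellin (q : R -> R) : measurable_fun setT (q : measurableTypeR R -> R) ->
  (forall v, `|q v| <= \prod_j bin_abs_limit v j) ->
  integrableC mu (fun v => expC (s * v%:C) * (q v * lt_weight v)%:C).
Proof.
move=> mq hq; apply: (@integrableC_dominated _ _ _ mu _ mellin_bound).
- apply: measurable_funCM; first exact: measurable_expC_lin.
  by apply: measurable_funC_real; apply: measurable_funM => //; exact: measurable_lt_weight.
- exact: integrable_mellin_bound.
- move=> v; rewrite normcM normc_expC_lin normc_real /mellin_bound -bin_abs_limit_weight.
  rewrite ler_wpM2l ?expR_ge0// normrM [ `|lt_weight v|]ger0_norm ?lt_weight_ge0//.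
  by rewrite ler_wpM2r ?lt_weight_ge0.
Qed.

Definition series_limit : R[i] := (GammaC s)^-1 *
  integralC mu (fun v => expC (s * v%:C) * (\prod_j bin_limit v j * lt_weight v)%:C).

Lemma re_s_gt0 : 0 < Re s.
Proof. by apply: le_lt_trans s_gt. Qed.

(** It dominates the error of the partial sum over [J] and decreases as [J] grows, so smallness on
    one cube passes to every finite set containing it. *)
Definition mellin_remainder J v : R :=
  expR (Re s * v) * ((\prod_j bin_abs_limit v j - \sum_(n <- J) `|bin_term v n|) * lt_weight v).

Lemma bin_remainder_ge0 J v : 0 <= \prod_j bin_abs_limit v j - \sum_(n <- J) `|bin_term v n|.
Proof. exact: le_trans (bin_remainder J v). Qed.

Lemma mellin_remainder_bounds J v : 0 <= mellin_remainder J v <= mellin_bound v.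
Proof.
rewrite /mellin_remainder; apply/andP; split.
  by apply: mulr_ge0; rewrite ?expR_ge0//; apply: mulr_ge0; [exact: bin_remainder_ge0|exact: lt_weight_ge0].
rewrite /mellin_bound -bin_abs_limit_weight ler_wpM2l ?expR_ge0// ler_wpM2r ?lt_weight_ge0//.
by rewrite gerBl sumr_ge0.
Qed.

Lemma measurable_mellin_remainder J : measurable_fun setT (mellin_remainder J : measurableTypeR R -> R).
Proof.
have -> : mellin_remainder J = (fun v => mellin_bound v -
    gkern (Re s) 0 v * ((\sum_(n <- J) `|bin_term v n|) * lt_weight v)).
  apply/funext => v; rewrite /mellin_bound -bin_abs_limit_weight /mellin_remainder /gkern mul0r subr0.
  by ring.
apply: measurable_funB.
  by apply: measurable_funM => //; exact: measurable_gkern.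
apply: measurable_funM; first exact: measurable_gkern.
apply: measurable_funM; last exact: measurable_lt_weight.
apply: measurable_sum => n; apply: measurableT_comp; first exact: normr_measurable.
exact: measurable_bin_term.
Qed.

Lemma integrable_mellin_remainder J : mu.-integrable setT (fun v => (mellin_remainder J v)%:E).
Proof.
apply: (@integrable_dominated _ _ _ mu _ mellin_bound).
- exact: measurable_mellin_remainder.
- exact: integrable_mellin_bound.
- by move=> v; have /andP[h0 h1] := mellin_remainder_bounds J v; rewrite ger0_norm.
Qed.

(** Dominated convergence needs a sequence, which the cubes provide; the monotonicity of the
    remainder recovers the limit along all finite sets. *)
Lemma mellin_remainder_cvg0 : \int[mu]_v mellin_remainder (box r N) v @[N --> \oo] --> (0 : R).
Proof.
have ml N : measurable_fun setT (fun v : measurableTypeR R => (mellin_remainder (box r N) v)%:E).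
  by apply/measurable_EFinP; exact: measurable_mellin_remainder.
have m0 : measurable_fun setT (fun v : measurableTypeR R => 0%E : \bar R) by exact: measurable_cst.
have DC := @dominated_convergence _ _ _ mu setT measurableT
  (fun N v => (mellin_remainder (box r N) v)%:E) (fun=> 0%E) (fun v => (mellin_bound v)%:E) ml m0.
have H1 : \forall v \ae mu, setT v -> (mellin_remainder (box r N) v)%:E @[N --> \oo] --> (0%E : \bar R).
  apply: aeW => v _; apply: cvg_EFin; first exact: nearW.
  have : mellin_remainder (box r N) v @[N --> \oo] -->
      expR (Re s * v) * ((\prod_j bin_abs_limit v j - \prod_j bin_abs_limit v j) * lt_weight v).
    apply: cvgM; first exact: cvg_cst.
    apply: cvgM; last exact: cvg_cst.
    apply: cvgB; first exact: cvg_cst.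
    exact: (@cvg_box_abs_sum R r (bin_factor v) (bin_abs_limit v) (@cvg_bin_factor_abs v)).
  by rewrite subrr mul0r mulr0.
have H2 : \forall v \ae mu, forall N, setT v -> (`|(mellin_remainder (box r N) v)%:E| <= (mellin_bound v)%:E)%E.
  apply: aeW => v N _; have /andP[h0 h1] := mellin_remainder_bounds (box r N) v.
  by rewrite /= ger0_norm// lee_fin.
have [_ _] := DC H1 integrable_mellin_bound H2; rewrite integral0 => h.
exact: fine_cvg h.
Qed.

Context (d : measure_display) (T : measurableType d) (P : probability T R).
Context (U : forall j : 'I_r, 'I_(alpha j) -> {RV P >-> R}).
Hypothesis U_unif : forall j (l : 'I_(alpha j)) (A : set R), measurable A ->
  distribution P (U l) A = uniform_prob (@ltr01 R) A.
Hypothesis U_indep : mutually_independent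
  (fun k : {j : 'I_r & 'I_(alpha j)} => U (tagged k)).

Lemma partial_sum_error J :
  normc (GammaC s) * normc (series_limit - \sum_(n <- J) tanh_moment_term a b U s n) <=
  2 * \int[mu]_v mellin_remainder J v.
Proof.
have g0 := GammaC_neq0 re_s_gt0.
have i1 := integrableC_mellin measurable_bin_limit bin_limit_le.
have i2 n := integrableC_mellin (measurable_bin_term n) (fun v => bin_term_le v n).
rewrite -normcM mulrBr /series_limit mulVKf// mulr_sumr.
have -> : \sum_(n <- J) GammaC s * tanh_moment_term a b U s n =
    integralC mu (fun v => \sum_(n <- J) expC (s * v%:C) * (bin_term v n * lt_weight v)%:C).
  rewrite integralC_sum; last by move=> n; exact: i2.
  by apply: eq_bigr => n _; rewrite (GammaC_term _ _ U_unif U_indep _ re_s_gt0).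
rewrite -integralCB//; last by apply: integrableC_sum => n; exact: i2.
apply: normc_integralC_le.
- by apply: integrableCB => //; apply: integrableC_sum => n; exact: i2.
- exact: integrable_mellin_remainder.
move=> v; rewrite -mulr_sumr -mulrBr normcM normc_expC_lin /mellin_remainder ler_wpM2l ?expR_ge0//.
rewrite (_ : _ - _ = (\prod_j bin_limit v j * lt_weight v - \sum_(n <- J) bin_term v n * lt_weight v)%:C); last first.
  by rewrite rmorphB rmorph_sum.
rewrite normc_real -mulr_suml -mulrBl normrM.
by rewrite [ `|lt_weight v|]ger0_norm ?lt_weight_ge0// ler_wpM2r ?lt_weight_ge0// bin_remainder.
Qed.

Lemma tanh_moment_partial_sum_cvg :
  summability.partial_sum (tanh_moment_term a b U s : _ -> R[i]^o) @ summability.totally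
    --> (series_limit : R[i]^o).
Proof.
apply: partial_sum_cvg => e e0.
have g0 : 0 < normc (GammaC s).
  rewrite lt_neqAle normc_ge0 andbT eq_sym; apply/eqP => /ComplexField.Normc.eq0_normc.
  exact/eqP/GammaC_neq0/re_s_gt0.
(* The division by [2] compensates the factor in [normc_integralC_le], and [|Gamma(s)|] is cancelled
   at the end. *)
have e'0 : 0 < normc (GammaC s) * e / 2 by rewrite divr_gt0// mulr_gt0.
have /cvgrPdist_le /(_ _ e'0)[N _ hN] := mellin_remainder_cvg0.
exists (box r N) => J hJ; rewrite -(ler_pM2l g0).
apply: (le_trans (partial_sum_error J)).
have h : `|0 - \int[mu]_v mellin_remainder (box r N) v| <= normc (GammaC s) * e / 2 := hN N (leqnn N).
rewrite sub0r normrN in h.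
have h1 : \int[mu]_v mellin_remainder J v <= \int[mu]_v mellin_remainder (box r N) v.
  apply: le_Rintegral => //; try exact: integrable_mellin_remainder.
  move=> v _; rewrite /mellin_remainder ler_wpM2l ?expR_ge0// ler_wpM2r ?lt_weight_ge0//.
  by rewrite lerD2l lerN2 (fset_sum_sub _ hJ) lerDl sumr_ge0.
move: h1 (le_trans (ler_norm _) h); move: (normc _) (\int[mu]_v mellin_remainder J v)
  (\int[mu]_v mellin_remainder (box r N) v) => G x y; lra.
Qed.

End series_convergence.

(** * The limit law and the analytic continuation *)

Lemma Rintegral_eq_in_distribution (R : realType) (d1 d2 : measure_display)
    (T1 : measurableType d1) (T2 : measurableType d2) (P1 : probability T1 R) (P2 : probability T2 R)
    (X1 : T1 -> R) (X2 : T2 -> R) (g : R -> R) :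
  measurable_fun setT X1 -> measurable_fun setT X2 -> eq_in_distribution P1 P2 X1 X2 ->
  bounded_measurable g -> \int[P1]_w g (X1 w) = \int[P2]_w g (X2 w).
Proof.
move=> m1 m2 e12 bg; have [mg _] := bg.
have m1' : measurable_fun setT (X1 : T1 -> measurableTypeR R) by move=> mT A mA; exact: (m1 mT A mA).
have m2' : measurable_fun setT (X2 : T2 -> measurableTypeR R) by move=> mT A mA; exact: (m2 mT A mA).
have mg' : measurable_fun setT (fun u : measurableTypeR R => (g u)%:E) by exact/measurable_EFinP.
have i1 : P1.-integrable (X1 @^-1` setT) (fun w => (g (X1 w))%:E).
  by rewrite preimage_setT; apply: bounded_measurable_integrable; exact: (bounded_measurable_comp m1 bg).
have i2 : P2.-integrable (X2 @^-1` setT) (fun w => (g (X2 w))%:E).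
  by rewrite preimage_setT; apply: bounded_measurable_integrable; exact: (bounded_measurable_comp m2 bg).
have := @integral_pushforward _ _ _ _ _ _ m1' P1 setT _ mg' i1 measurableT.
have := @integral_pushforward _ _ _ _ _ _ m2' P2 setT _ mg' i2 measurableT.
rewrite !preimage_setT /= => h2 h1; rewrite /Rintegral -h2 -h1; congr fine.
by apply: eq_measure_integral => A mA _; exact: e12.
Qed.

Lemma expC_sum {R : realType} (I : Type) (s : seq I) (F : I -> R[i]) :
  expC (\sum_(i <- s) F i) = \prod_(i <- s) expC (F i).
Proof. by apply: (big_morph (@expC R)); [exact: expCD|exact: expC0]. Qed.

Lemma tanhcN {R : realType} (x : R) : tanhc (- x) = tanhc x.
Proof.
rewrite /tanhc oppr_eq0; case: eqP => // /eqP x0; rewrite /tanh opprK.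
have e0 : expR x + expR (- x) != 0 by rewrite lt0r_neq0// addr_gt0 ?expR_gt0.
by rewrite [expR (- x) + _]addrC; field; rewrite x0 e0.
Qed.

(** Nonnegativity lets the real power in the characteristic function of [hatT] be read as an
    ordinary natural power. *)
Lemma tanhc_ge0 {R : realType} (x : R) : 0 <= tanhc x.
Proof.
wlog x0 : x / 0 <= x.
  by move=> h; have [/h//|/ltW x0] := leP 0 x; rewrite -tanhcN h// oppr_ge0.
rewrite /tanhc; case: eqP => // _; apply: divr_ge0 => //; apply: divr_ge0; last by rewrite addr_ge0 ?expR_ge0.
by rewrite subr_ge0 ler_expR; lra.
Qed.

Section line_logarithm.
Context (R : realType) (b : R).
Hypothesis b_gt0 : 0 < b.

Lemma LogC_line (w : R) : LogC (b +i* w) = ln (normc (b +i* w)) +i* atan (w / b).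
Proof. by rewrite /LogC argC_atan. Qed.

Context (d : measure_display) (T : measurableType d) (h : T -> R).
Hypothesis mh : measurable_fun setT h.

Lemma measurable_LogC_line : measurable_funC (fun w => LogC (b +i* h w)).
Proof.
under eq_fun do rewrite LogC_line; split => /=.
- apply: measurableT_comp; first exact: measurable_ln.
  by apply: (@measurable_normc _ _ _ (fun w => b +i* h w)).
- apply: (@measurableT_comp _ _ _ _ _ _ (@atan R)).
    by apply: continuous_measurable_fun => x; exact: continuous_atan.
  exact: measurable_funM.
Qed.

Lemma measurable_powC_line (s : R[i]) : measurable_funC (fun w => powC (b +i* h w) s).
Proof.
apply: measurable_funC_exp; apply: measurable_funCM; first exact: measurable_funC_cst.
exact: measurable_LogC_line.
Qed.

End line_logarithm.

Section limit_law.
Context (R : realType) (r : nat) (alpha : 'I_r -> nat) (a : 'I_r -> R) (b : R).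
Context (d2 : measure_display) (T2 : measurableType d2) (P2 : probability T2 R).
Context (hatT : 'I_r -> {RV P2 >-> R}).
Hypothesis hatT_char : forall (j : 'I_r) (theta : R),
  char_fun (hatT j) theta = (tanhc theta `^ (alpha j)%:R)%:C.
Context (d3 : measure_display) (T3 : measurableType d3) (P3 : probability T3 R).
Context (X : 'I_r -> {RV P3 >-> R}).
Hypothesis X_indep : mutually_independent X.
Hypothesis X_dist : forall j, eq_in_distribution P3 P2 (X j) (fun w => 2^-1 * hatT j w).
Context (W : {RV P3 >-> R}).
Hypothesis W_def : forall w, W w = \sum_j a j * X j w.
Hypothesis b_gt0 : 0 < b.
Notation mu := (@lebesgue_measure R).

Let bcos (t : R) : bounded_measurable (fun x : R => cos (t * x)).
Proof.
split; last by exists 1 => x; exact: cos_max.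
by apply: measurableT_comp; [apply: continuous_measurable_fun; exact: continuous_cos|exact: measurable_funM].
Qed.

Let bsin (t : R) : bounded_measurable (fun x : R => sin (t * x)).
Proof.
split; last by exists 1 => x; exact: sin_max.
by apply: measurableT_comp; [apply: continuous_measurable_fun; exact: continuous_sin|exact: measurable_funM].
Qed.

Lemma expC_imag (t : R) : expC (0 +i* t) = cos t +i* sin t.
Proof. by rewrite /expC /= expR0 !mul1r. Qed.

Lemma char_X j (t : R) :
  integralC P3 (fun w => expC (0 +i* (t * X j w))) = (tanhc (t / 2) ^+ alpha j)%:C.
Proof.
have mX : measurable_fun setT (X j) by exact: measurable_funPT.
have mh : measurable_fun setT (hatT j) by exact: measurable_funPT.
have mh2 : measurable_fun setT (fun w => 2^-1 * hatT j w) by exact: measurable_funM.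
have := hatT_char j (t / 2); rewrite /char_fun expectationCE powR_mulrn ?tanhc_ge0// => <-.
apply: complex_eqP => /=.
- under eq_Rintegral do rewrite expR0 mul1r.
  rewrite (Rintegral_eq_in_distribution mX mh2 (X_dist j) (bcos t)).
  by apply: eq_Rintegral => w _; rewrite expR0 mul1r; congr cos; ring.
- under eq_Rintegral do rewrite expR0 mul1r.
  rewrite (Rintegral_eq_in_distribution mX mh2 (X_dist j) (bsin t)).
  by apply: eq_Rintegral => w _; rewrite expR0 mul1r; congr sin; ring.
Qed.

Lemma char_W (t : R) : integralC P3 (fun w => expC (0 +i* (t * W w))) =
  (\prod_j tanhc (t * a j / 2) ^+ alpha j)%:C.
Proof.
transitivity (integralC P3 (fun w => \prod_j expC (0 +i* (t * a j * X j w)))).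
  congr integralC; apply/funext => w; rewrite -expC_sum; congr expC.
  apply: complex_eqP; rewrite ?(raddf_sum (@complex.Re R)) ?(raddf_sum (@complex.Im R)) /=.
    by rewrite big1.
  by rewrite W_def mulr_sumr; apply: eq_bigr => j _; rewrite mulrA.
rewrite (@indep_expectationC _ _ _ P3 _ X (fun j x => expC (0 +i* (t * a j * x))))//.
- by rewrite rmorph_prod; apply: eq_bigr => j _; rewrite char_X.
- by move=> j; under eq_fun do rewrite expC_imag; exact: bcos.
- by move=> j; under eq_fun do rewrite expC_imag; exact: bsin.
Qed.

Lemma W_moment k : P3.-integrable setT (fun w => (W w ^+ k.*2)%:E).
Proof.
apply: (@moment_integrable _ _ _ P3 W (fun t => \prod_j tanhc (t * a j / 2) ^+ alpha j)).
  move=> t; have := congr1 (@complex.Re R) (char_W t); rewrite /= => <-.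
  by apply: eq_Rintegral => w _; rewrite expR0 mul1r.
apply: poly_approx_prod => j; apply: poly_approxX.
have := @poly_approx_scale R k.*2 _ (a j / 2) (poly_approx_tanhc k.*2).
by rewrite [X in poly_approx _ X -> _](_ : _ = fun x => tanhc (x * a j / 2))//; apply/funext => x; congr tanhc; ring.
Qed.

Lemma exp_abs_ln_le (x : R) : 0 < x -> expR `|ln x| <= x + x^-1.
Proof.
move=> x0; have [h|h] := leP 0 (ln x).
  by rewrite ger0_norm// lnK ?posrE// lerDl invr_ge0 ltW.
by rewrite ltr0_norm// expRN lnK ?posrE// lerDr ltW.
Qed.

(** With [n = |b + i w| >= b], one has [|Log (b + i w)| <= |ln n| + pi] and [e^|ln n| <= n + 1 / n],
    which grows at most quadratically in [w]. The factor [2^k] comes from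
    [(1 + x)^k <= 2^k (1 + x^k)]. *)
Lemma exp_normc_LogC_le k : exists C : R, forall w,
  expR (k%:R * normc (LogC (b +i* w))) <= C * (1 + w ^+ k.*2).
Proof.
pose B : R := 1 + b ^+ 2 + b^-1.
have B1 : 1 <= B by rewrite /B -addrA lerDl addr_ge0 ?sqr_ge0// invr_ge0 ltW.
pose E := expR (pi : R).
exists ((B * E) ^+ k * 2 ^+ k) => w.
have w2 := sqr_ge0 w.
have n0 := @Re_gt0_normc R (b +i* w) b_gt0; set n := normc _ in n0.
have n2 : n ^+ 2 = b ^+ 2 + w ^+ 2 by rewrite /n normc_sqrtE sqr_sqrtr// addr_ge0 ?sqr_ge0.
have bn : b <= n by apply: le_trans (norm_Re_le (b +i* w)); rewrite ler_norm.
have h1 : expR (normc (LogC (b +i* w))) <= B * E * (1 + w ^+ 2).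
  apply: (@le_trans _ _ (expR (`|ln n| + pi))).
    rewrite ler_expR (LogC_line b_gt0) (le_trans (normc_le_l1 _))//= lerD2l.
    have pi0 := pi_gt0 R; have h1 := atan_gtNpi2 (w / b); have h2 := atan_ltpi2 (w / b).
    by rewrite ler_norml; apply/andP; split; lra.
  rewrite expRD -/E mulrAC ler_wpM2r ?expR_ge0// (le_trans (exp_abs_ln_le n0))//.
  have nb : n^-1 <= b^-1 by rewrite lef_pV2 ?posrE.
  have nn : n <= 1 + n ^+ 2 by have := sqr_ge0 (n - 1); have := sqr_ge0 n; lra.
  rewrite /B; have bi : 0 <= b^-1 by rewrite invr_ge0 ltW.
  have := sqr_ge0 b; nra.
rewrite mulrC expRM_natr.
apply: (@le_trans _ _ ((B * E * (1 + w ^+ 2)) ^+ k)).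
  by rewrite lerXn2r ?nnegrE ?expR_ge0// mulr_ge0 ?mulr_ge0 ?expR_ge0 ?(le_trans ler01 B1)// addr_ge0.
rewrite exprMn -mulrA ler_wpM2l ?exprn_ge0 ?mulr_ge0 ?expR_ge0 ?(le_trans ler01 B1)//.
have -> : w ^+ k.*2 = (w ^+ 2) ^+ k by rewrite -exprM mul2n.
move: (w ^+ 2) w2 => x x0.
have [x1|x1] := leP x 1.
  apply: (@le_trans _ _ (2 ^+ k)); first by rewrite lerXn2r ?nnegrE//; lra.
  by rewrite ler_peMr ?exprn_ge0// lerDl exprn_ge0.
apply: (@le_trans _ _ ((2 * x) ^+ k)); first by rewrite lerXn2r ?nnegrE//; lra.
by rewrite exprMn ler_wpM2l ?exprn_ge0// lerDr.
Qed.

Lemma integrable_exp_normc_LogC k :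
  P3.-integrable setT (fun w => (expR (k%:R * normc (LogC (b +i* W w))))%:E).
Proof.
have [C hC] := exp_normc_LogC_le k.
apply: (@integrable_dominated _ _ _ P3 _ (fun w => C * (1 + W w ^+ k.*2))).
- apply: measurableT_comp => //; apply: measurable_funM => //.
  by apply: measurable_normc; apply: measurable_LogC_line => //; exact: measurable_funPT.
- under eq_fun do rewrite EFinM; apply: integrableZl => //.
  under eq_fun do rewrite EFinD; apply: integrableD => //; last exact: W_moment.
  exact: (finite_measure_integrable_cst P3 1 measurableT).
- by move=> w; rewrite ger0_norm ?expR_ge0.
Qed.

Lemma normc_powC_line (s : R[i]) w :
  normc (powC (b +i* w) s) <= expR (normc s * normc (LogC (b +i* w))).
Proof.
by rewrite /powC normc_expC ler_expR -normcM (le_trans (ler_norm _))// norm_Re_le.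
Qed.

Lemma exp_normc_bound (x : R) : exists k : nat, forall w,
  expR (x * normc (LogC (b +i* w))) <= expR (k%:R * normc (LogC (b +i* w))).
Proof.
exists (Num.bound `|x|) => w; rewrite ler_expR ler_wpM2r ?normc_ge0//.
by rewrite (le_trans (ler_norm x))// ltW// archi_boundP.
Qed.

Lemma integrableC_powC_line (s : R[i]) : integrableC P3 (fun w => powC (b +i* W w) s).
Proof.
have [k hk] := exp_normc_bound (normc s).
apply: (integrableC_dominated _ (integrable_exp_normc_LogC k)).
  by apply: measurable_powC_line => //; exact: measurable_funPT.
by move=> w; apply: (le_trans (normc_powC_line s (W w))); exact: hk.
Qed.

(** The modulus of the kernel depends on [b + i W] only through its real part [b], so one function
    of [v] dominates for all [w] and Fubini applies. *)
Lemma GammaC_expectation_line (s : R[i]) : 0 < Re s ->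
  GammaC s * integralC P3 (fun w => powC (b +i* W w) (- s)) =
  integralC mu (fun v => expC (s * v%:C) *
    (expR (- (b * expR v)) * \prod_j tanhc (a j * expR v / 2) ^+ alpha j)%:C).
Proof.
move=> s0; have mW : measurable_fun setT W by exact: measurable_funPT.
rewrite -integralCZ; last exact: integrableC_powC_line.
transitivity (integralC P3 (fun w => integralC mu (fun v => expC (s * v%:C - (b +i* W w) * (expR v)%:C)))).
  by congr integralC; apply/funext => w; rewrite integralC_laplace_kernel.
rewrite (@integralC_fubini _ _ _ _ _ P3 mu _ (gkern (Re s) b)).
- congr integralC; apply/funext => v.
  transitivity (integralC P3 (fun w => (expC (s * v%:C) * (expR (- (b * expR v)))%:C) * expC (0 +i* (- expR v * W w)))).
    congr integralC; apply/funext => w; rewrite -(expC_real (- (b * expR v))) -!expCD; congr expC.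
    by apply: complex_eqP; rewrite ?cReD ?cImD ?cReN ?cImN ?cReM ?cImM /=; ring.
  rewrite integralCZ.
    rewrite char_W -mulrA -rmorphM; congr (_ * (_ * _)%:C); apply: eq_bigr => j _.
    (* The characteristic function is met at [- e^v]; evenness of [tanhc] removes the sign. *)
    by rewrite -tanhcN; congr (tanhc _ ^+ _); ring.
  split; apply: bounded_measurable_integrable.
    by under eq_fun do rewrite expC_imag; exact: (bounded_measurable_comp mW (bcos _)).
  by under eq_fun do rewrite expC_imag; exact: (bounded_measurable_comp mW (bsin _)).
- apply: measurable_funC_exp; apply: measurable_funCB; apply: measurable_funCM.
  + exact: measurable_funC_cst.
  + by apply: measurable_funC_real; exact: measurable_snd.
  + split => /=; first exact: measurable_cst.
    by apply: measurableT_comp; [exact: mW|exact: measurable_fst].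
  + by apply: measurable_funC_real; apply: measurableT_comp; [exact: measurable_expR|exact: measurable_snd].
- exact: integrable_gkern.
- by move=> w v; rewrite normc_laplace_kernel.
Qed.

End limit_law.

(** * The Stieltjes measure of the distribution function *)

Section stieltjes.
Context (R : realType) (d : measure_display) (T : measurableType d) (P : probability T R).
Variable W : {RV P >-> R}.

Let W' : T -> measurableTypeR R := W.

Let mW' : measurable_fun setT W'.
Proof. by move=> mT A mA; exact: (@measurable_funPT _ _ _ _ W mT A mA). Qed.

HB.instance Definition _ := isMeasurableFun.Build _ _ _ _ W' mW'.

(** By uniqueness of the extension it suffices to compare half-open intervals, where both sides
    equal [F(y) - F(x)]. *)
Lemma lebesgue_stieltjes_rcdf (A : set (measurableTypeR R)) : measurable A ->
  lebesgue_stieltjes_measure (rcdf W) A = distribution P (W' : {RV P >-> measurableTypeR R}) A.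
Proof.
move=> mA; apply: lebesgue_stieltjes_measure_unique => [I [[x y]]/= _ <- | //].
rewrite /lebesgue_stieltjes_measure /measure_extension/=.
rewrite measurable_mu_extE/=; last exact: is_ocitv.
have [xy | yx] := leP x y; last first.
  by rewrite set_itv_ge ?wlength0 ?measure0// bnd_simp -leNgt ltW.
rewrite wlength_itv_bnd// EFinB /rcdf !fineK ?fin_num_measure//.
rewrite /cdf /distribution /pushforward.
have e : `]x, y]%classic = `]-oo, y] `\` `]-oo, x] :> set R.
  by rewrite -[RHS]setCK setCD setCitvl setUC -[LHS]setCK setCitv.
have mI (z : R) : measurable (W @^-1` `]-oo, z]).
  by rewrite -[X in measurable X]setTI; exact: measurable_funPT.
have -> : W' @^-1` `]x, y] = (W @^-1` `]-oo, y]) `\` (W @^-1` `]-oo, x]) by rewrite e.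
rewrite measureD//; last by rewrite -ge0_fin_numE// fin_num_measure.
by rewrite setIidr// => w /=; rewrite !in_itv /= => /le_trans; exact.
Qed.

Lemma integralC_lebesgue_stieltjes (f : R -> R[i]) :
  measurable_funC (f : measurableTypeR R -> R[i]) -> integrableC P (fun w => f (W w)) ->
  integralC (lebesgue_stieltjes_measure (rcdf W)) f = integralC P (fun w => f (W w)).
Proof.
move=> [m1 m2] [i1 i2].
have h (g : R -> R) : measurable_fun setT (g : measurableTypeR R -> R) ->
    P.-integrable setT (fun w => (g (W w))%:E) ->
    \int[lebesgue_stieltjes_measure (rcdf W)]_x g x = \int[P]_w g (W w).
  move=> mg ig.
  have mg' : measurable_fun setT (fun u : measurableTypeR R => (g u)%:E) by exact/measurable_EFinP.
  rewrite /Rintegral; congr fine.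
  rewrite (eq_measure_integral (distribution P (W' : {RV P >-> measurableTypeR R}))); last first.
    by move=> A mA _; exact: lebesgue_stieltjes_rcdf.
  by rewrite (@integral_distribution _ _ _ _ _ P (W' : {RV P >-> measurableTypeR R}) (fun u => (g u)%:E) mg' ig).
by apply: complex_eqP => /=; [exact: h|exact: h].
Qed.

End stieltjes.

(** * Complex differentiability of the expectation *)

Section entire.
Context {R : realType}.

Lemma derivable_of_quadratic (g : R[i] -> R[i]) (s D : R[i]) (M : R) : 0 <= M ->
  (forall h, normc h <= 1 -> normc (g (h + s) - g s - h * D) <= M * normc h ^+ 2) ->
  derivable (g : R[i]^o -> R[i]^o) s 1.
Proof.
move=> M0 hM; apply/cvg_ex; exists (D : R[i]^o); apply/cvgrPdist_le => /= e e0.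
have eE : e = (Re e)%:C.
  by case: e e0 => x y; rewrite ltcE /= => /andP[/eqP -> _].
have re0 : 0 < Re e by rewrite eE ltcR in e0.
pose dl : R := Num.min 1 (Re e / (M + 1)).
have dl0 : 0 < dl by rewrite lt_min ltr01 divr_gt0// ltr_wpDl.
have dlC : 0 < (dl%:C : R[i]) by rewrite ltcR.
near=> h.
have h0 : h != 0 by near: h; exact: withinT.
have hd : `|(h : R[i]^o)| <= (dl%:C : R[i]) by near: h; exact: (@dnbhs0_le _ R[i]^o _ dlC).
rewrite normcK lecR in hd.
have h1 : normc h <= 1 by rewrite (le_trans hd)// ge_min lexx.
have n0 : 0 < normc h.
  by rewrite lt_neqAle normc_ge0 andbT eq_sym; apply/eqP => /ComplexField.Normc.eq0_normc/eqP; exact/negP.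
rewrite /GRing.scale /= mulr1 eE normcK lecR.
have -> : D - h^-1 * (g (h + s) - g s) = - (h^-1 * (g (h + s) - g s - h * D)).
  by rewrite [in RHS]mulrBr mulKf// opprB.
rewrite normc_opp normcM ComplexField.Normc.normcV ler_pdivrMl//.
apply: (le_trans (hM h h1)); rewrite expr2 mulrCA ler_wpM2l ?normc_ge0//.
have : normc h * (M + 1) <= Re e by rewrite -ler_pdivlMr ?ltr_wpDl// (le_trans hd)// ge_min lexx orbT.
by rewrite mulrDr mulr1 mulrC; have := normc_ge0 h; lra.
Unshelve. all: by end_near.
Qed.

End entire.

Section limit_law_analytic.
Context (R : realType) (r : nat) (alpha : 'I_r -> nat) (a : 'I_r -> R) (b : R).
Hypothesis alpha_gt0 : forall j, (0 < alpha j)%N.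
Hypothesis a_gt0 : forall j, 0 < a j.
Context (d2 : measure_display) (T2 : measurableType d2) (P2 : probability T2 R).
Context (hatT : 'I_r -> {RV P2 >-> R}).
Hypothesis hatT_char : forall (j : 'I_r) (theta : R),
  char_fun (hatT j) theta = (tanhc theta `^ (alpha j)%:R)%:C.
Context (d3 : measure_display) (T3 : measurableType d3) (P3 : probability T3 R).
Context (X : 'I_r -> {RV P3 >-> R}).
Hypothesis X_indep : mutually_independent X.
Hypothesis X_dist : forall j, eq_in_distribution P3 P2 (X j) (fun w => 2^-1 * hatT j w).
Context (W : {RV P3 >-> R}).
Hypothesis W_def : forall w, W w = \sum_j a j * X j w.
Hypothesis b_gt0 : 0 < b.
Notation mu := (@lebesgue_measure R).

(** The derivative is [E (- L (b + i W)^-s)] with [L = Log (b + i W)]. The remainder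
    [4 |h L|^2 e^|h L|] becomes [8 |h|^2 e^(2 |L|)] through [|L|^2 <= 2 e^|L|] and [|h| <= 1]. *)
Lemma expectation_powC_quadratic (s : R[i]) : exists (D : R[i]), exists2 M : R, 0 <= M &
  forall h, normc h <= 1 ->
  normc (integralC P3 (fun w => powC (b +i* W w) (- (h + s))) - integralC P3 (fun w => powC (b +i* W w) (- s)) - h * D)
    <= M * normc h ^+ 2.
Proof.
pose L w := LogC (b +i* W w).
have mW : measurable_fun setT W by exact: measurable_funPT.
have mL : measurable_funC L by exact: measurable_LogC_line.
have iG := integrable_exp_normc_LogC hatT_char X_indep X_dist W_def b_gt0.
have iP := integrableC_powC_line hatT_char X_indep X_dist W_def b_gt0.
(* One unit of the [2] absorbs [e^|h L|] and the other [|L|^2], on top of [e^(|s| |L|)] for the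
   power itself. *)
have [k hk] := exp_normc_bound b (normc s + 2).
have exn x : 0 <= x -> x <= expR x :> R by move=> x0; have := expR_ge1Dx x; lra.
have exn2 x : 0 <= x -> x ^+ 2 <= 2 * expR x :> R.
  by move=> x0; have := expR_ge1Dxn 1 x0; rewrite (_ : 2`!%:R = 2%:R :> R)//; lra.
have pw w : normc (powC (b +i* W w) (- s)) <= expR (normc s * normc (L w)).
  by have := normc_powC_line b (- s) (W w); rewrite normc_opp.
have iD : integrableC P3 (fun w => - (L w) * powC (b +i* W w) (- s)).
  apply: (integrableC_dominated _ (iG k)).
    by apply: measurable_funCM; [exact: measurable_funCN|exact: measurable_powC_line].
  move=> w; apply: le_trans (hk (W w)); rewrite normcM normc_opp -/(L w) mulrDl expRD mulrC.
  apply: ler_pM => //; rewrite ?normc_ge0//.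
  have n0 := normc_ge0 (L w); apply: (le_trans (exn _ n0)); rewrite ler_expR; lra.
exists (integralC P3 (fun w => - (L w) * powC (b +i* W w) (- s))).
exists (2 * (8 * \int[P3]_w expR (k%:R * normc (L w)))).
  by rewrite !mulr_ge0//; apply: Rintegral_ge0 => w _; rewrite expR_ge0.
move=> h h1.
rewrite -integralCZ// -integralCB// -integralCB//; first last.
- exact: integrableCZ.
- exact: integrableCB.
have -> : 2 * (8 * \int[P3]_w expR (k%:R * normc (L w))) * normc h ^+ 2 =
    2 * \int[P3]_w ((8 * normc h ^+ 2) * expR (k%:R * normc (L w))).
  by rewrite RintegralZl//; [ring|exact: iG].
apply: normc_integralC_le.
- by apply: integrableCB; [exact: integrableCB|exact: integrableCZ].
- by under eq_fun do rewrite EFinM; apply: integrableZl => //; exact: iG.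
move=> w.
have e1 : powC (b +i* W w) (- (h + s)) = powC (b +i* W w) (- s) * expC (- (h * L w)).
  by rewrite /powC -/(L w) -expCD; congr expC; ring.
have -> : powC (b +i* W w) (- (h + s)) - powC (b +i* W w) (- s) - h * (- L w * powC (b +i* W w) (- s)) =
    powC (b +i* W w) (- s) * (expC (- (h * L w)) - 1 - (- (h * L w))).
  by rewrite e1; ring.
rewrite normcM.
have n0 := normc_ge0 (L w); have h0 := normc_ge0 h.
have q := normc_expC_sub1_subz (- (h * L w)).
rewrite normc_opp [normc (h * L w)]normcM in q.
apply: (@le_trans _ _ (expR (normc s * normc (L w)) * (4 * (normc h * normc (L w)) ^+ 2 * expR (normc h * normc (L w))))).
  by apply: ler_pM; rewrite ?normc_ge0.
apply: (@le_trans _ _ (8 * normc h ^+ 2 * expR ((normc s + 2) * normc (L w)))); last first.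
  by rewrite ler_wpM2l ?mulr_ge0 ?sqr_ge0// hk.
move: (normc (L w)) n0 (normc h) h0 h1 => x x0 y y0 y1.
have -> : (normc s + 2) * x = normc s * x + x + x by ring.
rewrite !expRD exprMn.
have hx := exn2 _ x0.
have hy : expR (y * x) <= expR x by rewrite ler_expR ler_piMl.
have ex := expR_gt0 x.
have -> : expR (normc s * x) * (4 * (y ^+ 2 * x ^+ 2) * expR (y * x)) =
   (4 * y ^+ 2 * expR (normc s * x)) * (x ^+ 2 * expR (y * x)) by ring.
have -> : 8 * y ^+ 2 * (expR (normc s * x) * expR x * expR x) =
   (4 * y ^+ 2 * expR (normc s * x)) * ((2 * expR x) * expR x) by ring.
apply: ler_wpM2l; first by rewrite !mulr_ge0 ?expR_ge0 ?sqr_ge0.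
by apply: ler_pM => //; rewrite ?sqr_ge0 ?expR_ge0.
Qed.

Lemma bin_limit_tanhc v : \prod_j bin_limit alpha a v j * lt_weight alpha a b v =
  2 ^- (\sum_j alpha j)%N * (expR (- (b * expR v)) * \prod_j tanhc (a j * expR v / 2) ^+ alpha j).
Proof.
rewrite /lt_weight mulrCA [RHS]mulrCA; congr (_ * _).
have -> : (2 : R) ^- (\sum_j alpha j)%N = \prod_j (2^-1) ^+ alpha j by rewrite prodrXr exprVn.
rewrite -!big_split; apply: eq_bigr => j _ /=.
rewrite /bin_limit -exprVn -!exprMn; congr (_ ^+ _).
set x := a j * expR v; have x0 : 0 < x by rewrite mulr_gt0 ?expR_gt0.
have x2 : x / 2 != 0 by rewrite mulf_neq0// lt0r_neq0.
rewrite /tanhc (negPf x2) /tanh /unif_lt -/x.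
pose A := expR (x / 2); have A0 : 0 < A := expR_gt0 _.
have eA : expR (- (x / 2)) = A^-1 by rewrite expRN.
have ex : expR (- x) = A^-1 * A^-1 by rewrite -!eA -expRD; congr expR; field.
have ev : expR (- v) / a j = x^-1 by rewrite expRN /x; field; rewrite !lt0r_neq0 ?expR_gt0.
rewrite ev ex eA -/A; field.
by rewrite (lt0r_neq0 x0) (lt0r_neq0 A0) lt0r_neq0// addr_gt0// mulr_gt0.
Qed.

Lemma series_limitE s : (\sum_j alpha j)%N%:R < Re s ->
  series_limit alpha a b s =
  (2 ^- (\sum_j alpha j)%N)%:C * integralC P3 (fun w => powC (b +i* W w) (- s)).
Proof.
move=> hs; have s0 : 0 < Re s by apply: le_lt_trans hs.
rewrite /series_limit.
have -> : (fun v : R => expC (s * v%:C) * (\prod_j bin_limit alpha a v j * lt_weight alpha a b v)%:C) =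
   (fun v => (2 ^- (\sum_j alpha j)%N)%:C * (expC (s * v%:C) *
    (expR (- (b * expR v)) * \prod_j tanhc (a j * expR v / 2) ^+ alpha j)%:C)).
  by apply/funext => v; rewrite bin_limit_tanhc rmorphM mulrCA.
have iK : integrableC mu (fun v : R => expC (s * v%:C) * (\prod_j bin_limit alpha a v j * lt_weight alpha a b v)%:C).
  by apply: integrableC_mellin => //; [exact: measurable_bin_limit|move=> v; exact: bin_limit_le].
rewrite integralCZ.
  rewrite -(GammaC_expectation_line hatT_char X_indep X_dist W_def b_gt0 s0).
  by rewrite mulrCA mulKf// GammaC_neq0.
(* Integrability of the kernel without its constant is obtained by multiplying the integrable kernel
   back by [2^beta]. *)
have := integrableCZ ((2 ^+ (\sum_j alpha j)%N)%:C) iK.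
congr integrableC; apply/funext => v; rewrite mulrCA -rmorphM bin_limit_tanhc; congr (_ * _%:C).
by rewrite mulVKf// expf_neq0.
Qed.

End limit_law_analytic.

Theorem theorem3 (R : realType) (r : nat) (r_ge1 : (1 <= r)%N)
    (alpha : 'I_r -> nat) (alpha_gt0 : forall j, (0 < alpha j)%N)
    (a : 'I_r -> R) (a_gt0 : forall j, 0 < a j) (b : R) (b_gt0 : 0 < b)
    (c_neq0 : b - 2^-1 * (\sum_j a j * (alpha j)%:R) != 0)
    (d1 : measure_display) (T1 : measurableType d1) (P1 : probability T1 R)
    (U : forall j : 'I_r, 'I_(alpha j) -> {RV P1 >-> R})
    (U_unif : forall j (l : 'I_(alpha j)) (A : set R), measurable A ->
       distribution P1 (U j l) A = uniform_prob (@ltr01 R) A)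
    (U_indep : mutually_independent
       (fun k : {j : 'I_r & 'I_(alpha j)} => U (tag k) (tagged k)))
    (d2 : measure_display) (T2 : measurableType d2) (P2 : probability T2 R)
    (hatT : 'I_r -> {RV P2 >-> R})
    (hatT_char : forall (j : 'I_r) (theta : R),
       char_fun (hatT j) theta = (tanhc theta `^ (alpha j)%:R)%:C)
    (d3 : measure_display) (T3 : measurableType d3) (P3 : probability T3 R)
    (X : 'I_r -> {RV P3 >-> R})
    (X_indep : mutually_independent X)
    (X_dist : forall j, eq_in_distribution P3 P2
       (X j) (fun w => 2^-1 * hatT j w))
    (W : {RV P3 >-> R}) (W_def : forall w, W w = \sum_j a j * X j w) :
  let beta := (\sum_j alpha j)%N in
  (forall s : R[i], beta%:R < complex.Re s ->
     [/\ tanh_moment_cvg a b U s,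
         tanh_moment a b U s =
           (2 ^- beta)%:C *
           integralC (lebesgue_stieltjes_measure (rcdf W))
             (fun w : R => 1 / powC (b +i* w) s) &
         tanh_moment a b U s =
           (2 ^- beta)%:C *
           expectationC P3 (fun w => powC (b +i* W w) (- s))]) /\
  (exists g : R[i] -> R[i], entire g /\
     forall s : R[i], beta%:R < complex.Re s -> g s = tanh_moment a b U s).
Proof.
move=> beta.
pose E s := integralC P3 (fun w => powC (b +i* W w) (- s)).
have cvgS (s : R[i]) : beta%:R < Re s ->
    summability.partial_sum (tanh_moment_term a b U s : _ -> R[i]^o) @ summability.totally
      --> ((2 ^- beta)%:C * E s : R[i]^o).
  move=> hs; have := tanh_moment_partial_sum_cvg alpha_gt0 a_gt0 b_gt0 hs U_unif U_indep.
  by rewrite (series_limitE alpha_gt0 a_gt0 hatT_char X_indep X_dist W_def b_gt0 hs).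
have tF : ProperFilter (@summability.totally {ffun 'I_r -> nat}) := summability.totally_filter.
have sumE (s : R[i]) : beta%:R < Re s -> tanh_moment a b U s = (2 ^- beta)%:C * E s.
  move=> hs; exact: (@cvg_lim R[i]^o (@norm_hausdorff _ R[i]^o) _ _ tF _ _ (cvgS s hs)).
split.
  move=> s hs; split.
  - by apply/cvg_ex; eexists; exact: cvgS.
  - rewrite sumE//; congr (_ * _); apply/esym.
    under eq_fun do rewrite -powCN.
    apply: integralC_lebesgue_stieltjes; last exact: (integrableC_powC_line hatT_char X_indep X_dist W_def b_gt0).
    exact: (@measurable_powC_line _ _ b_gt0 _ (measurableTypeR R) idfun (@measurable_id _ _ _)).
  - by rewrite sumE// expectationCE.
(* The expectation is finite for every complex [s], so the right-hand side is itself the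
   continuation. *)
exists (fun s => (2 ^- beta)%:C * E s); split; last by move=> s hs; rewrite sumE.
move=> s; have [D [M M0 hM]] := expectation_powC_quadratic hatT_char X_indep X_dist W_def b_gt0 s.
apply: (@derivable_of_quadratic _ _ s ((2 ^- beta)%:C * D) (normc (2 ^- beta)%:C * M)).
  by rewrite mulr_ge0// normc_ge0.
move=> h h1; have -> : (2 ^- beta)%:C * E (h + s) - (2 ^- beta)%:C * E s - h * ((2 ^- beta)%:C * D) =
    (2 ^- beta)%:C * (E (h + s) - E s - h * D) by ring.
by rewrite normcM -mulrA ler_wpM2l ?normc_ge0// hM.
Qed.
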